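(* Let $\varphi_0:\mathbb{R}^n\to\mathbb{R}$ and $g:\mathbb{R}^n\to\mathbb{R}^m$ be $\mathcal{C}^2$-smooth, let $\psi:\mathbb{R}^m\to\overline{\mathbb{R}}$ be l.s.c., and consider the composite problem of minimizing $\varphi(x):=\varphi_0(x)+\psi(g(x))$ over $x\in\mathbb{R}^n$. Let $\bar x$ be a stationary point of this problem (i.e. $0\in\partial\varphi(\bar x)$) at which $\operatorname{rank}\nabla g(\bar x)=m$, and hence there exists a unique vector $\bar y\in\mathbb{R}^m$ with $$\nabla\varphi_0(\bar x)+\nabla g(\bar x)^*\bar y=0\quad\text{and}\quad\bar y\in\partial\psi(g(\bar x)).$$ Suppose in addition that $\psi$ is subdifferentially continuous at $g(\bar x)$ for $\bar y$. Then: (i) The variational sufficient condition for local optimality holds at $\bar x$ if and only if $\psi$ is prox-regular at $g(\bar x)$ for $\bar y$ and there exist neighborhoods $U$ of $\bar x$ and $V$ of $0$ such that $$\langle\nabla^2\varphi_0(x)w,w\rangle+\langle\nabla^2\langle y,g\rangle(x)w,w\rangle+\langle u,\nabla g(x)w\rangle\ge0$$ for all $x\in U$, $v\in V$, $y\in\Lambda(x,v)$, $u\in\partial^2\psi(g(x),y)(\nabla g(x)w)$, $w\in\mathbb{R}^n$, where $\Lambda(x,v)$ is a singleton in this case (for $(x,v)$ near $(\bar x,0)$ with $v\in\partial\varphi(x)$). (ii) For $\sigma>0$, the strong variational sufficient condition for local optimality holds at $\bar x$ with modulus $\sigma$ if and only if $\psi$ is prox-regular at $g(\bar x)$ for $\bar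 y$ and there exist neighborhoods $U$ of $\bar x$ and $V$ of $0$ such that $$\langle\nabla^2\varphi_0(x)w,w\rangle+\langle\nabla^2\langle y,g\rangle(x)w,w\rangle+\langle u,\nabla g(x)w\rangle\ge\sigma\|w\|^2$$ for all $x\in U$, $v\in V$, $y\in\Lambda(x,v)$, $u\in\partial^2\psi(g(x),y)(\nabla g(x)w)$, $w\in\mathbb{R}^n$, where $\Lambda(x,v)$ is a singleton in this case (for $(x,v)$ near $(\bar x,0)$ with $v\in\partial\varphi(x)$). Furthermore, the strong variational sufficiency in (ii) with some modulus $\sigma>0$ is equivalent to the prox-regularity of $\psi$ at $g(\bar x)$ for $\bar y$ together with the condition $$\langle\nabla^2\varphi_0(\bar x)w,w\rangle+\langle\nabla^2\langle\bar y,g\rangle(\bar x)w,w\rangle+\langle u,\nabla g(\bar x)w\rangle>0\quad\text{whenever } u\in\partial^2\psi(g(\bar x),\bar y)(\nabla g(\bar x)w),\ w\ne0.$$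
   Context: Conventions: $\overline{\mathbb{R}}:=(-\infty,\infty]$; every extended-real-valued function is assumed proper (not identically $\infty$), $\operatorname{dom}\varphi:=\{x\mid\varphi(x)<\infty\}$. $\mathbb{B}_\epsilon(a)$ is the closed ball with center $a$ and radius $\epsilon$; l.s.c. means lower semicontinuous; $\nabla g(x)$ is the Jacobian and $\nabla g(x)^*$ its transpose; $\nabla^2\langle y,g\rangle(x)$ is the Hessian at $x$ of the function $x\mapsto\langle y,g(x)\rangle$. Subdifferentials (for any $\varphi$, in any $\mathbb{R}^n$): for $\bar x\in\operatorname{dom}\varphi$, $$\widehat\partial\varphi(\bar x)=\Big\{v\;\Big|\;\liminf_{x\to\bar x}\frac{\varphi(x)-\varphi(\bar x)-\langle v,x-\bar x\rangle}{\|x-\bar x\|}\ge 0\Big\},$$ and the limiting subdifferential $\partial\varphi(\bar x)$ is the set of all $v$ for which there are $x_k\to\bar x$ with $\varphi(x_k)\to\varphi(\bar x)$ and $v_k\in\widehat\partial\varphi(x_k)$ with $v_k\to v$ (and $\partial\varphi(\bar x)=\emptyset$ if $\bar x\notin\operatorname{dom}\varphi$). The limiting normal cone is $N_\Omega(\bar x):=\partial\delta_\Omega(\bar x)$, with $\delta_\Omega$ the indicator function. Limiting second-order subdifferential: for $(z,y)\in\operatorname{gph}\partial\psi$, $\partial^2\psi(z,y)(w):=\{u\mid(u,-w)\in N_{\operatorname{gph}\partial\psi}(z,y)\}$. Multipliers: $\Lambda(x,v):=\{y\in\mathbb{R}^m\mid v=\nabla\varphi_0(x)+\nabla g(x)^*y,\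 y\in\partial\psi(g(x))\}$. Variational convexity: an l.s.c. function $\varphi$ is variationally convex at $\bar x$ for $\bar v\in\partial\varphi(\bar x)$ if for some convex neighborhood $U\times V$ of $(\bar x,\bar v)$ there exist an l.s.c. convex function $\theta\le\varphi$ on $U$ and $\epsilon>0$ such that $(U_\epsilon\times V)\cap\operatorname{gph}\partial\varphi=(U\times V)\cap\operatorname{gph}\partial\theta$ and $\varphi(x)=\theta(x)$ at the common elements $(x,v)$, where $U_\epsilon:=\{x\in U\mid\varphi(x)<\varphi(\bar x)+\epsilon\}$. It is variationally strongly convex with modulus $\sigma>0$ if this holds with $\theta-\frac\sigma2\|\cdot\|^2$ convex on $U$. The variational sufficient condition for local optimality holds at $\bar x$ if $\varphi$ is variationally convex at $\bar x$ for $0\in\partial\varphi(\bar x)$; the strong variational sufficient condition holds at $\bar x$ with modulus $\sigma$ if $\varphi$ is variationally strongly convex at $\bar x$ for $0$ with modulus $\sigma$. Prox-regularity: an l.s.c. function $\psi$ is prox-regular at $\bar z\in\operatorname{dom}\psi$ for $\bar y\in\partial\psi(\bar z)$ if there exist $\epsilon>0$ and $r\ge0$ such that $\psi(z)\ge\psi(u)+\langle y,z-u\rangle-\frac r2\|z-u\|^2$ for all $z\in\mathbb{B}_\epsilon(\bar z)$ and all $(u,y)\in\operatorname{gph}\partial\psi\cap(\mathbb{B}_\epsilon(\bar z)\times\mathbb{B}_\epsilon(\bar y))$ with $\psi(u)<\psi(\bar z)+\epsilon$. Subdifferential continuity of $\psi$ at $\bar z$ for $\bar y$: for every $\epsilon>0$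 there is $\delta>0$ such that $|\psi(z)-\psi(\bar z)|<\epsilon$ whenever $(z,y)\in\operatorname{gph}\partial\psi\cap(\mathbb{B}_\delta(\bar z)\times\mathbb{B}_\delta(\bar y))$. *)

(* Defs.v *)
From HB Require Import structures.
From mathcomp Require Import all_boot all_order all_algebra.
From mathcomp Require Import all_classical all_reals all_analysis.
Import Order.TTheory GRing.Theory Num.Theory.
Import numFieldNormedType.Exports.
Set Implicit Arguments.
Unset Strict Implicit.
Unset Printing Implicit Defensive.
Local Open Scope classical_set_scope.
Local Open Scope ring_scope.

(* Elements of R^n are row vectors, and matrices act on the right: the library
   Jacobian ['J g x] is the transpose of the usual one, so that
   [w *m 'J g x] is the usual  nabla g(x) w  and
   [y *m ('J g x)^T] is the usual  nabla g(x)^* y.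

   Extended-real-valued functions are maps into [\bar R] subject to [proper_efun]. *)

Section Euclidean.
Context {R : realType} {n : nat}.
Implicit Types u v a x : 'rV[R]_n.

Definition dotv u v : R := \sum_(i < n) u 0 i * v 0 i.

(* The library norm on matrices is the max norm; it induces the same topology,
   but quotients, balls and moduli below need the Euclidean norm. *)
Definition enorm u : R := Num.sqrt (dotv u u).

Definition eball a (e : R) : set 'rV[R]_n := [set x | enorm (x - a) <= e].

End Euclidean.

Section Smooth.
Context {R : realType} {n : nat}.
Implicit Types f : 'rV[R]_n -> R.

Definition gradient f (x : 'rV[R]_n) : 'rV[R]_n :=
  \row_(i < n) 'D_(delta_mx 0 i) f x.

Definition hessian f (x : 'rV[R]_n) : 'M[R]_n := 'J (gradient f) x.

Definition C2_scalar f : Prop :=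
  [/\ forall x, differentiable f x,
      forall x, differentiable (gradient f) x
    & continuous (hessian f)].

Definition C2 {m : nat} (g : 'rV[R]_n -> 'rV[R]_m) : Prop :=
  forall j : 'I_m, C2_scalar (fun x => g x 0 j).

End Smooth.

Section Extended.
Context {R : realType} {n : nat}.
Implicit Types (f : 'rV[R]_n -> \bar R) (U : set 'rV[R]_n).
Local Open Scope ereal_scope.

Definition edom f : set 'rV[R]_n := [set x | f x < +oo].

Definition proper_efun f : Prop := (forall x, -oo < f x) /\ edom f !=set0.

Definition convex_on U f : Prop :=
  forall (x y : 'rV[R]_n) (t : R), U x -> U y -> (0 < t < 1)%R ->
    f (t *: x + (1 - t) *: y)%R <= t%:E * f x + (1 - t)%:E * f y.

End Extended.

Section Subdifferential.
Context {R : realType} {n : nat}.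
Implicit Types (f : 'rV[R]_n -> \bar R) (W : set 'rV[R]_n).
Local Open Scope ereal_scope.

Definition regular_subdiff f (xbar : 'rV[R]_n) : set 'rV[R]_n :=
  [set v | edom f xbar /\
    0 <= limf_einf
           (fun x => (f x - f xbar - (dotv v (x - xbar)%R)%:E)
                     * ((enorm (x - xbar)%R)^-1)%:E)
           xbar^'].

Definition subdiff f (xbar : 'rV[R]_n) : set 'rV[R]_n :=
  [set v | edom f xbar /\
    exists (xk vk : nat -> 'rV[R]_n),
      [/\ xk @ \oo --> xbar,
          (fun k => f (xk k)) @ \oo --> f xbar,
          forall k, regular_subdiff f (xk k) (vk k)
        & vk @ \oo --> v]].

Definition eindicator W (x : 'rV[R]_n) : \bar R := if x \in W then 0 else +oo.

Definition normal_cone W (xbar : 'rV[R]_n) : set 'rV[R]_n :=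
  subdiff (eindicator W) xbar.

Definition gph (F : 'rV[R]_n -> set 'rV[R]_n) : set ('rV[R]_n * 'rV[R]_n) :=
  [set p | F p.1 p.2].

End Subdifferential.

(* R^m x R^m is identified with R^(m + m) in order to take normal cones. *)
Definition second_subdiff {R : realType} {m : nat} (psi : 'rV[R]_m -> \bar R)
    (z y w : 'rV[R]_m) : set 'rV[R]_m :=
  [set u | normal_cone [set row_mx p.1 p.2 | p in gph (subdiff psi)]
             (row_mx z y) (row_mx u (- w))].

Section Variational.
Context {R : realType} {n : nat}.
Implicit Types (f theta : 'rV[R]_n -> \bar R) (U V : set 'rV[R]_n).
Local Open Scope ereal_scope.

Definition var_convex_witness f (xbar vbar : 'rV[R]_n) U V theta (eps : R) :=
  let Ueps := [set x | U x /\ f x < f xbar + eps%:E] in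
  [/\ [/\ nbhs xbar U, nbhs vbar V, convex_set U & convex_set V],
      [/\ proper_efun theta, lower_semicontinuous theta, convex_on setT theta
        & forall x, U x -> theta x <= f x],
      (0 < eps)%R,
      (Ueps `*` V) `&` gph (subdiff f) = (U `*` V) `&` gph (subdiff theta)
    & forall x v, ((U `*` V) `&` gph (subdiff theta)) (x, v) -> f x = theta x].

Definition variationally_convex f (xbar vbar : 'rV[R]_n) : Prop :=
  [/\ lower_semicontinuous f, subdiff f xbar vbar
    & exists U V theta eps, var_convex_witness f xbar vbar U V theta eps].

Definition variationally_strongly_convex (sigma : R) f (xbar vbar : 'rV[R]_n)
    : Prop :=
  [/\ lower_semicontinuous f, subdiff f xbar vbar
    & exists U V theta eps, var_convex_witness f xbar vbar U V theta eps /\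
        convex_on U (fun x => theta x - (sigma / 2 * enorm x ^+ 2)%:E)].

Definition variational_sufficiency f (xbar : 'rV[R]_n) : Prop :=
  variationally_convex f xbar 0%R.

Definition strong_variational_sufficiency (sigma : R) f (xbar : 'rV[R]_n)
    : Prop :=
  variationally_strongly_convex sigma f xbar 0%R.

Definition prox_regular f (zbar ybar : 'rV[R]_n) : Prop :=
  [/\ lower_semicontinuous f, subdiff f zbar ybar
    & exists eps r : R, [/\ (0 < eps)%R, (0 <= r)%R &
        forall z u y : 'rV[R]_n, eball zbar eps z ->
          gph (subdiff f) (u, y) -> eball zbar eps u -> eball ybar eps y ->
          f u < f zbar + eps%:E ->
          f u + (dotv y (z - u)%R)%:E - (r / 2 * enorm (z - u)%R ^+ 2)%:E
            <= f z]].

Definition subdiff_continuous f (zbar ybar : 'rV[R]_n) : Prop :=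
  forall eps : R, (0 < eps)%R -> exists2 delta : R, (0 < delta)%R &
    forall z y : 'rV[R]_n, gph (subdiff f) (z, y) ->
      eball zbar delta z -> eball ybar delta y ->
      `|f z - f zbar| < eps%:E.

End Variational.

Section Composite.
Context {R : realType} {n m : nat}.
Variables (phi0 : 'rV[R]_n -> R) (g : 'rV[R]_n -> 'rV[R]_m)
  (psi : 'rV[R]_m -> \bar R).

Definition composite (x : 'rV[R]_n) : \bar R := ((phi0 x)%:E + psi (g x))%E.

Definition Lambda (x v : 'rV[R]_n) : set 'rV[R]_m :=
  [set y | v = gradient phi0 x + y *m ('J g x)^T /\ subdiff psi (g x) y].

Definition second_order_form (x : 'rV[R]_n) (y u : 'rV[R]_m) (w : 'rV[R]_n)
    : R :=
  dotv (w *m hessian phi0 x) w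
  + dotv (w *m hessian (fun x' => dotv y (g x')) x) w
  + dotv u (w *m 'J g x).

End Composite.

(* Main.v *)
Require Import Defs.
From HB Require Import structures.
From mathcomp Require Import all_boot all_order all_algebra.
From mathcomp Require Import all_classical all_reals all_analysis.
From mathcomp Require Import ring lra.
Import Order.TTheory GRing.Theory Num.Theory.
Import numFieldNormedType.Exports.
Local Open Scope classical_set_scope.
Local Open Scope ring_scope.

(* Call [f] of growth [s] at [xb] if, for subgradients [v] of [f] at [u] with
   [(u, v)] near [(xb, 0)], f(x) >= f(u) + <v, x - u> + (s/2) |x - u|^2 for all
   [x] near [xb].  Prox-regularity is growth with some negative [s], up to a
   tilt.  Growth with [s >= 0] is (strong) variational convexity with modulus
   [s]: the supremum of the quadratic minorants above is a convex witness.

   Under growth with negative [s] the proximal mapping X of [f] with parameter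
   mu is single-valued and Lipschitz, and X together with V(p) = (p - X(p))/mu
   parametrises the graph of the subdifferential.  Testing regular normals
   (p, -w) to that graph against the resulting displacements turns growth [s]
   into <p, w> >= s |w|^2.  Conversely, such a bound on normals bounds the slopes
   of the proximal subgradients of <d, V(.)>, so V is monotone by a mean value
   argument, and monotonicity of the gradient V of the Moreau envelope is
   integrated back to growth.

   As the Jacobian of [g] at [xb] has full rank, [g] is metrically regular near
   [xb]; this transfers subgradients and graph normals between [psi] and the
   composite function, the Hessian of the Lagrangian being the correction term.
   The pointwise positivity condition implies a uniform one by compactness:
   since [p] is bounded by |w + mu p| for regular normals (p, -w), violating
   normals scaled to |w + mu p| = 1 cluster at a violation at [xb]. *)

(** In the coordinate [x + mu v] the graph of the subdifferential of a prox-regular function becomes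
    the graph of a Lipschitz map [V], and a regular normal [(p, -w)] becomes a subgradient [p] of
    [<q, V(.)>] with [q = w + mu p]. This is why normals enter through [w + mu p]: a bound
    [<p, w> >= s |w|^2] turns into [<p, q> >= c |q|^2] with [c = s / (1 + mu s)], the convexity
    modulus of the Moreau envelope of an [s]-strongly convex function, and [s = c / (1 - c mu)]
    recovers [s] without loss. Unlike [w], the vector [q] controls [p]: already for [|x|] at its
    kink there are normals with [w = 0] and [p <> 0], so a compactness argument on [|w| = 1] would
    fail. Limiting normals at one point are limits of regular normals at other points; all estimates
    are therefore made for regular normals over a whole neighbourhood, and limits are taken only
    where [second_subdiff] appears. Growth also localises in function values; subdifferential
    continuity of [psi], carried over to the composite function, makes that restriction
    automatic. *)

Ltac below_min := rewrite !ge_min lexx ?orbT.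
Ltac row_ring := apply/rowP => i; rewrite !mxE; ring.
Ltac le_of_eq := rewrite le_eqVlt; apply/orP; left; apply/eqP.

(** * Euclidean inner product and norm on row vectors *)

Section Vectors.
Context {R : realType} {n : nat}.
Implicit Types (u v w x y : 'rV[R]_n) (k : R).

Lemma dotvC u v : dotv u v = dotv v u.
Proof. by apply: eq_bigr => i _; rewrite mulrC. Qed.

Lemma dotvDl u v w : dotv (u + v) w = dotv u w + dotv v w.
Proof. by rewrite /dotv -big_split; apply: eq_bigr => i _; rewrite mxE mulrDl. Qed.

Lemma dotvZl k u v : dotv (k *: u) v = k * dotv u v.
Proof. by rewrite /dotv mulr_sumr; apply: eq_bigr => i _; rewrite mxE mulrA. Qed.

Lemma dotvNl u v : dotv (- u) v = - dotv u v.
Proof. by rewrite -scaleN1r dotvZl mulN1r. Qed.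

Lemma dotvBl u v w : dotv (u - v) w = dotv u w - dotv v w.
Proof. by rewrite dotvDl dotvNl. Qed.

Lemma dot0v u : dotv 0 u = 0.
Proof. by rewrite -(scale0r 0) dotvZl mul0r. Qed.

Lemma dotvDr u v w : dotv w (u + v) = dotv w u + dotv w v.
Proof. by rewrite dotvC dotvDl !(dotvC w). Qed.

Lemma dotvZr k u v : dotv u (k *: v) = k * dotv u v.
Proof. by rewrite dotvC dotvZl dotvC. Qed.

Lemma dotvNr u v : dotv u (- v) = - dotv u v.
Proof. by rewrite dotvC dotvNl dotvC. Qed.

Lemma dotvBr u v w : dotv w (u - v) = dotv w u - dotv w v.
Proof. by rewrite dotvDr dotvNr. Qed.

Lemma dotv0 u : dotv u 0 = 0.
Proof. by rewrite dotvC dot0v. Qed.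

Definition dotvE :=
  (dotvDl, dotvDr, dotvNl, dotvNr, dotvZl, dotvZr, dot0v, dotv0).

Lemma dotvv_ge0 u : 0 <= dotv u u.
Proof. by apply: sumr_ge0 => i _; rewrite -expr2 sqr_ge0. Qed.

Lemma dotvv_eq0 u : (dotv u u == 0) = (u == 0).
Proof.
apply/eqP/eqP => [/eqP|->]; last by rewrite dot0v.
rewrite psumr_eq0 => [/allP u0|i _]; last by rewrite -expr2 sqr_ge0.
apply/rowP => i; rewrite mxE; have := u0 i (mem_index_enum _).
by rewrite mulf_eq0 orbb => /eqP.
Qed.

Lemma enorm_ge0 u : 0 <= enorm u.
Proof. exact: sqrtr_ge0. Qed.
Hint Resolve enorm_ge0 : core.

Lemma enorm_sq u : enorm u ^+ 2 = dotv u u.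
Proof. by rewrite sqr_sqrtr // dotvv_ge0. Qed.

Lemma enorm0 : enorm (0 : 'rV[R]_n) = 0.
Proof. by rewrite /enorm dot0v sqrtr0. Qed.

Lemma enorm_eq0 u : (enorm u == 0) = (u == 0).
Proof. by rewrite -dotvv_eq0 -enorm_sq sqrf_eq0. Qed.

Lemma enorm_gt0 u : (0 < enorm u) = (u != 0).
Proof. by rewrite lt_def enorm_ge0 andbT enorm_eq0. Qed.

Lemma enormZ k u : enorm (k *: u) = `|k| * enorm u.
Proof.
by rewrite /enorm dotvZl dotvZr mulrA -expr2 sqrtrM ?sqr_ge0 // sqrtr_sqr.
Qed.

Lemma enormN u : enorm (- u) = enorm u.
Proof. by rewrite -scaleN1r enormZ normrN1 mul1r. Qed.

Lemma enormBC u v : enorm (u - v) = enorm (v - u).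
Proof. by rewrite -enormN opprB. Qed.

Lemma CauchySchwarz u v : dotv u v ^+ 2 <= dotv u u * dotv v v.
Proof.
have [->|v0] := eqVneq v 0; first by rewrite !dotv0 expr0n mulr0.
have v_gt0 : 0 < dotv v v by rewrite lt_def dotvv_eq0 v0 dotvv_ge0.
have := dotvv_ge0 (dotv v v *: u - dotv u v *: v).
rewrite !dotvE (dotvC v u) => h.
rewrite -subr_ge0 -(pmulr_rge0 _ v_gt0); apply: le_trans h _.
by le_of_eq; ring.
Qed.

Lemma dotv_le_enorm u v : dotv u v <= enorm u * enorm v.
Proof.
apply: le_trans (ler_norm _) _.
rewrite -(@ler_pXn2r _ 2) ?nnegrE ?mulr_ge0 //.
by rewrite real_normK ?num_real // exprMn !enorm_sq CauchySchwarz.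
Qed.

Lemma dotv_geN_enorm u v : - (enorm u * enorm v) <= dotv u v.
Proof. by rewrite lerNl -dotvNl -(enormN u) dotv_le_enorm. Qed.

Lemma normr_dotv_le u v : `|dotv u v| <= enorm u * enorm v.
Proof. by rewrite ler_norml dotv_geN_enorm dotv_le_enorm. Qed.

Lemma enormD u v : enorm (u + v) <= enorm u + enorm v.
Proof.
rewrite -(@ler_pXn2r _ 2) ?nnegrE ?addr_ge0 // enorm_sq.
rewrite sqrrD !enorm_sq !dotvE (dotvC v u).
by have := dotv_le_enorm u v; lra.
Qed.

Lemma enormB u v : enorm (u - v) <= enorm u + enorm v.
Proof. by rewrite -(enormN v) enormD. Qed.

Lemma enorm_triangle w u v : enorm (u - v) <= enorm (u - w) + enorm (w - v).
Proof. by rewrite -[u - v](subrKA w) enormD. Qed.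

Lemma enorm_le_sq u k : 0 <= k -> (enorm u <= k) = (dotv u u <= k ^+ 2).
Proof. by move=> k0; rewrite -enorm_sq ler_pXn2r ?nnegrE. Qed.

Lemma ler_enorm_sq u v : (enorm u <= enorm v) = (dotv u u <= dotv v v).
Proof. by rewrite enorm_le_sq // enorm_sq. Qed.

Lemma enorm_coord u i : `|u 0 i| <= enorm u.
Proof.
rewrite -sqrtr_sqr ler_sqrt ?dotvv_ge0 // /dotv (bigD1 i) //= -expr2 lerDl.
by apply: sumr_ge0 => j _; rewrite -expr2 sqr_ge0.
Qed.

Lemma enorm_le_sum u : enorm u <= \sum_(i < n) `|u 0 i|.
Proof.
rewrite enorm_le_sq ?sumr_ge0 // expr2 mulr_suml ler_sum // => i _.
apply: le_trans (ler_norm _) _; rewrite normrM ler_wpM2l //.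
by rewrite (bigD1 i) //= lerDl sumr_ge0.
Qed.

Lemma dotv_delta i u : dotv u (delta_mx 0 i) = u 0 i.
Proof.
rewrite /dotv (bigD1 i) //= mxE !eqxx mulr1 big1 ?addr0 // => j /negPf ji.
by rewrite mxE eqxx ji mulr0.
Qed.

Lemma dotv_ext u v : (forall w, dotv u w = dotv v w) -> u = v.
Proof. by move=> h; apply/rowP => i; rewrite -!dotv_delta. Qed.

End Vectors.
#[export] Hint Extern 0 (is_true (0 <= enorm _)) => apply: enorm_ge0 : core.

Section VectorMatrix.
Context {R : realType} {n m : nat}.

Lemma dotv_mulmxl (w : 'rV[R]_n) (A : 'M[R]_(n, m)) (v : 'rV[R]_m) :
  dotv (w *m A) v = dotv w (v *m A^T).
Proof.
have dE k (a b : 'rV[R]_k) : dotv a b = (a *m b^T) 0 0.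
  by rewrite mxE; apply: eq_bigr => i _; rewrite mxE.
by rewrite !dE trmx_mul trmxK mulmxA.
Qed.

Lemma enorm_mulmx (A : 'M[R]_(n, m)) :
  exists2 K : R, 0 <= K & forall w : 'rV[R]_n, enorm (w *m A) <= K * enorm w.
Proof.
exists (\sum_(j < m) enorm (col j A)^T).
  by apply: sumr_ge0.
move=> w; apply: le_trans (enorm_le_sum _) _.
rewrite mulr_suml ler_sum // => j _.
have -> : (w *m A) 0 j = dotv (col j A)^T w.
  by rewrite mxE; apply: eq_bigr => i _; rewrite !mxE mulrC.
exact: normr_dotv_le.
Qed.

Lemma dotv_row_mx (u u' : 'rV[R]_n) (v v' : 'rV[R]_m) :
  dotv (row_mx u v) (row_mx u' v') = dotv u u' + dotv v v'.
Proof.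
rewrite /dotv big_split_ord; congr (_ + _); apply: eq_bigr => i _.
  by rewrite !row_mxEl.
by rewrite !row_mxEr.
Qed.

Lemma enorm_row_mxl (u : 'rV[R]_n) (v : 'rV[R]_m) : enorm u <= enorm (row_mx u v).
Proof. by rewrite enorm_le_sq // enorm_sq dotv_row_mx lerDl dotvv_ge0. Qed.

Lemma enorm_row_mxr (u : 'rV[R]_n) (v : 'rV[R]_m) : enorm v <= enorm (row_mx u v).
Proof. by rewrite enorm_le_sq // enorm_sq dotv_row_mx lerDr dotvv_ge0. Qed.

Lemma enorm_row_mx (u : 'rV[R]_n) (v : 'rV[R]_m) :
  enorm (row_mx u v) <= enorm u + enorm v.
Proof.
rewrite enorm_le_sq ?addr_ge0 // dotv_row_mx sqrrD !enorm_sq lerD2r lerDl.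
by rewrite mulrn_wge0 // mulr_ge0.
Qed.

End VectorMatrix.

(** * Euclidean balls, compactness and attained minima *)

Section Topology.
Context {R : realType} {n : nat}.
Implicit Types (x y : 'rV[R]_n) (U : set 'rV[R]_n).

Lemma mx_norm_le_enorm x : `|x| <= enorm x.
Proof.
rewrite [leLHS]/Num.norm /= mx_normrE; apply: bigmax_le => // -[i j] _ /=.
by rewrite ord1 enorm_coord.
Qed.

Lemma enorm_le_mx_norm x : enorm x <= n%:R * `|x|.
Proof.
apply: le_trans (enorm_le_sum _) _.
rewrite -[n in n%:R]card_ord -sum1_card natr_sum mulr_suml ler_sum // => i _.
rewrite mul1r [leRHS]/Num.norm /= mx_normrE.
by apply/bigmax_geP; right; exists (0, i).
Qed.

Lemma nbhs_enorm x U :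
  nbhs x U <-> exists2 e : R, 0 < e & forall y, enorm (y - x) < e -> U y.
Proof.
split=> [/nbhs_ballP[e /= e0 eU]|[e e0 eU]].
  exists e => // y yx; apply: eU; rewrite -ball_normE /= distrC.
  exact: le_lt_trans (mx_norm_le_enorm _) yx.
(* [n.+1] instead of [n] keeps the radius positive in dimension zero. *)
apply/nbhs_ballP; exists (e / n.+1%:R) => /=; first by rewrite divr_gt0.
move=> y; rewrite -ball_normE /= distrC => yx; apply: eU.
apply: le_lt_trans (enorm_le_mx_norm _) _.
rewrite ltr_pdivlMr // in yx; apply: le_lt_trans yx.
by rewrite mulrC ler_wpM2l // ler_nat.
Qed.

Lemma cvg_enorm (xk : nat -> 'rV[R]_n) x :
  xk @ \oo --> x <->
  forall e : R, 0 < e -> exists N, forall k, (N <= k)%N -> enorm (xk k - x) < e.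
Proof.
split=> [xkx e e0|h].
  have /xkx[N _ hN] : nbhs x [set y | enorm (y - x) < e].
    by apply/nbhs_enorm; exists e.
  by exists N => k /hN.
move=> U /nbhs_enorm[e e0 eU]; have [N hN] := h _ e0.
by exists N => // k /hN /eU.
Qed.

Lemma near_enorm x e : 0 < e -> \forall y \near x, enorm (y - x) < e.
Proof. by move=> e0; apply/nbhs_enorm; exists e. Qed.

End Topology.

Section TopologyContinued.
Context {R : realType} {n : nat}.
Implicit Types (x y : 'rV[R]_n).

Lemma continuous_enorm {m} (f : 'rV[R]_n -> 'rV[R]_m) x :
  {for x, continuous f} <->
  forall e : R, 0 < e -> exists2 d : R, 0 < d &
    forall y, enorm (y - x) < d -> enorm (f y - f x) < e.
Proof.
split=> [fx e e0|h].
  have /fx/nbhs_enorm[d d0 hd] := near_enorm (f x) e e0.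
  by exists d.
move=> U /nbhs_enorm[e e0 eU]; have [d d0 hd] := h _ e0.
by apply/nbhs_enorm; exists d => // y /hd /eU.
Qed.

Lemma compact_eball x e : compact (eball x e).
Proof.
apply: bounded_closed_compact.
  exists (enorm x + e); split; first exact: num_real.
  move=> M xM y /= yx; apply: le_trans (mx_norm_le_enorm _) _.
  apply: le_trans (ltW xM); rewrite -[y](subrK x).
  by apply: le_trans (enormD _ _) _; rewrite [leRHS]addrC lerD2r.
move=> y yx; rewrite /eball /= leNgt; apply/negP => ey.
have /yx[z [/= zx]] : nbhs y [set z | enorm (z - y) < enorm (y - x) - e].
  by apply/nbhs_enorm; exists (enorm (y - x) - e) => //; rewrite subr_gt0.
apply/negP; rewrite -leNgt lerBlDr.
apply: le_trans (enorm_triangle z _ _) _; rewrite (enormBC y) lerD2l.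
exact: zx.
Qed.

End TopologyContinued.

Section LscMin.
Context {R : realType}.

(** Sublevel sets [{f < a}] with [a] above the infimum form a filter base on [A]; lower
    semicontinuity at a cluster point keeps its value below every such [a]. *)
Lemma lsc_compact_min (T : topologicalType) (f : T -> \bar R) (A : set T) :
  lower_semicontinuous f -> compact A -> A !=set0 ->
  exists2 c, A c & forall t, A t -> (f c <= f t)%E.
Proof.
move=> flsc cA [a0 Aa0].
pose m := ereal_inf (f @` A).
(* With [m = +oo] there is no [a > m] to index the filter base, but then [f] is constantly [+oo] on
   [A]. *)
have [fa0y|fa0] := eqVneq m +oo%E.
  exists a0 => // t At; have /= := ereal_inf_lbound (imageP f At).
  by rewrite -/m fa0y leye_eq => /eqP->; rewrite leey.
pose F := filter_from [set a | m < a]%E (fun a => A `&` [set t | f t < a]%E).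
have FF : ProperFilter F.
  apply: filter_from_proper.
    apply: filter_from_filter; first by exists +oo%E; rewrite /= ltey.
    move=> i j /= mi mj; exists (Order.min i j); first by rewrite lt_min mi mj.
    by move=> t [At] /=; rewrite lt_min => /andP[].
  by move=> i /= /ereal_inf_lt[_ [t At <-] ti]; exists t.
have [|c [Ac cF]] := cA F FF.
  by exists +oo%E; [rewrite /= ltey | move=> t []].
exists c => // t At; apply: le_trans (ereal_inf_lbound (imageP f At)).
rewrite leNgt; apply/negP => mc.
have [r /andP[mr rc]] : exists r : R, (m < r%:E < f c)%E.
  move: mc; rewrite -/m; case: (m) fa0 => [r|//|] _; case: (f c) => [s||] //.
  - rewrite lte_fin => rs; exists ((r + s) / 2); rewrite !lte_fin.
    by rewrite midf_lt // midf_lt.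
  - by move=> _; exists (r + 1); rewrite lte_fin ltrDl ltr01 ltry.
  - by move=> _; exists (s - 1); rewrite ltNyr lte_fin gtrBl ltr01.
  - by move=> _; exists 0; rewrite ltNyr ltry.
have [V cV hV] := flsc c r rc.
have [|s [[As /= sr] Vs]] := cF (A `&` [set t | f t < r%:E]%E) V _ cV.
  by exists r%:E.
by have := hV s Vs; rewrite ltNge (ltW sr).
Qed.

(** Stands in for the extraction of a convergent subsequence: [P d] collects the candidates of
    quality [d], and monotonicity in [d] makes these sets a filter base on a compact ball. *)
Lemma compact_cluster_point {n} (P : R -> 'rV[R]_n -> Prop) (M : R) :
  (forall (d d' : R) x, d <= d' -> P d x -> P d' x) ->
  (forall d : R, 0 < d -> exists2 x, enorm x <= M & P d x) ->
  exists2 x, enorm x <= M &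
    forall d : R, 0 < d -> exists2 y, enorm (y - x) < d & P d y.
Proof.
move=> Pmono hP.
pose F := filter_from [set d | 0 < d] (fun d => eball 0 M `&` P d).
have FF : ProperFilter F.
  apply: filter_from_proper.
    apply: filter_from_filter; first by exists 1 => /=.
    move=> i j /= i0 j0; exists (Order.min i j); first by rewrite /= lt_min i0.
    move=> x [xM Px]; split; split => //; apply: Pmono Px.
      by rewrite ge_min lexx.
    by rewrite ge_min lexx orbT.
  move=> d /= /hP[x xM Px]; exists x; split => //.
  by rewrite /eball /= subr0.
have [|x [xM xF]] := compact_eball 0 M F FF.
  by exists 1 => /= [//|x []].
exists x; first by rewrite /eball /= subr0 in xM.
move=> d d0; have [|y [[yM Py] yx]] := xF (eball 0 M `&` P d) _ _ (near_enorm x d d0).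
  by exists d.
by exists y.
Qed.

End LscMin.

(** * Epsilon-delta forms of subgradients and normals *)

Section SubdiffCharacterizations.
Context {R : realType} {n : nat}.
Implicit Types (f : 'rV[R]_n -> \bar R) (u v x y : 'rV[R]_n).

Lemma efin_num f x : (forall z, -oo < f z)%E -> (f x < +oo)%E -> f x = (fine (f x))%:E.
Proof. by move=> fN fy; rewrite fineK // fin_numElt fN fy. Qed.

Lemma regular_subdiffP f x v : (forall z, -oo < f z)%E ->
  regular_subdiff f x v <->
  (f x < +oo)%E /\ forall e : R, 0 < e -> exists2 d : R, 0 < d &
    forall y, enorm (y - x) < d ->
      (f x + (dotv v (y - x) - e * enorm (y - x))%:E <= f y)%E.
Proof.
move=> fN; rewrite /regular_subdiff /edom /= limf_einfE.
split=> -[fxy h]; split=> //; have fxE := efin_num _ _ fN fxy.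
  move=> e e0; have : ((- e)%:E < ereal_sup [set ereal_inf
      ((fun y => (f y - f x - (dotv v (y - x))%:E) * (enorm (y - x))^-1%:E) @` V)
      | V in x^'])%E.
    by apply: lt_le_trans h; rewrite lte_fin oppr_lt0.
  move=> /ereal_sup_gt[_ [V /nbhs_enorm[d d0 dV] <-] eV].
  exists d => // y yx; have [->|yNx] := eqVneq y x.
    by rewrite subrr dotv0 enorm0 mulr0 subr0 adde0.
  have yx0 : 0 < enorm (y - x) by rewrite enorm_gt0 subr_eq0.
  have /(lt_le_trans eV) := ereal_inf_lbound (imageP (fun y => (f y - f x - (dotv v (y - x))%:E) * (enorm (y - x))^-1%:E)%E (dV y yx yNx)).
  have [fyy|] := ltP (f y) +oo%E; last by rewrite leye_eq => /eqP->; rewrite leey.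
  rewrite fxE (efin_num _ _ fN fyy) -!EFinB -EFinM -EFinD lte_fin lee_fin.
  by rewrite ltr_pdivlMr // mulNr => /ltW; lra.
apply/lee_addgt0Pr => e e0; rewrite -leeBlDr // sub0e.
have [d d0 hd] := h e e0.
apply: le_ereal_sup_tmp.
pose q y := ((f y - f x - (dotv v (y - x))%:E) * (enorm (y - x))^-1%:E)%E.
exists (ereal_inf (q @` [set y | y != x /\ enorm (y - x) < d])).
  exists [set y | y != x /\ enorm (y - x) < d] => //.
  by apply/nbhs_enorm; exists d.
apply: le_ereal_inf_tmp => _ /= [y [yNx yx] <-]; rewrite /q.
have yx0 : 0 < enorm (y - x) by rewrite enorm_gt0 subr_eq0.
have := hd y yx; have [fyy|] := ltP (f y) +oo%E; last first.
  rewrite leye_eq => /eqP->; rewrite fxE /= => _.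
  by rewrite mulyr gtr0_sg ?invr_gt0 // mul1e leey.
rewrite fxE (efin_num _ _ fN fyy) -!EFinB -EFinM -EFinD ?lee_fin.
by rewrite ler_pdivlMr // mulNr; lra.
Qed.

(** Sequences are traded for approximation at every scale [d]; the way back picks one pair for each
    [d = 1 / (k + 1)]. Convergence of values becomes two strict inequalities, so that infinite
    values are never subtracted. *)
Lemma subdiffP f x v : (forall z, -oo < f z)%E ->
  subdiff f x v <->
  (f x < +oo)%E /\ forall d : R, 0 < d -> exists x' v',
    [/\ enorm (x' - x) < d, enorm (v' - v) < d,
        (f x' < f x + d%:E)%E, (f x < f x' + d%:E)%E & regular_subdiff f x' v'].
Proof.
move=> fN; rewrite /subdiff /edom /=; split=> -[fxy h]; split=> //;
  have fxE := efin_num _ _ fN fxy.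
  case: h => xk [vk [/cvg_enorm xkx fk rk /cvg_enorm vkv]] d d0.
  have [N1 h1] := xkx _ d0; have [N2 h2] := vkv _ d0.
  have /fk[N3 _ h3] : nbhs (f x) [set b | b < f x + d%:E /\ f x < b + d%:E]%E.
    rewrite fxE; apply/(nbhs_ballP (fine (f x))); exists d => //= b.
    rewrite /ball /= ltr_distlC => /andP[b1 b2].
    by rewrite -!EFinD !lte_fin; split => //; rewrite -ltrBlDr.
  pose k := maxn N1 (maxn N2 N3).
  have [] := h3 k; first by rewrite /= /k !leq_max leqnn !orbT.
  exists (xk k), (vk k); split=> //; first by apply: h1; rewrite leq_maxl.
  by apply: h2; rewrite /k !leq_max leqnn !orbT.
have {}h (k : nat) : exists p : 'rV[R]_n * 'rV[R]_n,
    [/\ enorm (p.1 - x) < k.+1%:R^-1, enorm (p.2 - v) < k.+1%:R^-1,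
        (f p.1 < f x + k.+1%:R^-1%:E)%E, (f x < f p.1 + k.+1%:R^-1%:E)%E
      & regular_subdiff f p.1 p.2].
  by have [|x' [v' hxv]] := h k.+1%:R^-1; [rewrite invr_gt0|exists (x', v')].
have /choice[p hp] := h.
have small e : 0 < e -> exists N, forall k, (N <= k)%N -> k.+1%:R^-1 < e :> R.
  move=> e0; have [N _ hN] := near_infty_natSinv_lt (PosNum e0).
  by exists N => k /hN.
exists (fun k => (p k).1), (fun k => (p k).2); split.
- apply/cvg_enorm => e /small[N hN]; exists N => k /hN; apply: lt_trans.
  by case: (hp k).
- rewrite fxE => A /(nbhs_ballP (fine (f x)))[e /= e0 eA].
  have [N hN] := small _ e0; exists N => // k /hN ke /=.
  case: (hp k) => _ _ h1 h2 _; have fky : (f (p k).1 < +oo)%E.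
    by apply: lt_trans h1 _; rewrite fxE ltry.
  move: h1 h2; rewrite fxE (efin_num _ _ fN fky) -!EFinD !lte_fin.
  move: ke; move: (k.+1%:R^-1) => r re h1 h2.
  by rewrite (efin_num _ _ fN fky); apply: eA; rewrite /ball /= ltr_distlC; apply/andP; split; lra.
- by move=> k; case: (hp k).
- apply/cvg_enorm => e /small[N hN]; exists N => k /hN; apply: lt_trans.
  by case: (hp k).
Qed.

Lemma regular_subdiff_subdiff f x v : (forall z, -oo < f z)%E ->
  regular_subdiff f x v -> subdiff f x v.
Proof.
move=> fN h; apply/subdiffP => //; have /regular_subdiffP[] // := h.
move=> fxy _; split=> // d d0; exists x, v; rewrite !subrr enorm0.
by split=> //; rewrite (efin_num _ _ fN fxy) -EFinD lte_fin ltrDl.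
Qed.

Lemma subdiff_fin f x v : subdiff f x v -> (f x < +oo)%E.
Proof. by case. Qed.

End SubdiffCharacterizations.

(* As in [second_subdiff], the regular normal to the graph of [G] at [(z, y)]
   is the pair [(u, -w)]. *)
Definition regular_normal {R : realType} {n : nat}
    (G : 'rV[R]_n -> set 'rV[R]_n) (z y u w : 'rV[R]_n) : Prop :=
  G z y /\ forall e : R, 0 < e -> exists2 d : R, 0 < d &
    forall z' y', G z' y' -> enorm (z' - z) < d -> enorm (y' - y) < d ->
      dotv u (z' - z) - dotv w (y' - y) <=
        e * (enorm (z' - z) + enorm (y' - y)).

Section NormalCharacterizations.
Context {R : realType} {n : nat}.

Lemma eindicator_gtNy (W : set 'rV[R]_n) x : (-oo < eindicator W x)%E.
Proof. by rewrite /eindicator; case: ifP. Qed.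

Lemma eindicator_lty (W : set 'rV[R]_n) x : (eindicator W x < +oo)%E <-> W x.
Proof.
rewrite /eindicator; case: ifPn => [/set_mem|/negP xW] //.
by split=> // /mem_set.
Qed.

Lemma eindicator_in (W : set 'rV[R]_n) x : W x -> eindicator W x = 0%E.
Proof. by rewrite /eindicator => /mem_set ->. Qed.

Lemma regular_subdiff_eindicator (W : set 'rV[R]_n) x v :
  regular_subdiff (eindicator W) x v <->
  W x /\ forall e : R, 0 < e -> exists2 d : R, 0 < d &
    forall y, W y -> enorm (y - x) < d -> dotv v (y - x) <= e * enorm (y - x).
Proof.
have iN := eindicator_gtNy W; split.
  move=> /regular_subdiffP[] // /eindicator_lty Wx h; split=> // e /h[d d0 hd].
  exists d => // y Wy /hd; rewrite !eindicator_in // add0e lee_fin.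
  by rewrite subr_le0.
move=> [Wx h]; apply/regular_subdiffP => //; split; first exact/eindicator_lty.
move=> e /h[d d0 hd]; exists d => // y yx.
have [Wy|Wy] := pselect (W y).
  by rewrite !eindicator_in // add0e lee_fin subr_le0 hd.
rewrite (_ : eindicator W y = +oo%E) ?leey // /eindicator ifF //.
by apply/negP => /set_mem.
Qed.

Lemma normal_coneP (W : set 'rV[R]_n) x v :
  normal_cone W x v <-> W x /\ forall d : R, 0 < d -> exists x' v',
    [/\ enorm (x' - x) < d, enorm (v' - v) < d
      & regular_subdiff (eindicator W) x' v'].
Proof.
have iN := eindicator_gtNy W; split.
  move=> /subdiffP[] // /eindicator_lty Wx h; split=> // d /h[x' [v' [? ? _ _ ?]]].
  by exists x', v'.
move=> [Wx h]; apply/subdiffP => //; split; first exact/eindicator_lty.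
move=> d d0; have [x' [v' [? ? rv]]] := h d d0; exists x', v'.
have /regular_subdiff_eindicator[Wx' _] := rv.
by split=> //; rewrite !eindicator_in // add0e lte_fin.
Qed.

End NormalCharacterizations.

Section SecondOrderCharacterizations.
Context {R : realType} {n : nat}.

(** The norm of a pair and the sum of the norms of its components differ by a factor of at most two,
    whence [d / 2] in one direction and [e / 2] in the other. *)
Lemma regular_normal_row_mx (G : 'rV[R]_n -> set 'rV[R]_n)
    (z y u w : 'rV[R]_n) :
  regular_subdiff (eindicator [set row_mx p.1 p.2 | p in gph G])
    (row_mx z y) (row_mx u (- w)) <-> regular_normal G z y u w.
Proof.
have gphP (a b : 'rV[R]_n) :
    [set row_mx p.1 p.2 | p in gph G] (row_mx a b) <-> G a b.
  split=> [[[a' b'] /= Gab /eq_row_mx[<- <-]]//|Gab].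
  by exists (a, b).
have dE (a b : 'rV[R]_n) :
    dotv (row_mx u (- w)) (row_mx a b - row_mx z y) =
    dotv u (a - z) - dotv w (b - y).
  by rewrite opp_row_mx add_row_mx dotv_row_mx dotvNl.
split=> [/regular_subdiff_eindicator[/gphP Gzy h]|[Gzy h]].
  split=> // e e0; have [d d0 hd] := h e e0; exists (d / 2) => [|z' y' /gphP Gzy' zz' yy'].
    by rewrite divr_gt0.
  have le : enorm (row_mx z' y' - row_mx z y) <= enorm (z' - z) + enorm (y' - y).
    by rewrite opp_row_mx add_row_mx enorm_row_mx.
  have lt : enorm (row_mx z' y' - row_mx z y) < d.
    apply: le_lt_trans le _. lra.
  rewrite -dE; apply: le_trans (hd _ Gzy' lt) _.
  by rewrite ler_wpM2l // ltW.
apply/regular_subdiff_eindicator; split; first exact/gphP.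
move=> e e0; have [d d0 hd] := h (e / 2) (divr_gt0 e0 (ltr0Sn _ 1)).
exists d => // _ [[z' y'] /= Gzy' <-]; rewrite dE => lt.
have l1 : enorm (z' - z) <= enorm (row_mx z' y' - row_mx z y).
  by rewrite opp_row_mx add_row_mx enorm_row_mxl.
have l2 : enorm (y' - y) <= enorm (row_mx z' y' - row_mx z y).
  by rewrite opp_row_mx add_row_mx enorm_row_mxr.
apply: le_trans (hd z' y' Gzy' (le_lt_trans l1 lt) (le_lt_trans l2 lt)) _.
rewrite -mulrA ler_wpM2l ?(ltW e0) //.
by rewrite mulrC ler_pdivrMr // mulr_natr mulr2n lerD.
Qed.

Lemma second_subdiffP (psi : 'rV[R]_n -> \bar R) (z y w u : 'rV[R]_n) :
  second_subdiff psi z y w u <->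
  subdiff psi z y /\ forall d : R, 0 < d -> exists z' y' u' w',
    [/\ enorm (z' - z) < d, enorm (y' - y) < d, enorm (u' - u) < d,
        enorm (w' - w) < d & regular_normal (subdiff psi) z' y' u' w'].
Proof.
have gphP (a b : 'rV[R]_n) :
    [set row_mx p.1 p.2 | p in gph (subdiff psi)] (row_mx a b) <->
    subdiff psi a b.
  split=> [[[a' b'] /= Gab /eq_row_mx[<- <-]]//|Gab].
  by exists (a, b).
rewrite /second_subdiff; split=> [/normal_coneP[/gphP zy h]|[zy h]].
  split=> // d /h[p [q]]; rewrite -[p]hsubmxK -[q]hsubmxK => -[pz qu rn].
  exists (lsubmx p), (rsubmx p), (lsubmx q), (- rsubmx q); split.
  - apply: le_lt_trans pz; rewrite opp_row_mx add_row_mx; exact: enorm_row_mxl.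
  - apply: le_lt_trans pz; rewrite opp_row_mx add_row_mx; exact: enorm_row_mxr.
  - apply: le_lt_trans qu; rewrite opp_row_mx add_row_mx; exact: enorm_row_mxl.
  - apply: le_lt_trans qu; rewrite opp_row_mx add_row_mx.
    by rewrite -opprD enormN opprK enorm_row_mxr.
  - by apply/regular_normal_row_mx; rewrite opprK.
apply/normal_coneP; split; first exact/gphP.
move=> d d0; have [|z' [y' [u' [w' [zz yy uu ww rn]]]]] := h (d / 2).
  by rewrite divr_gt0.
exists (row_mx z' y'), (row_mx u' (- w')); split.
- rewrite opp_row_mx add_row_mx; apply: le_lt_trans (enorm_row_mx _ _) _; lra.
- rewrite opp_row_mx add_row_mx; apply: le_lt_trans (enorm_row_mx _ _) _.
  by rewrite -opprD enormN; lra.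
- exact/regular_normal_row_mx.
Qed.

End SecondOrderCharacterizations.

(** * Semicontinuity and continuity of the functions to be minimised *)

Section LowerSemicontinuity.
Context {R : realType}.

Lemma EFin_dense (a : R) (b : \bar R) : (a%:E < b)%E ->
  exists c : R, (a < c)%R /\ (c%:E < b)%E.
Proof.
case: b => [b||] //; last by exists (a + 1); rewrite ltrDl ltr01 ltry.
by rewrite lte_fin => ab; exists ((a + b) / 2); rewrite lte_fin !midf_lt.
Qed.

Lemma lscD {T : topologicalType} (f : T -> \bar R) (h : T -> R) :
  lower_semicontinuous f -> continuous h ->
  lower_semicontinuous (fun x => f x + (h x)%:E)%E.
Proof.
move=> flsc hc x a; rewrite -lteBlDr // -EFinB => /EFin_dense[c [ac cf]].
have [V xV hV] := flsc x c cf.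
have hx : \forall y \near x, a - c < h y.
  by apply: (cvgr_gt (h x) (hc x)); rewrite ltrBlDr -ltrBlDl.
exists (V `&` [set y | a - c < h y]); first exact: filterI.
move=> y [/hV cy /= hy]; rewrite -lteBlDr // -EFinB; apply: lt_trans cy.
by rewrite lte_fin ltrBlDr -ltrBlDl.
Qed.

Lemma lsc_comp {T U : topologicalType} (f : U -> \bar R) (g : T -> U) :
  lower_semicontinuous f -> continuous g ->
  lower_semicontinuous (fun x => f (g x)).
Proof.
move=> flsc gc x a /flsc[V gV hV]; exists (g @^-1` V); first exact: gc.
by move=> y /hV.
Qed.

End LowerSemicontinuity.

Section Continuity.
Context {R : realType} {n : nat}.

Lemma enorm_continuous : continuous (@enorm R n).
Proof.
move=> x; apply/(@cvgrPdist_lt _ _ _ (nbhs x)) => e e0.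
apply: (@filterS _ (nbhs x) _ _ _ _ (near_enorm x e e0)) => y yx.
apply: le_lt_trans yx; rewrite ler_norml; apply/andP; split.
  by have := enormD (y - x) x; rewrite subrK; lra.
by have := enormD (x - y) y; rewrite subrK enormBC; lra.
Qed.

Lemma continuous_sq_enorm {T : topologicalType} (k : R) (h : T -> 'rV[R]_n) :
  continuous h -> continuous (fun x => k * dotv (h x) (h x)).
Proof.
move=> hc; have -> : (fun x => k * dotv (h x) (h x)) =
    (fun x => k * (enorm (h x) * enorm (h x))).
  by apply/funext => x; rewrite -enorm_sq expr2.
move=> x.
have ec : enorm (h y) @[y --> x] --> enorm (h x).
  by apply: (continuous_comp (hc x)); exact: enorm_continuous.
by apply: cvgM; [exact: cvg_cst|exact: cvgM].
Qed.

Lemma continuous_subl (p : 'rV[R]_n) : continuous (fun x : 'rV[R]_n => x - p).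
Proof.
move=> x; apply/continuous_enorm => e e0; exists e => // y.
by rewrite opprB addrA subrK.
Qed.

End Continuity.

(** * Growth inequalities, proximal points and regular normals *)

Section Growth.
Context {R : realType} {n : nat}.
Implicit Types (f : 'rV[R]_n -> \bar R) (u v w x y p : 'rV[R]_n).

(** Proximal subgradients are regular: the quadratic term is at most [e |y - x|] once
    [|y - x| <= e / (|C| + 1)]. *)
Lemma regular_subdiff_quadratic f x v (d C : R) :
  (forall z, -oo < f z)%E -> (f x < +oo)%E -> 0 < d ->
  (forall y, enorm (y - x) <= d ->
    (f x + (dotv v (y - x) - C * dotv (y - x) (y - x))%:E <= f y)%E) ->
  regular_subdiff f x v.
Proof.
move=> fN fxy d0 h; apply/regular_subdiffP => //; split=> // e e0.
exists (Num.min d (e / (`|C| + 1))) => [|y].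
  by rewrite lt_min d0 divr_gt0 // ltr_wpDl.
rewrite lt_min => /andP[yd ye]; apply: le_trans (h y (ltW yd)).
rewrite (efin_num _ _ fN fxy) -!EFinD lee_fin lerD2l lerD2l lerN2.
rewrite -enorm_sq expr2 mulrA ler_wpM2r //.
move: ye; rewrite ltr_pdivlMr ?ltr_wpDl // => /ltW; apply: le_trans.
by rewrite mulrC ler_wpM2l // (le_trans (ler_norm C)) // lerDl.
Qed.

(* Around [(xb, 0)] the subgradients of [f] support [f] from below with
   curvature [s]; [s < 0] is prox-regularity, [s >= 0] is the inequality behind
   variational (strong) convexity. *)
Definition growth f xb (s rho : R) : Prop :=
  forall u v x, subdiff f u v -> enorm (u - xb) <= rho -> enorm v <= rho ->
    (f u < f xb + rho%:E)%E -> enorm (x - xb) <= rho ->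
    (f u + (dotv v (x - u) + s / 2 * dotv (x - u) (x - u))%:E <= f x)%E.

Lemma growth_le f xb s s' rho rho' : s' <= s -> rho' <= rho ->
  growth f xb s rho -> growth f xb s' rho'.
Proof.
move=> ss rr h u v x uv ux vr fu xx.
apply: le_trans (h u v x uv _ _ _ _); rewrite ?(le_trans _ rr) //.
  by rewrite leeD2l // lee_fin lerD2l ler_wpM2r ?dotvv_ge0 // ler_wpM2r.
by apply: lt_le_trans fu _; rewrite leeD2l.
Qed.

(** Sum of the growth inequalities at the two graph points, each tested at the other point. *)
Lemma growth_monotone f xb s rho u v u' v' : (forall z, -oo < f z)%E ->
  growth f xb s rho ->
  subdiff f u v -> enorm (u - xb) <= rho -> enorm v <= rho ->
  (f u < f xb + rho%:E)%E ->
  subdiff f u' v' -> enorm (u' - xb) <= rho -> enorm v' <= rho ->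
  (f u' < f xb + rho%:E)%E ->
  s * dotv (u' - u) (u' - u) <= dotv (u' - u) (v' - v).
Proof.
move=> fN g uv ux vr fu uv' ux' vr' fu'.
have := g u v u' uv ux vr fu ux'; have := g u' v' u uv' ux' vr' fu' ux.
rewrite (efin_num _ _ fN (subdiff_fin _ _ _ uv)).
rewrite (efin_num _ _ fN (subdiff_fin _ _ _ uv')).
rewrite -!EFinD !lee_fin -(opprB u' u); move: (u' - u) => a.
by rewrite !dotvE !(dotvC a); lra.
Qed.

(** The point [x] minimises [f + |. - p|^2 / (2 mu)] over the closed ball of radius [rho]. By growth
    at [(xb, 0)], [f] drops by at most [r / 2 |x - xb|^2], which is at most half of
    [|x - xb|^2 / (2 mu)] as [mu r <= 1/2]. So [x] stays within [4 d] of [xb], inside the ball, and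
    [(p - x) / mu] is a subgradient there. *)
Lemma proximal_point f xb r rho mu : (forall z, -oo < f z)%E ->
  lower_semicontinuous f -> subdiff f xb 0 -> 0 < rho ->
  growth f xb (- r) rho -> 0 < mu -> mu * r <= 2^-1 ->
  forall rho1, 0 < rho1 <= rho -> exists2 d, 0 < d &
    forall p, enorm (p - xb) <= d -> exists x v,
      [/\ x + mu *: v = p,
          [/\ enorm (x - xb) <= rho1, enorm v <= rho1
            & (f x < f xb + rho1%:E)%E],
          regular_subdiff f x v
        & forall y, enorm (y - xb) <= rho ->
          (f x + ((2 * mu)^-1 * dotv (x - p) (x - p))%:E <=
           f y + ((2 * mu)^-1 * dotv (y - p) (y - p))%:E)%E].
Proof.
move=> fN flsc sxb rho0 g mu0 mur rho1 /andP[rho10 rho1r].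
(* [rho1 / 8] keeps [4 d] within [rho1 / 2]; [mu * rho1 / 8] keeps [|p - x| <= 5 d] within
   [mu * rho1]; [d <= 1] makes the bound [d ^+ 2] on the scaled increase of [f] a linear one. *)
pose d := Num.min 1 (Num.min (rho1 / 8) (mu * rho1 / 8)).
have d0 : 0 < d by rewrite !lt_min ltr01 !divr_gt0 // mulr_gt0.
have d1 : d <= 1 by rewrite ge_min lexx.
have d2 : d <= rho1 / 8 by below_min.
have d3 : d <= mu * rho1 / 8 by below_min.
clearbody d; exists d => // p pd.
have fxb := subdiff_fin _ _ _ sxb; have fxbE := efin_num _ _ fN fxb.
have clsc : lower_semicontinuous
    (fun y => f y + ((2 * mu)^-1 * dotv (y - p) (y - p))%:E)%E.
  by apply: lscD => //; apply: continuous_sq_enorm; exact: continuous_subl.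
have [|x xK xmin] := lsc_compact_min _ _ _ clsc (compact_eball xb rho).
  by exists xb; rewrite /eball /= subrr enorm0 ltW.
rewrite /eball /= in xK xmin.
have xbK : enorm (xb - xb) <= rho by rewrite subrr enorm0 ltW.
have xxb := xmin xb xbK.
have fx : (f x < +oo)%E.
  rewrite ltNge leye_eq; apply/negP => /eqP fx.
  by move: xxb; rewrite fx fxbE -EFinD.
have fxE := efin_num _ _ fN fx.
have gx : (f xb + (dotv 0 (x - xb) + - r / 2 * dotv (x - xb) (x - xb))%:E <= f x)%E.
  apply: g; rewrite ?enorm0 ?(ltW rho0) //.
  by rewrite fxbE -EFinD lte_fin ltrDl.
move: xxb gx; rewrite fxE fxbE -!EFinD !lee_fin dot0v add0r.
set a := fine (f x); set b := fine (f xb).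
have -> : x - p = (x - xb) - (p - xb) by rewrite opprB addrA subrK.
rewrite -[xb - p]opprB.
have [X XE] : exists X, X = x - xb by eexists.
have [P PE] : exists P, P = p - xb by eexists.
rewrite -XE -PE !dotvE (dotvC P X) => h1 h2; rewrite -PE in pd.
have mu2 : 0 < 2 * mu by rewrite mulr_gt0.
have h3 : a - b <= (2 * mu)^-1 * (2 * dotv X P - dotv X X) by lra.
rewrite mulrC ler_pdivlMr // in h3.
have h4 : dotv X X <= 4 * dotv X P.
  have e1 : mu * r * dotv X X <= 2^-1 * dotv X X by rewrite ler_wpM2r ?dotvv_ge0.
  have e2 : - (mu * r * dotv X X) <= (a - b) * (2 * mu).
    have : (- r / 2 * dotv X X) * (2 * mu) <= (a - b) * (2 * mu).
      by rewrite ler_wpM2r ?(ltW mu2) //; lra.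
    by apply: le_trans; lra.
  by lra.
have XP : enorm X <= 4 * d.
  have [X0|] := eqVneq (enorm X) 0; first by rewrite X0 mulr_ge0 // ltW.
  move=> X0; have {}X0 : 0 < enorm X by rewrite lt_def X0 enorm_ge0.
  rewrite -(ler_pM2r X0) -expr2 enorm_sq; apply: le_trans h4 _.
  rewrite -mulrA ler_wpM2l //; apply: le_trans (dotv_le_enorm _ _) _.
  by rewrite mulrC ler_wpM2r.
exists x, (mu^-1 *: (p - x)).
have muI : mu != 0 by rewrite gt_eqF.
have pxE : p - x = P - X by rewrite PE XE opprB addrA subrK.
have x1 : enorm (x - xb) <= rho1 / 2 by rewrite -XE; lra.
split.
- by rewrite scalerA mulfV // scale1r addrC subrK.
- split; first by lra.
    rewrite pxE enormZ ger0_norm ?invr_ge0 ?(ltW mu0) //.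
    rewrite ler_pdivrMl //; apply: le_trans (enormB _ _) _; lra.
  rewrite fxE lte_fin -/a.
  have PP : dotv P P <= d ^+ 2 by rewrite -enorm_le_sq // ltW.
  have h5 : (a - b) * (2 * mu) <= d * (mu * rho1 / 8).
    apply: le_trans (_ : dotv P P <= _); last first.
      by apply: le_trans PP _; rewrite expr2 ler_wpM2l // ltW.
    apply: le_trans h3 _; have := dotvv_ge0 (X - P).
    by rewrite !dotvE (dotvC P X); lra.
  have h6 : d * (mu * rho1 / 8) < rho1 * (2 * mu).
    have : d * (mu * rho1) <= mu * rho1 by rewrite ger_pMl // mulr_gt0.
    have : 0 < mu * rho1 by rewrite mulr_gt0.
    by lra.
  by have := le_lt_trans h5 h6; rewrite ltr_pM2r //; lra.
- apply: (@regular_subdiff_quadratic _ _ _ (rho1 / 2) (2 * mu)^-1) => //.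
    by rewrite divr_gt0.
  move=> y yx; have yK : enorm (y - xb) <= rho.
    by apply: le_trans (enorm_triangle x _ _) _; lra.
  have := xmin y yK; have [fy|] := ltP (f y) +oo%E; last first.
    by rewrite leye_eq => /eqP-> _; rewrite leey.
  rewrite fxE (efin_num _ _ fN fy) -!EFinD !lee_fin.
  have -> : y - p = (y - x) - (p - x) by rewrite opprB addrA subrK.
  have -> : mu^-1 = 2 * (2 * mu)^-1 by field.
  rewrite -(opprB p x); move: (y - x) (p - x) => Y Q.
  by rewrite !dotvE (dotvC Q Y); lra.
- by [].
Qed.

(* With D = p + w - 2 (1 + s) w, the resolvent moved along t D is displaced by a
   vector of the ball with diameter t D / (1 + s); testing the normal against
   these displacements gives |D| <= |p + w|, which is the claim. *)
Lemma growth_normal f xb s rho : (forall z, -oo < f z)%E ->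
  lower_semicontinuous f -> subdiff f xb 0 -> 0 < rho -> 0 <= s ->
  growth f xb s rho -> exists2 d, 0 < d &
    forall x v p w, enorm (x - xb) <= d -> enorm v <= d ->
      (f x < f xb + d%:E)%E -> regular_normal (subdiff f) x v p w ->
      s * dotv w w <= dotv p w.
Proof.
move=> fN flsc sxb rho0 s0 g.
have g0 : growth f xb (- 0) rho by apply: growth_le g; rewrite ?oppr0.
have [||d0 d00 hd0] := proximal_point _ _ _ _ 1 fN flsc sxb rho0 g0 ltr01 _ rho.
- by rewrite mulr0 invr_ge0.
- by rewrite rho0 lexx.
exists (Num.min rho (d0 / 4)) => [|x v p w]; first by rewrite lt_min rho0 divr_gt0.
rewrite !le_min => /andP[xr xd] /andP[vr vd] fx [xv hn].
have {}fx : (f x < f xb + rho%:E)%E.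
  by apply: lt_le_trans fx _; rewrite leeD2l // lee_fin ge_min lexx.
pose L := 1 + s; have L1 : 1 <= L by rewrite lerDl.
have L0 : 0 < L by apply: lt_le_trans L1.
have [P PE] : exists P, P = p + w by eexists.
have [D DE] : exists D, D = P - (2 * L) *: w by eexists.
(* Squared, this reads [L <w, w> <= <P, w>], and [P = p + w], [L = 1 + s] turn it into the goal. *)
suff DP : enorm D <= enorm P.
  move: DP; rewrite ler_enorm_sq -subr_ge0 DE !dotvE (dotvC w P) => h.
  have : 0 <= 4 * L * (dotv P w - L * dotv w w) by lra.
  rewrite pmulr_rge0 ?mulr_gt0 // PE /L !dotvE; lra.
have [->|D0] := eqVneq D 0; first by rewrite enorm0.
have {}D0 : 0 < enorm D by rewrite enorm_gt0.
apply/ler_addgt0Pr => e' e'0.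
pose e := e' / (4 * L); have e0 : 0 < e by rewrite divr_gt0 ?mulr_gt0.
have [d1 d10 hd1] := hn e e0.
pose t := Num.min (d0 / 4 / enorm D) (d1 / 2 / enorm D).
have t0 : 0 < t by rewrite lt_min !divr_gt0.
have t1 : t * enorm D <= d0 / 4 by rewrite -ler_pdivlMr // ge_min lexx.
have t2 : t * enorm D <= d1 / 2 by rewrite -ler_pdivlMr // ge_min lexx orbT.
clearbody t.
have tD : enorm (t *: D) = t * enorm D by rewrite enormZ gtr0_norm.
have [|x' [v' [xvE [x'r v'r fx'] rs' _]]] := hd0 (x + v + t *: D).
  have -> : x + v + t *: D - xb = (x - xb) + (v + t *: D).
    by rewrite addrAC (addrAC x) -addrA.
  apply: le_trans (enormD _ _) _.
  by have := enormD v (t *: D); lra.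
have mono := growth_monotone _ _ _ _ _ _ _ _ fN g xv xr vr fx
  (regular_subdiff_subdiff _ _ _ fN rs') x'r v'r fx'.
rewrite scale1r in xvE.
have abE : (x' - x) + (v' - v) = t *: D.
  by rewrite addrACA -opprD xvE addrAC subrr add0r.
have {}hd1 := hd1 x' v' (regular_subdiff_subdiff _ _ _ fN rs').
move: (x' - x) (v' - v) abE mono hd1 => a b abE mono hd1.
have bE : b = t *: D - a by rewrite -abE addrC addKr.
have ab0 : 0 <= dotv a b.
  by apply: le_trans mono; rewrite mulr_ge0 ?dotvv_ge0.
have aD : enorm a <= t * enorm D.
  rewrite -tD ler_enorm_sq -abE !dotvE (dotvC b a).
  by have := dotvv_ge0 b; clear -ab0; lra.
have bD : enorm b <= t * enorm D.
  rewrite -tD ler_enorm_sq -abE !dotvE (dotvC b a).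
  by have := dotvv_ge0 a; clear -ab0; lra.
(* Since [b = t D - a], strong monotonicity places [a] in the ball with antipodal points [0] and
   [t D / L]; [h3] is the same fact after scaling by [2 L] and recentring. *)
have h1 : L * dotv a a <= t * dotv a D.
  by move: mono; rewrite bE !dotvE /L; clear; lra.
have h2 : dotv P a - t * dotv w D <= e * (2 * (t * enorm D)).
  have : dotv p a - dotv w b <= e * (enorm a + enorm b).
    by apply: hd1; [apply: le_lt_trans aD _|apply: le_lt_trans bD _]; clear -t2 d10; lra.
  have : e * (enorm a + enorm b) <= e * (2 * (t * enorm D)).
    by rewrite ler_pM2l //; clear -aD bD; lra.
  by rewrite bE PE !dotvE; clear; lra.
have h3 : enorm ((2 * L) *: a - t *: D) <= t * enorm D.
  rewrite -tD ler_enorm_sq !dotvE (dotvC D a).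
  have : 0 <= 4 * L * (t * dotv a D - L * dotv a a).
    by rewrite !mulr_ge0 ?subr_ge0 // ltW.
  by clear; lra.
have h4 : - (enorm P * (t * enorm D)) <= dotv P ((2 * L) *: a - t *: D).
  apply: le_trans (dotv_geN_enorm _ _); rewrite lerN2.
  by rewrite ler_wpM2l.
have h5 : t * (dotv P D - 2 * L * dotv w D) <=
    t * ((enorm P + e') * enorm D).
  have : (2 * L) * (dotv P a - t * dotv w D) <= (2 * L) * (e * (2 * (t * enorm D))).
    by rewrite ler_pM2l // mulr_gt0.
  have -> : 2 * L * (e * (2 * (t * enorm D))) = t * (e' * enorm D).
    by rewrite /e; field; rewrite gt_eqF.
  by move: h4; rewrite !dotvE; clear; lra.
rewrite ler_pM2l // in h5; rewrite -(ler_pM2r D0); apply: le_trans h5.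
by rewrite -expr2 enorm_sq {1}DE !dotvE; clear; lra.
Qed.

End Growth.

(** * A mean value inequality, and integration along segments *)

Section MeanValue.
Context {R : realType} {n : nat}.
Implicit Types (V : 'rV[R]_n -> 'rV[R]_n) (u v w x y p q : 'rV[R]_n).

Lemma enorm_segment (p1 p2 xb : 'rV[R]_n) (t k : R) : 0 <= t <= 1 ->
  enorm (p1 - xb) <= k -> enorm (p2 - xb) <= k ->
  enorm (p1 + t *: (p2 - p1) - xb) <= k.
Proof.
move=> /andP[t0 t1] h1 h2.
have -> : p1 + t *: (p2 - p1) - xb = (1 - t) *: (p1 - xb) + t *: (p2 - xb).
  row_ring.
apply: le_trans (enormD _ _) _; rewrite !enormZ !ger0_norm ?subr_ge0 //.
apply: le_trans (_ : (1 - t) * k + t * k <= _); last by lra.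
by rewrite lerD // ler_wpM2l // subr_ge0.
Qed.

Lemma lipschitz_ball_lsc (h : 'rV[R]_n -> R) xb (d K : R) :
  (forall p p', enorm (p - xb) <= d -> enorm (p' - xb) <= d ->
     h p - K * enorm (p' - p) <= h p') ->
  lower_semicontinuous
    (fun x => if enorm (x - xb) <= d then (h x)%:E else +oo%E).
Proof.
move=> hL x a; have [xd|xd _] := leP (enorm (x - xb)) d.
  rewrite lte_fin => ah; pose e := (h x - a) / (`|K| + 1).
  have K1 : 0 < `|K| + 1 by rewrite ltr_wpDl.
  have e0 : 0 < e by rewrite divr_gt0 // subr_gt0.
  exists [set y | enorm (y - x) < e]; first exact: near_enorm.
  move=> y /= yx; case: ifPn => [yd|_]; last by rewrite ltry.
  rewrite lte_fin; apply: lt_le_trans (hL x y xd yd).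
  move: yx; rewrite /e ltr_pdivlMr // => yx.
  have : K * enorm (y - x) <= enorm (y - x) * (`|K| + 1).
    by rewrite mulrC ler_wpM2l // (le_trans (ler_norm K)) // lerDl.
  lra.
exists [set y | enorm (y - x) < enorm (x - xb) - d].
  by apply: near_enorm; rewrite subr_gt0.
move=> y /= yx; rewrite ifF ?ltry //; apply/negbTE; rewrite -ltNge.
by have := enorm_triangle y x xb; rewrite (enormBC x y); lra.
Qed.

Lemma continuous_penalty p1 d0 (a N : R) :
  continuous (fun z : 'rV[R]_n * R =>
    N * dotv (z.1 - (p1 + z.2 *: d0)) (z.1 - (p1 + z.2 *: d0)) - z.2 * a).
Proof.
move=> z; apply: cvgB; last by apply: cvgMl; exact: cvg_snd.
apply: (@continuous_sq_enorm R n _ N (fun z : 'rV[R]_n * R => z.1 - (p1 + z.2 *: d0))) => {}z.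
apply: (@continuousB _ _ _ (fun z : 'rV[R]_n * R => z.1) (fun z => p1 + z.2 *: d0)).
  exact: cvg_fst.
apply: (@continuousD _ _ _ (fun z : 'rV[R]_n * R => p1) (fun z => z.2 *: d0)).
  exact: cvg_cst.
apply: (@continuousZr_tmp _ _ _ (fun z : 'rV[R]_n * R => z.2)).
exact: cvg_snd.
Qed.

(** Completing the square gives the minimum [- L^2 / (4 N)]; this choice of [N] keeps it strictly
    above [- e], and [N] positive also for [L = 0]. *)
Lemma quadratic_gtN (N s L e : R) : 0 < e -> N = (L ^+ 2 + 1) / e ->
  - e < N * s ^+ 2 - L * s.
Proof.
move=> e0 NE; have N0 : 0 < N by rewrite NE divr_gt0 // ltr_wpDl // sqr_ge0.
have Ne : N * e = L ^+ 2 + 1 by rewrite NE; field; rewrite gt_eqF.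
rewrite -subr_gt0 -(pmulr_rgt0 _ N0) opprK.
have -> : N * (N * s ^+ 2 - L * s + e) = (N * s - L / 2) ^+ 2 - L ^+ 2 / 4 + N * e.
  by field.
rewrite Ne; have := sqr_ge0 (N * s - L / 2); have := sqr_ge0 L; lra.
Qed.

(* Zagrodny's mean value argument: minimising the penalised function
   [<d, V x> - t a + N |x - (p1 + t d)|^2] over [x] and [t] yields a proximal
   subgradient of [<d, V .>] whose slope along [d] is at most that of the chord. *)
Lemma monotone_of_proximal V xb (r K c : R) : 0 < r -> 0 <= K ->
  (forall p p', enorm (p - xb) <= r -> enorm (p' - xb) <= r ->
     enorm (V p' - V p) <= K * enorm (p' - p)) ->
  (forall p q u N, enorm (p - xb) < r ->
     (forall p', enorm (p' - xb) <= r ->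
        dotv u (p' - p) - N * dotv (p' - p) (p' - p) <= dotv q (V p' - V p)) ->
     c * dotv q q <= dotv u q) ->
  forall p1 p2, enorm (p1 - xb) <= r / 2 -> enorm (p2 - xb) <= r / 2 ->
    c * dotv (p2 - p1) (p2 - p1) <= dotv (p2 - p1) (V p2 - V p1).
Proof.
move=> r0 K0 VL Vprox p1 p2 p1r p2r.
have [d dE] : exists d, d = p2 - p1 by eexists.
rewrite -dE leNgt; apply/negP => hlt.
pose h p := dotv d (V p).
pose D := dotv d (V p2 - V p1).
(* A slope strictly between the chord value [D] and the alleged lower bound: [D < a] excludes a
   minimiser with [t = 0], while [a < c |d|^2] is contradicted at the end. *)
pose a := (D + c * dotv d d) / 2.
have Da : D < a by rewrite /a /D; lra.
have ac : a < c * dotv d d by rewrite /a /D; lra.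
have h12 : h p2 = h p1 + D by rewrite /h /D dotvBr; lra.
clearbody D a.
pose L := K * enorm d; have L0 : 0 <= L by rewrite mulr_ge0.
have hL p p' : enorm (p - xb) <= r -> enorm (p' - xb) <= r ->
    h p - L * enorm (p' - p) <= h p'.
  move=> pr p'r; have := dotv_geN_enorm d (V p' - V p).
  have : enorm d * enorm (V p' - V p) <= enorm d * (K * enorm (p' - p)).
    by rewrite ler_wpM2l // VL.
  by rewrite /h /L dotvBr; lra.
have eta0 : 0 < a - D by rewrite subr_gt0.
pose C := L * enorm d + `|a|.
have C0 : 0 <= C by rewrite addr_ge0 // mulr_ge0.
pose N1 := (L ^+ 2 + 1) / (a - D).
have N10 : 0 < N1 by rewrite divr_gt0 // ltr_wpDl // sqr_ge0.
(* [N1] serves to show [t > 0]; the second term keeps the minimiser within [r / 4] of the segment,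
   which lies in the ball of radius [r / 2], hence off the boundary of the ball of radius [r]. *)
pose N := N1 + (4 / r) * (L + 4 * C / r) + 1.
have NN1 : N1 <= N.
  by rewrite /N -addrA lerDl addr_ge0 // mulr_ge0 // ?addr_ge0 // ?divr_ge0 ?mulr_ge0 // ltW.
have N0 : 0 < N by apply: lt_le_trans NN1.
have Nbig : (4 / r) * (L + 4 * C / r) < N by rewrite /N; lra.
pose F := fun z : 'rV[R]_n * R =>
  ((if (enorm (z.1 - xb) <= r)%R then (h z.1)%:E else +oo) +
   (N * dotv (z.1 - (p1 + z.2 *: d)) (z.1 - (p1 + z.2 *: d)) - z.2 * a)%:E)%E.
have Flsc : lower_semicontinuous F.
  apply: lscD; last exact: continuous_penalty.
  apply: (@lsc_comp _ _ _
    (fun x => if enorm (x - xb) <= r then (h x)%:E else +oo%E) fst).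
    exact: (@lipschitz_ball_lsc _ _ _ L).
  by move=> z; exact: cvg_fst.
have cA : compact (eball xb r `*` `[0 : R, 1]%classic).
  by apply: compact_setX; [exact: compact_eball|exact: segment_compact].
have p1R : enorm (p1 - xb) <= r by lra.
have p2R : enorm (p2 - xb) <= r by lra.
have [|[x t] /= [xr /=]] := lsc_compact_min _ _ _ Flsc cA.
  by exists (p1, 0); split => //=; rewrite in_itv /= lexx ler01.
rewrite in_itv /= => /andP[t0 t1] Fmin.
have {}Fmin y s : enorm (y - xb) <= r -> 0 <= s <= 1 ->
    h x + (N * dotv (x - (p1 + t *: d)) (x - (p1 + t *: d)) - t * a) <=
    h y + (N * dotv (y - (p1 + s *: d)) (y - (p1 + s *: d)) - s * a).
  move=> yr s01; have := Fmin (y, s); rewrite /F /= yr xr -!EFinD lee_fin.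
  by apply; split => //=; rewrite in_itv.
rewrite /eball /= in xr.
have [e eE] : exists e, e = x - (p1 + t *: d) by eexists.
rewrite -eE in Fmin.
have xp1 : x - p1 = e + t *: d by rewrite eE opprD addrA subrK.
have ed : enorm e <= r / 4.
  rewrite leNgt; apply/negP => re.
  have := Fmin p1 0 p1R; rewrite lexx ler01 => /(_ isT).
  rewrite scale0r addr0 subrr dot0v mul0r mulr0 subr0 addr0 => h1.
  have := hL p1 x p1R xr; rewrite xp1 => h2.
  have : enorm (e + t *: d) <= enorm e + enorm d.
    apply: le_trans (enormD _ _) _; rewrite lerD2l enormZ ger0_norm //.
    by rewrite ler_piMl.
  move=> /(ler_wpM2l L0) h3.
  have h4 : t * a <= `|a|.
    apply: le_trans (ler_norm _) _; rewrite normrM (ger0_norm t0).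
    by rewrite ler_piMl.
  have h5 : N * enorm e ^+ 2 <= L * enorm e + C by rewrite enorm_sq /C; clear -h1 h2 h3 h4; lra.
  have e0 : 0 < enorm e by apply: lt_trans re; rewrite divr_gt0.
  have h6 : C <= 4 * C / r * enorm e.
    rewrite mulrAC ler_pdivlMr // -mulrA mulrCA ler_wpM2l //; clear -re; lra.
  have h7 : N * enorm e <= L + 4 * C / r.
    rewrite -(ler_pM2r e0).
    have -> : N * enorm e * enorm e = N * enorm e ^+ 2 by ring.
    by apply: le_trans h5 _; clear -h6; lra.
  have h8 : N * (r / 4) < N * enorm e by rewrite ltr_pM2l.
  have : 4 / r * (N * (r / 4)) < 4 / r * (L + 4 * C / r).
    by rewrite ltr_pM2l ?divr_gt0 //; clear -h7 h8; lra.
  have -> : 4 / r * (N * (r / 4)) = N by field; rewrite gt_eqF.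
  by clear -Nbig; lra.
have xlt : enorm (x - xb) < r.
  apply: le_lt_trans (enorm_triangle (p1 + t *: d) _ _) _; rewrite -eE.
  have : enorm (p1 + t *: d - xb) <= r / 2.
    by rewrite dE; apply: enorm_segment => //; rewrite t0.
  by clear -ed r0; lra.
have tpos : 0 < t.
  rewrite lt_def t0 andbT; apply/eqP => tz.
  have := Fmin p2 1 p2R; rewrite lexx ler01 => /(_ isT).
  have -> : p1 + 1 *: d = p2 by rewrite scale1r dE addrC subrK.
  rewrite subrr dot0v mulr0 tz mul0r h12 => h1.
  have := hL p1 x p1R xr; rewrite xp1 tz scale0r addr0 => h2.
  have := quadratic_gtN N1 (enorm e) L (a - D) eta0 (erefl _).
  have : N1 * enorm e ^+ 2 <= N * enorm e ^+ 2 by rewrite ler_wpM2r // sqr_ge0.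
  by rewrite enorm_sq; clear -h1 h2; lra.
(* Minimality in [x] at fixed [t] makes [- 2 N e] a proximal subgradient of [<d, V(.)>] at [x]. *)
have ud : c * dotv d d <= dotv (- (2 * N) *: e) d.
  apply: (Vprox x d _ N xlt) => p pr.
  have := Fmin p t pr; rewrite t0 t1 => /(_ isT).
  have -> : p - (p1 + t *: d) = (p - x) + e by rewrite eE addrA subrK.
  by move: (p - x) => Y; rewrite dotvBr -/(h p) -/(h x) !dotvE (dotvC Y e); clear; lra.
(* Minimality in [t] is used only downwards, from [t] to [t - tau], so [t = 1] is no special case;
   [tau] is small enough for the quadratic remainder not to exceed [gap]. *)
pose gap := c * dotv d d - a; have gap0 : 0 < gap by rewrite subr_gt0.
have dd0 : 0 <= dotv d d := dotvv_ge0 d.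
have Nd0 : 0 < N * dotv d d + 1 by rewrite ltr_wpDl // mulr_ge0 // ltW.
pose tau := Num.min t (gap / (N * dotv d d + 1)).
have tau0 : 0 < tau by rewrite lt_min tpos divr_gt0.
have taut : tau <= t by rewrite ge_min lexx.
have taug : tau * (N * dotv d d + 1) <= gap.
  by rewrite -ler_pdivlMr // ge_min lexx orbT.
clearbody tau.
have := Fmin x (t - tau) xr; have -> : 0 <= t - tau <= 1 by clear -tau0 taut t1; apply/andP; split; lra.
move=> /(_ isT).
have -> : x - (p1 + (t - tau) *: d) = e + tau *: d.
  by rewrite eE scalerBl; row_ring.
rewrite !dotvE (dotvC d e) => h1.
have : 0 <= tau * (a + 2 * N * dotv e d + N * tau * dotv d d) by clear -h1; lra.
rewrite pmulr_rge0 // => h2.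
move: ud taug; rewrite !dotvE /gap; clear -h2 dd0 tau0 N0 ac; lra.
Qed.

(** Integrates [V] over [k] equal steps of length [s] from [p] to [p']. Only an upper estimate of
    [e] is given, so each step applies it backwards, from the new point to the previous one. Summing
    [c j s^2] over the steps gives [c / 2 * (k s) * (k s + s)], and the errors [M s^2] add up to
    [M / k] when [s = 1 / k], each times [|p' - p|^2]. *)
Lemma convex_of_monotone (e : 'rV[R]_n -> R) V xb (r M c : R) : 0 <= c -> 0 <= M ->
  (forall p p', enorm (p - xb) <= r -> enorm (p' - xb) <= r ->
     e p' <= e p + dotv (V p) (p' - p) + M * dotv (p' - p) (p' - p)) ->
  (forall p p', enorm (p - xb) <= r -> enorm (p' - xb) <= r ->
     c * dotv (p' - p) (p' - p) <= dotv (p' - p) (V p' - V p)) ->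
  forall p p', enorm (p - xb) <= r -> enorm (p' - xb) <= r ->
     e p + dotv (V p) (p' - p) + c / 2 * dotv (p' - p) (p' - p) <= e p'.
Proof.
move=> c0 M0 eM Vc p p' pr p'r.
have [d dE] : exists d, d = p' - p by eexists.
rewrite -dE; have dd0 := dotvv_ge0 d.
have step (k : nat) (s : R) : 0 < s -> k%:R * s <= 1 ->
    e p + k%:R * s * dotv (V p) d
      + c / 2 * dotv d d * (k%:R * s) * (k%:R * s + s)
      - M * dotv d d * (k%:R * s) * s <= e (p + (k%:R * s) *: d).
  move=> s0; elim: k => [|k IH] ks.
    by rewrite mulr0n !(mul0r, mulr0) scale0r !addr0 subr0.
  have k0 : 0 <= k%:R * s by rewrite mulr_ge0 // ltW.
  have kE : k.+1%:R * s = k%:R * s + s by rewrite -natr1 mulrDl mul1r.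
  have {}IH := IH (le_trans (ler_wpM2r (ltW s0) (eqbRL (ler_nat _ k k.+1) (leqnSn k))) ks).
  move: ks IH; rewrite kE; set x := k%:R * s in k0 kE *; clearbody x => ks IH.
  have qr : enorm (p + x *: d - xb) <= r.
    by rewrite dE; apply: enorm_segment => //; apply/andP; split; lra.
  have q'r : enorm (p + (x + s) *: d - xb) <= r.
    by rewrite dE; apply: enorm_segment => //; apply/andP; split; lra.
  have h1 := eM _ _ q'r qr; have h2 := Vc p _ pr q'r.
  have E1 : p + x *: d - (p + (x + s) *: d) = - s *: d.
    by row_ring.
  have E2 : p + (x + s) *: d - p = (x + s) *: d by rewrite addrC addKr.
  rewrite E1 in h1; rewrite E2 in h2.
  move: h1 h2; set W := V _; rewrite !dotvE => h1 h2.
  have h3 : c * (x + s) * dotv d d <= dotv d W - dotv d (V p).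
    have xs0 : 0 < x + s by lra.
    by rewrite -(ler_pM2l xs0); lra.
  have h4 : s * (c * (x + s) * dotv d d) <= s * (dotv d W - dotv d (V p)).
    by rewrite ler_pM2l.
  by rewrite (dotvC _ d) in h1; rewrite (dotvC _ d) in IH *; lra.
apply/ler_addgt0Pr => eps eps0.
pose k := (Num.bound (M * dotv d d / eps)).+1.
have kb : M * dotv d d / eps < k%:R.
  apply: lt_trans (_ : (Num.bound (M * dotv d d / eps))%:R < _).
    by apply: archi_boundP; rewrite divr_ge0 ?mulr_ge0 // ltW.
  by rewrite ltr_nat.
have k0 : 0 < k%:R :> R by rewrite ltr0n.
have := step k k%:R^-1; rewrite invr_gt0 k0 mulfV ?gt_eqF // lexx => /(_ isT isT).
have -> : p + 1 *: d = p' by rewrite scale1r dE addrC subrK.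
rewrite !mulr1 mul1r.
have : M * dotv d d / k%:R <= eps.
  by rewrite ler_pdivrMr // -ler_pdivrMl // mulrC ltW.
have : 0 <= c / 2 * dotv d d * k%:R^-1 by rewrite !mulr_ge0 ?invr_ge0 // ?ltW.
by lra.
Qed.

End MeanValue.

(** * The proximal map as a Lipschitz parametrisation of the graph *)

Section ProximalMap.
Context {R : realType} {n : nat}.
Implicit Types (f : 'rV[R]_n -> \bar R) (u v w x y z p q : 'rV[R]_n).

(* The consequence of subdifferential continuity at [(xb, 0)] that makes
   f-attentive localisation automatic. *)
Definition attentive f xb : Prop :=
  forall rho : R, 0 < rho -> exists2 d : R, 0 < d &
    forall z y, subdiff f z y -> enorm (z - xb) <= d -> enorm y <= d ->
      (f z < f xb + rho%:E)%E.

(** Pairing [P] with [a] gives [<a, P> >= (1 - mu r) |a|^2 >= |a|^2 / 2], and then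
    [b = (P - a) / mu]. *)
Lemma hypomonotone_bound (a b P : 'rV[R]_n) (r mu : R) : 0 < mu -> mu * r <= 2^-1 ->
  - r * dotv a a <= dotv a b -> a + mu *: b = P ->
  enorm a <= 2 * enorm P /\ enorm b <= 3 / mu * enorm P.
Proof.
move=> mu0 mur ab PE.
have aP : enorm a <= 2 * enorm P.
  have [a0|a0] := eqVneq (enorm a) 0; first by rewrite a0 mulr_ge0.
  have {}a0 : 0 < enorm a by rewrite lt_def a0 enorm_ge0.
  rewrite -(ler_pM2r a0) -expr2 enorm_sq.
  have := dotv_le_enorm a P; rewrite -{1}PE !dotvE => h.
  have : mu * (- r * dotv a a) <= mu * dotv a b by rewrite ler_pM2l.
  have : mu * r * dotv a a <= 2^-1 * dotv a a by rewrite ler_wpM2r ?dotvv_ge0.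
  by lra.
split=> //.
have -> : b = mu^-1 *: (P - a).
  by rewrite -PE addrC addKr scalerA mulVf ?scale1r ?gt_eqF.
rewrite enormZ gtr0_norm ?invr_gt0 // -mulrA mulrCA ler_pM2l ?invr_gt0 //.
by apply: le_trans (enormB _ _) _; lra.
Qed.

Section Map.
Variables (f : 'rV[R]_n -> \bar R) (xb : 'rV[R]_n) (r rho mu : R).
Hypotheses (fN : forall z, (-oo < f z)%E) (flsc : lower_semicontinuous f)
  (sxb : subdiff f xb 0) (rho0 : 0 < rho) (g : growth f xb (- r) rho)
  (mu0 : 0 < mu) (mur : mu * r <= 2^-1).

(** [X] and [V] are chosen pointwise; all regularity comes from comparing a localised graph point
    [(u, v)] with [(X p, V p)] by hypomonotonicity. Applied to another value of the map this yields
    the Lipschitz constants, applied with [p = u + mu v] it recovers the graph point. *)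
Lemma proximal_map rho1 : 0 < rho1 <= rho ->
  exists (d : R) (X V : 'rV[R]_n -> 'rV[R]_n), [/\ 0 < d,
    (forall p, enorm (p - xb) <= d ->
      [/\ X p + mu *: V p = p,
          [/\ enorm (X p - xb) <= rho1, enorm (V p) <= rho1
            & (f (X p) < f xb + rho1%:E)%E],
          subdiff f (X p) (V p)
        & forall y, enorm (y - xb) <= rho ->
          (f (X p) + ((2 * mu)^-1 * dotv (X p - p) (X p - p))%:E <=
           f y + ((2 * mu)^-1 * dotv (y - p) (y - p))%:E)%E]),
    (forall p p', enorm (p - xb) <= d -> enorm (p' - xb) <= d ->
      enorm (X p' - X p) <= 2 * enorm (p' - p) /\
      enorm (V p' - V p) <= 3 / mu * enorm (p' - p))
    & (forall u v, enorm (u + mu *: v - xb) <= d -> subdiff f u v ->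
      enorm (u - xb) <= rho -> enorm v <= rho -> (f u < f xb + rho%:E)%E ->
      X (u + mu *: v) = u /\ V (u + mu *: v) = v)].
Proof.
move=> rho1P; have /andP[rho10 rho1r] := rho1P.
have [d d0 hd] := proximal_point _ _ _ _ _ fN flsc sxb rho0 g mu0 mur _ rho1P.
have /choice[XV hXV] : forall p, exists xv : 'rV[R]_n * 'rV[R]_n,
    enorm (p - xb) <= d ->
      [/\ xv.1 + mu *: xv.2 = p,
          [/\ enorm (xv.1 - xb) <= rho1, enorm xv.2 <= rho1
            & (f xv.1 < f xb + rho1%:E)%E],
          subdiff f xv.1 xv.2
        & forall y, enorm (y - xb) <= rho ->
          (f xv.1 + ((2 * mu)^-1 * dotv (xv.1 - p) (xv.1 - p))%:E <=
           f y + ((2 * mu)^-1 * dotv (y - p) (y - p))%:E)%E].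
  move=> p; have [pd|pd] := pselect (enorm (p - xb) <= d); last by exists (0, 0).
  have [x [v [h1 h2 h3 h4]]] := hd p pd; exists (x, v) => _.
  by split=> //; exact: regular_subdiff_subdiff.
have frho x : (f x < f xb + rho1%:E)%E -> (f x < f xb + rho%:E)%E.
  by move=> h; apply: lt_le_trans h _; rewrite leeD2l.
have near_unique u v p : enorm (p - xb) <= d -> subdiff f u v ->
    enorm (u - xb) <= rho -> enorm v <= rho -> (f u < f xb + rho%:E)%E ->
    enorm (u - (XV p).1) <= 2 * enorm (u + mu *: v - p) /\
    enorm (v - (XV p).2) <= 3 / mu * enorm (u + mu *: v - p).
  move=> pd uv ur vr fu; have [pE [h1 h2 h3] h4 _] := hXV p pd.
  apply: (@hypomonotone_bound _ _ _ r) => //.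
    by apply: (@growth_monotone _ _ f xb _ rho) => //; rewrite ?(le_trans _ rho1r) ?frho.
  by rewrite -{3}pE scalerBr opprD addrACA.
exists d, (fun p => (XV p).1), (fun p => (XV p).2); split=> //.
  move=> p p' pd p'd; have [p'E [h1 h2 h3] h4 _] := hXV p' p'd.
  have := near_unique (XV p').1 (XV p').2 p pd h4; rewrite p'E; apply.
  - exact: le_trans h1 rho1r.
  - exact: le_trans h2 rho1r.
  - exact: frho.
move=> u v pd uv ur vr fu; have [] := near_unique u v _ pd uv ur vr fu.
rewrite subrr enorm0 !mulr0 => h1 h2.
split; apply/eqP; rewrite eq_sym -subr_eq0 -enorm_eq0 eq_le enorm_ge0 andbT //.
Qed.

(** The proximal parameter is moved by [t p], along the normal itself. As [a + mu b = t p], the test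
    [<p, a> - <w, b>] equals [t |p|^2 - <w + mu p, b>], and [|b| <= (3 / mu) t |p|]. *)
Lemma normal_bound : attentive f xb -> exists2 d : R, 0 < d &
  forall x v p w, enorm (x - xb) <= d -> enorm v <= d ->
    regular_normal (subdiff f) x v p w ->
    enorm p <= 3 / mu * enorm (w + mu *: p).
Proof.
move=> fatt; have [d0 d00 hd0] := fatt rho rho0.
have [|d [X [V [dpos hXV hL hU]]]] := proximal_map rho; first by rewrite rho0 lexx.
exists (Num.min (Num.min rho d0) (d / 2 / (1 + mu))) => [|x v p w].
  by rewrite !lt_min rho0 d00 !divr_gt0 // addr_gt0.
rewrite !le_min => /andP[/andP[xr xd0] xd] /andP[/andP[vr vd0] vd] [xv hn].
have fx := hd0 x v xv xd0 vd0.
have mu1 : 0 < 1 + mu by rewrite addr_gt0.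
have pd : enorm (x + mu *: v - xb) <= d / 2.
  rewrite addrAC; apply: le_trans (enormD _ _) _; rewrite enormZ gtr0_norm //.
  have : mu * enorm v <= mu * (d / 2 / (1 + mu)) by rewrite ler_pM2l.
  have : (1 + mu) * (d / 2 / (1 + mu)) = d / 2 by field; rewrite gt_eqF.
  by lra.
have [XE VE] : X (x + mu *: v) = x /\ V (x + mu *: v) = v by apply: hU => //; lra.
have [->|p0] := eqVneq p 0; first by rewrite enorm0 mulr_ge0 // divr_ge0 // ltW.
have {}p0 : 0 < enorm p by rewrite enorm_gt0.
apply/ler_addgt0Pr => e' e'0.
pose C := 2 + 3 / mu; have C0 : 0 < C by rewrite addr_gt0 ?divr_gt0.
pose e := e' / C; have e0 : 0 < e by rewrite divr_gt0.
have [d1 d10 hd1] := hn e e0.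
pose t := Num.min (d / 2 / enorm p) (d1 / 2 / C / enorm p).
have t0 : 0 < t by rewrite lt_min !divr_gt0.
have t1 : t * enorm p <= d / 2 by rewrite -ler_pdivlMr // ge_min lexx.
have t2 : t * enorm p * C <= d1 / 2.
  by rewrite -ler_pdivlMr // -ler_pdivlMr // ge_min lexx orbT.
clearbody t.
have tp : enorm (t *: p) = t * enorm p by rewrite enormZ gtr0_norm.
have xd' : enorm (x + mu *: v - xb) <= d by lra.
have [p' p'E] : exists p', p' = x + mu *: v + t *: p by eexists.
have p'p : p' - (x + mu *: v) = t *: p by rewrite p'E addrC addKr.
have pd' : enorm (p' - xb) <= d.
  by rewrite p'E addrAC; apply: le_trans (enormD _ _) _; rewrite tp; lra.
have [pE [_ _ _] sd _] := hXV _ pd'.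
have [h1 h2] := hL _ _ xd' pd'.
rewrite XE VE p'p tp in h1 h2.
have {}hd1 := hd1 _ _ sd.
have abE : X p' - x + mu *: (V p' - v) = t *: p.
  by rewrite scalerBr addrACA pE -opprD p'p.
move: (X _ - x) (V _ - v) abE h1 h2 hd1 => a b abE h1 h2 hd1.
have aE : a = t *: p - mu *: b by rewrite -abE addrK.
have tpe0 : 0 <= t * enorm p by rewrite mulr_ge0 // ltW.
have aC : enorm a <= t * enorm p * C.
  rewrite /C mulrDr (mulrC _ 2); apply: le_trans h1 _; rewrite lerDl.
  by rewrite mulr_ge0 // divr_ge0 // ltW.
have bC : enorm b <= t * enorm p * C.
  by rewrite /C mulrDr (mulrC _ (3 / mu)); apply: le_trans h2 _; rewrite lerDr mulr_ge0.
have h3 : dotv p a - dotv w b <= e * (t * enorm p * C).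
  have : dotv p a - dotv w b <= e * (enorm a + enorm b).
    by apply: hd1; [apply: le_lt_trans aC _|apply: le_lt_trans bC _]; lra.
  move=> /le_trans; apply; rewrite ler_pM2l //.
  by rewrite /C mulrDr (mulrC _ 2) (mulrC _ (3 / mu)) lerD.
have h4 : dotv (w + mu *: p) b <= enorm (w + mu *: p) * (3 / mu * (t * enorm p)).
  by apply: le_trans (dotv_le_enorm _ _) _; rewrite ler_wpM2l.
have h5 : t * enorm p * enorm p <=
    t * enorm p * (3 / mu * enorm (w + mu *: p) + e').
  have eC : e * C = e' by rewrite /e; field; rewrite gt_eqF.
  have : e * (t * enorm p * C) = t * enorm p * e' by rewrite -eC; ring.
  have : t * enorm p * enorm p = t * dotv p p by rewrite -enorm_sq; ring.
  by move: h3 h4; rewrite aE !dotvE; lra.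
by move: h5; rewrite ler_pM2l // mulr_gt0.
Qed.

End Map.
End ProximalMap.

(** * Curvature of normals to the subdifferential graph *)

Section GrowthOfNormals.
Context {R : realType} {n : nat}.
Implicit Types (f : 'rV[R]_n -> \bar R) (u v w x y z p q : 'rV[R]_n).

(** The hypothesis bounds slopes of [<q, V(.)>] with [q = w + mu p], so [c] is the modulus of the
    Moreau envelope [E]; the return from [E] to [f] raises it to [c / (1 - c mu)]. *)
Lemma growth_of_normals f xb r rho mu c : (forall z, (-oo < f z)%E) ->
  lower_semicontinuous f -> subdiff f xb 0 -> 0 < rho -> growth f xb (- r) rho ->
  0 < mu -> mu * r <= 2^-1 -> 0 <= c -> c * mu < 1 -> attentive f xb ->
  (exists2 d : R, 0 < d & forall x v p w,
     enorm (x - xb) <= d -> enorm v <= d -> regular_normal (subdiff f) x v p w ->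
     c * dotv (w + mu *: p) (w + mu *: p) <= dotv p (w + mu *: p)) ->
  exists2 rho' : R, 0 < rho' & growth f xb (c / (1 - c * mu)) rho'.
Proof.
move=> fN flsc sxb rho0 g mu0 mur c0 cmu fatt [d1 d10 hd1].
have [d2 d20 hd2] := fatt rho rho0.
pose rho1 := Num.min (rho / 2) (Num.min d1 (d2 / 2)).
have rho10 : 0 < rho1 by rewrite !lt_min d10 !divr_gt0.
have rho1r : rho1 <= rho / 2 by rewrite ge_min lexx.
have rho1d1 : rho1 <= d1 by below_min.
have rho1d2 : rho1 <= d2 / 2 by below_min.
clearbody rho1.
have [|d [X [V [d0 hXV hL hU]]]] := proximal_map _ _ _ _ _ fN flsc sxb rho0 g mu0 mur rho1.
  by rewrite rho10; lra.
have muI : mu != 0 by rewrite gt_eqF.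
have VL p p' : enorm (p - xb) <= d -> enorm (p' - xb) <= d ->
    enorm (V p' - V p) <= 3 / mu * enorm (p' - p).
  by move=> pd p'd; case: (hL p p' pd p'd).
have Vprox p q u N : enorm (p - xb) < d ->
    (forall p', enorm (p' - xb) <= d ->
       dotv u (p' - p) - N * dotv (p' - p) (p' - p) <= dotv q (V p' - V p)) ->
    c * dotv q q <= dotv u q.
  move=> pd hp; have [pE [h1 h2 h3] h4 _] := hXV p (ltW pd).
  (* A proximal subgradient [u] of [<q, V(.)>] at [p] yields the regular normal [(u, -(q - mu u))]
     to the graph: when [p] moves by [a + mu b], [<u, a + mu b> - <q, b> = <u, a> - <q - mu u,
     b>]. *)
  have -> : q = (q - mu *: u) + mu *: u by rewrite subrK.
  apply: (hd1 (X p) (V p)); [exact: le_trans h1 _|exact: le_trans h2 _|].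
  split=> // e e0; pose m := 1 + mu.
  have m1 : 1 <= m by rewrite lerDl ltW.
  have m0 : 0 < m by apply: lt_le_trans m1.
  have mm : mu <= m by rewrite lerDr.
  pose N' := `|N| + 1; have N'0 : 0 < N' by rewrite ltr_wpDl.
  have NN' : N <= N' by rewrite (le_trans (ler_norm N)) // lerDl.
  (* In order: the graph point stays where growth holds; attentiveness bounds its value; its
     parameter stays in the domain of the proximal map; the quadratic remainder is below [e] times
     the displacement. *)
  pose k := Num.min (Num.min (rho / 2) (d2 / 2))
    (Num.min ((d - enorm (p - xb)) / 2 / m) (e / N' / m / m / 2)).
  have k0 : 0 < k.
    by rewrite !lt_min !divr_gt0 // subr_gt0.
  exists k => // z' y' zy'; rewrite !lt_min.
  move=> /andP[/andP[zr zd2] /andP[zd ze]] /andP[/andP[yr yd2] /andP[yd ye]].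
  have z'r : enorm (z' - xb) <= rho.
    by apply: le_trans (enorm_triangle (X p) _ _) _; clear -h1 zr rho1r; lra.
  have z'd2 : enorm (z' - xb) <= d2.
    by apply: le_trans (enorm_triangle (X p) _ _) _; clear -h1 zd2 rho1d2; lra.
  have y'E : enorm y' <= enorm (y' - V p) + enorm (V p).
    by rewrite -{1}[y'](subrK (V p)) enormD.
  have y'r : enorm y' <= rho by clear -y'E yr h2 rho1r; lra.
  have y'd2 : enorm y' <= d2 by clear -y'E yd2 h2 rho1d2; lra.
  have fz' := hd2 z' y' zy' z'd2 y'd2.
  have [a aE] : exists a, a = z' - X p by eexists.
  have [b bE] : exists b, b = y' - V p by eexists.
  rewrite -aE -bE in zd ze yd ye *.
  have pE' : z' + mu *: y' - p = a + mu *: b.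
    by rewrite aE bE scalerBr addrACA -opprD pE.
  have Pm : enorm (a + mu *: b) <= m * (enorm a + enorm b).
    apply: le_trans (enormD _ _) _; rewrite enormZ gtr0_norm // mulrDr.
    by rewrite lerD // ?ler_peMl // ler_wpM2r.
  have p'd : enorm (z' + mu *: y' - xb) <= d.
    apply: le_trans (enorm_triangle p _ _) _; rewrite pE'.
    have : m * (enorm a + enorm b) <= m * ((d - enorm (p - xb)) / m).
      by rewrite ler_pM2l //; clear -zd yd; lra.
    have -> : m * ((d - enorm (p - xb)) / m) = d - enorm (p - xb).
      by field; rewrite gt_eqF.
    by clear -Pm; lra.
  have [XE VE] := hU z' y' p'd zy' z'r y'r fz'.
  have := hp _ p'd; rewrite pE' VE -bE => h.
  have h' : N * dotv (a + mu *: b) (a + mu *: b) <= e * (enorm a + enorm b).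
    have abe : enorm a + enorm b <= e / N' / m / m by clear -ze ye; lra.
    have h1' : N' * (m * m * (enorm a + enorm b)) <= e.
      have : N' * (m * m * (enorm a + enorm b)) <= N' * (m * m * (e / N' / m / m)).
        by rewrite ler_pM2l // ler_pM2l ?mulr_gt0.
      have -> // : N' * (m * m * (e / N' / m / m)) = e.
      by field; rewrite !gt_eqF.
    apply: le_trans (_ : N' * dotv (a + mu *: b) (a + mu *: b) <= _).
      by rewrite ler_wpM2r ?dotvv_ge0.
    apply: le_trans (_ : N' * (m * (enorm a + enorm b)) ^+ 2 <= _).
      by rewrite ler_pM2l // -enorm_le_sq // mulr_ge0 ?addr_ge0 // ltW.
    have ab0 : 0 <= enorm a + enorm b by rewrite addr_ge0.
    have := ler_wpM2r ab0 h1'; rewrite expr2; clear; lra.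
  by move: h h'; rewrite !dotvE; clear; lra.
have Vmono := monotone_of_proximal V xb d (3 / mu) c d0 (divr_ge0 (ler0n _ 3) (ltW mu0)) VL Vprox.
pose E p := fine (f (X p)) + (2 * mu)^-1 * dotv (X p - p) (X p - p).
have Xp p : enorm (p - xb) <= d -> X p - p = - (mu *: V p).
  by move=> /hXV[pE _ _ _]; rewrite -{2}pE opprD addrA subrr add0r.
(* Testing the minimality of [X p'] against the competitor [X p] bounds the envelope from above,
   with [V p] in the role of its gradient. *)
have EM p p' : enorm (p - xb) <= d / 2 -> enorm (p' - xb) <= d / 2 ->
    E p' <= E p + dotv (V p) (p' - p) + (2 * mu)^-1 * dotv (p' - p) (p' - p).
  move=> pd p'd; have {}pd : enorm (p - xb) <= d by clear -pd d0; lra.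
  have {}p'd : enorm (p' - xb) <= d by clear -p'd d0; lra.
  have [pE [h1 h2 h3] h4 _] := hXV p pd; have [_ _ s' h'] := hXV p' p'd.
  have /h' : enorm (X p - xb) <= rho by clear -h1 rho1r rho0; lra.
  rewrite (efin_num _ _ fN (subdiff_fin _ _ _ h4)).
  rewrite (efin_num _ _ fN (subdiff_fin _ _ _ s')) -!EFinD lee_fin -/(E p').
  move=> /le_trans; apply; rewrite /E Xp //.
  have -> : X p - p' = - (mu *: V p) - (p' - p).
    by rewrite -Xp // opprB addrA subrK.
  move: (V p) (p' - p) => v D; rewrite !dotvE (dotvC D v).
  by le_of_eq; field.
have M0 : 0 <= (2 * mu)^-1 by rewrite invr_ge0 mulr_ge0 // ltW.
have Ecvx := convex_of_monotone E V xb (d / 2) (2 * mu)^-1 c c0 M0 EM Vmono.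
pose s := c / (1 - c * mu); rewrite -/s.
have cmu0 : 0 < 1 - c * mu by rewrite subr_gt0.
have s0 : 0 <= s by rewrite divr_ge0 // ltW.
(* [k = 1 / (1 - c mu)]: among all [Z], the choice [Z = k (x - u)] maximises the lower bound for
   [f x] obtained from [f x >= E (p + Z) - |x - p - Z|^2 / (2 mu)] and the convexity of [E]; [key]
   evaluates it there. *)
pose k := 1 + mu * s; have k1 : 1 <= k by rewrite lerDl mulr_ge0 // ltW.
have k0 : 0 < k by apply: lt_le_trans k1.
pose m := 1 + mu + 2 * k.
have m0 : 0 < m by rewrite !addr_gt0 // mulr_gt0.
pose rho' := Num.min rho (d / 2 / m).
exists rho' => [|u v x uv ur vr fu xr]; first by rewrite lt_min rho0 !divr_gt0.
have rr : rho' <= rho by rewrite ge_min lexx.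
have rd : m * rho' <= d / 2.
  by rewrite mulrC -ler_pdivlMr // ge_min lexx orbT.
have r'0 : 0 <= rho' by apply: le_trans ur.
clearbody rho'.
have {}fu : (f u < f xb + rho%:E)%E by apply: lt_le_trans fu _; rewrite leeD2l.
have h2 : mu * enorm v <= mu * rho' by rewrite ler_pM2l.
have h3 : 0 <= k * rho' by rewrite mulr_ge0 // ltW.
have h0 : 0 <= mu * rho' by rewrite mulr_ge0 // ltW.
have [Y YE] : exists Y, Y = x - u by eexists.
have [p pE] : exists p, p = u + mu *: v by eexists.
have Yr : enorm Y <= 2 * rho'.
  by rewrite YE; apply: le_trans (enorm_triangle xb _ _) _; rewrite (enormBC xb); clear -ur xr; lra.
have pr : enorm (p - xb) <= rho' + mu * rho'.
  rewrite pE addrAC; apply: le_trans (enormD _ _) _; rewrite enormZ gtr0_norm //.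
  by clear -ur h2; lra.
have rdE : rho' + mu * rho' + 2 * (k * rho') <= d / 2.
  by move: rd; rewrite /m; clear; lra.
have pd : enorm (p - xb) <= d / 2 by clear -pr rdE h3; lra.
have p'd : enorm (p + k *: Y - xb) <= d / 2.
  rewrite addrAC; apply: le_trans (enormD _ _) _; rewrite enormZ gtr0_norm //.
  have : k * enorm Y <= k * (2 * rho') by rewrite ler_pM2l.
  by clear -pr rdE; lra.
have [XE VE] : X p = u /\ V p = v.
  rewrite pE; apply: hU => //; rewrite -?pE; [clear -pd d0|clear -ur rr|clear -vr rr]; lra.
have := Ecvx p (p + k *: Y) pd p'd.
have p'd' : enorm (p + k *: Y - xb) <= d by clear -p'd d0; lra.
have [_ _ s' h'] := hXV (p + k *: Y) p'd'.
have /h' : enorm (x - xb) <= rho by clear -xr rr; lra.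
have [fx|] := ltP (f x) +oo%E; last first.
  by rewrite leye_eq => /eqP-> _; rewrite leey.
rewrite (efin_num _ _ fN (subdiff_fin _ _ _ uv)) (efin_num _ _ fN fx).
rewrite (efin_num _ _ fN (subdiff_fin _ _ _ s')) -!EFinD !lee_fin -/(E _).
rewrite {2}/E Xp ?XE ?VE; last by clear -pd d0; lra.
have -> : x - (p + k *: Y) = Y - mu *: v - k *: Y.
  by rewrite pE YE; clear; row_ring.
have -> : p + k *: Y - p = k *: Y by rewrite addrC addKr.
rewrite -YE => h4 h5.
have cE : c = s / k.
  rewrite /k /s; field; rewrite gt_eqF //= gt_eqF //.
  by rewrite mulrC subrK ltr01.
have key : dotv v (k *: Y) + c / 2 * dotv (k *: Y) (k *: Y)
    + (2 * mu)^-1 * dotv (- (mu *: v)) (- (mu *: v))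
    - (2 * mu)^-1 * dotv (Y - mu *: v - k *: Y) (Y - mu *: v - k *: Y)
    = dotv v Y + s / 2 * dotv Y Y.
  rewrite !dotvE (dotvC Y v) cE /k; clearbody s; field.
  by rewrite muI /= gt_eqF.
by move: h4 h5 key; clear; lra.
Qed.

End GrowthOfNormals.

(** * Variational convexity as a growth inequality *)

Section VariationalConvexity.
Context {R : realType} {n : nat}.
Implicit Types (f theta : 'rV[R]_n -> \bar R) (u v w x y z p q : 'rV[R]_n).

Lemma nbhs_eball x (e : R) : 0 < e -> nbhs x (eball x e).
Proof. by move=> e0; apply/nbhs_enorm; exists e => // y /ltW. Qed.

Lemma segmentE x y (t : R) : t *: x + (1 - t) *: y = y + t *: (x - y).
Proof. by row_ring. Qed.

Lemma convex_eball x (e : R) : convex_set (eball x e).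
Proof.
move=> y z l; rewrite !inE /eball /= => yx zx.
have -> : conv l (y : convex_lmodType _) z - x = z + l%:num *: (y - z) - x.
  by rewrite -segmentE.
by apply: enorm_segment => //; apply/andP; split.
Qed.

Lemma segment_sq x y (t : R) :
  dotv (t *: x + (1 - t) *: y) (t *: x + (1 - t) *: y) =
  t * dotv x x + (1 - t) * dotv y y - t * (1 - t) * dotv (x - y) (x - y).
Proof. by rewrite !dotvE (dotvC y x); ring. Qed.

Lemma small_pos (a b : R) : 0 <= a -> 0 < b ->
  exists t, [/\ 0 < t, t < 1 & t * a < b].
Proof.
move=> a0 b0; have a1 : 0 < a + 1 by rewrite ltr_wpDl.
exists (Num.min 2^-1 (b / (a + 1))).
have t0 : 0 < Num.min 2^-1 (b / (a + 1)) by rewrite lt_min invr_gt0 ltr0Sn divr_gt0.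
have t1 : Num.min 2^-1 (b / (a + 1)) <= 2^-1 by rewrite ge_min lexx.
have t2 : Num.min 2^-1 (b / (a + 1)) * (a + 1) <= b.
  by rewrite -ler_pdivlMr // ge_min lexx orbT.
by split=> //; lra.
Qed.

(** For a regular subgradient, the local estimate at [u' + t (x - u')] spreads to [x] by convexity,
    on dividing by [t]. Passing to limiting subgradients uses only that the values at the
    approximating points do not fall far below [theta u]. *)
Lemma convex_subdiff theta u v x : (forall z, (-oo < theta z)%E) ->
  convex_on setT theta -> subdiff theta u v ->
  (theta u + (dotv v (x - u))%:E <= theta x)%E.
Proof.
move=> tN tc.
have regular u' v' : regular_subdiff theta u' v' ->
    (theta u' + (dotv v' (x - u'))%:E <= theta x)%E.
  move=> /regular_subdiffP[] // tu h.
  have [tx|] := ltP (theta x) +oo%E; last first.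
    by rewrite leye_eq => /eqP->; rewrite leey.
  rewrite (efin_num _ _ tN tu) (efin_num _ _ tN tx) -EFinD lee_fin.
  apply/ler_addgt0Pr => e e0; pose k := enorm (x - u') + 1.
  have k0 : 0 < k by rewrite ltr_wpDl.
  have [d d0 hd] := h (e / k) (divr_gt0 e0 k0).
  have [t [t0 t1 td]] := small_pos (enorm (x - u')) d (enorm_ge0 _) d0.
  have := tc x u' t I I; rewrite t0 t1 => /(_ isT).
  have := hd (t *: x + (1 - t) *: u'); rewrite segmentE.
  have -> : u' + t *: (x - u') - u' = t *: (x - u') by rewrite addrC addKr.
  rewrite enormZ gtr0_norm // => /(_ td) h1 h2.
  have := le_trans h1 h2.
  rewrite (efin_num _ _ tN tu) (efin_num _ _ tN tx) -!EFinM -!EFinD lee_fin.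
  rewrite dotvZr => h3.
  have : e / k * (t * enorm (x - u')) <= t * e.
    have : e / k * enorm (x - u') <= e.
      by rewrite mulrAC ler_pdivrMr // ler_pM2l // lerDl.
    by move=> h4; have := ler_wpM2l (ltW t0) h4; lra.
  move=> h5; rewrite -(ler_pM2l t0); lra.
move=> /subdiffP[] // tu h.
have [tx|] := ltP (theta x) +oo%E; last first.
  by rewrite leye_eq => /eqP->; rewrite leey.
rewrite (efin_num _ _ tN tu) (efin_num _ _ tN tx) -EFinD lee_fin.
apply/ler_addgt0Pr => e e0; pose k := 2 + enorm (x - u) + enorm v.
have k0 : 0 < k by rewrite /k !ltr_wpDr.
have [d [d0 d1 dk]] := small_pos k e (ltW k0) e0.
have [u' [v' [u'u v'v _ tu' /[dup] rs /regular]]] := h d d0.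
have tu'y : (theta u' < +oo)%E by case: rs.
move: tu'; rewrite (efin_num _ _ tN tu) (efin_num _ _ tN tx) (efin_num _ _ tN tu'y).
rewrite -!EFinD lte_fin lee_fin => h1 h2.
have h3 : - (enorm (v' - v) * enorm (x - u')) <= dotv (v' - v) (x - u').
  exact: dotv_geN_enorm.
have h4 : - (enorm v * enorm (u - u')) <= dotv v (u - u').
  exact: dotv_geN_enorm.
have h5 : enorm (x - u') <= enorm (x - u) + d.
  by apply: le_trans (enorm_triangle u _ _) _; rewrite (enormBC u); lra.
have h6 : enorm (v' - v) * enorm (x - u') <= d * (enorm (x - u) + 1).
  by apply: ler_pM => //; lra.
have h7 : enorm v * enorm (u - u') <= enorm v * d.
  by rewrite ler_wpM2l // enormBC ltW.
have h8 : dotv v' (x - u') = dotv (v' - v) (x - u') + dotv v (u - u') + dotv v (x - u).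
  by rewrite !dotvE; ring.
by move: dk; rewrite /k; lra.
Qed.

(** The supporting inequality at [u + t (x - u)] meets strong convexity along the segment; dividing
    by [t] leaves the factor [(1 - t) s / 2], with [t] arbitrarily small. *)
Lemma strongly_convex_subgradient theta (U : set 'rV[R]_n) (s : R) u v x :
  (forall z, (-oo < theta z)%E) -> (theta u < +oo)%E ->
  convex_on U (fun y => theta y - (s / 2 * enorm y ^+ 2)%:E)%E ->
  (forall y, (theta u + (dotv v (y - u))%:E <= theta y)%E) -> U u -> U x ->
  (theta u + (dotv v (x - u) + s / 2 * dotv (x - u) (x - u))%:E <= theta x)%E.
Proof.
move=> tN tu tc h Uu Ux.
have [tx|] := ltP (theta x) +oo%E; last first.
  by rewrite leye_eq => /eqP->; rewrite leey.
rewrite (efin_num _ _ tN tu) (efin_num _ _ tN tx) -EFinD lee_fin.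
apply/ler_addgt0Pr => e e0.
have [t [t0 t1 te]] := small_pos (`|s / 2| * dotv (x - u) (x - u)) e
  (mulr_ge0 (normr_ge0 _) (dotvv_ge0 _)) e0.
have := tc x u t Ux Uu; rewrite t0 t1 => /(_ isT).
have := h (t *: x + (1 - t) *: u); rewrite !enorm_sq segment_sq.
have -> : t *: x + (1 - t) *: u - u = t *: (x - u).
  by rewrite segmentE addrC addKr.
set a := theta (t *: x + _).
rewrite (efin_num _ _ tN tu) (efin_num _ _ tN tx) -!EFinB -!EFinM -!EFinD dotvZr.
have [ay h1 h2|] := ltP a +oo%E; last first.
  by rewrite leye_eq => /eqP->.
have aE : a = (fine a)%:E := efin_num _ _ tN ay.
move: h1 h2; rewrite aE -!EFinB !lee_fin => h1 h2.
have h3 : s / 2 * dotv (x - u) (x - u) * t <= `|s / 2| * dotv (x - u) (x - u) * t.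
  by rewrite ler_wpM2r ?ler_wpM2r ?dotvv_ge0 ?ler_norm // ltW.
have h4 : fine (theta u) + dotv v (x - u) + s / 2 * (1 - t) * dotv (x - u) (x - u)
   <= fine (theta x).
  by rewrite -(ler_pM2l t0); lra.
by lra.
Qed.

(** The graph identity moves [(u, v)] to the graph of the subdifferential of the convex [theta],
    with [f u = theta u]; at [x] the inequality [theta x <= f x] suffices. *)
Lemma growth_of_witness f xb (U V : set 'rV[R]_n) theta (eps s : R) :
  (forall z, (-oo < f z)%E) -> (f xb < +oo)%E ->
  var_convex_witness f xb 0 U V theta eps ->
  convex_on U (fun x => theta x - (s / 2 * enorm x ^+ 2)%:E)%E ->
  exists2 rho : R, 0 < rho & growth f xb s rho.
Proof.
move=> fN fxb [[/nbhs_enorm[dU dU0 hU] /nbhs_enorm[dV dV0 hV] _ _]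
  [[tN _] _ tc tf] eps0 geq feq] sc.
pose rho := Num.min eps (Num.min (dU / 2) (dV / 2)).
have rho0 : 0 < rho by rewrite !lt_min eps0 !divr_gt0.
have r1 : rho <= eps by rewrite ge_min lexx.
have r2 : rho <= dU / 2 by below_min.
have r3 : rho <= dV / 2 by below_min.
clearbody rho; exists rho => // u v x uv ur vr fu xr.
have Uu : U u by apply: hU; lra.
have Ux : U x by apply: hU; lra.
have Vv : V v by apply: hV; rewrite subr0; lra.
have fueps : (f u < f xb + eps%:E)%E by apply: lt_le_trans fu _; rewrite leeD2l.
have guv : ((U `*` V) `&` gph (subdiff theta)) (u, v).
  by rewrite -geq; split.
have [_ /= tuv] := guv.
apply: le_trans (tf x Ux); rewrite (feq _ _ guv).
apply: (@strongly_convex_subgradient _ U) => //.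
  exact: subdiff_fin tuv.
by move=> y; apply: convex_subdiff.
Qed.

End VariationalConvexity.

(** * The convex witness as an envelope of quadratic minorants *)

Section SupportEnvelope.
Context {R : realType} {n : nat}.
Implicit Types (f theta : 'rV[R]_n -> \bar R) (u v w x y z : 'rV[R]_n).

Lemma continuous_enorm_real (h : 'rV[R]_n -> R) x :
  {for x, continuous h} <->
  forall e : R, 0 < e -> exists2 d : R, 0 < d &
    forall y, enorm (y - x) < d -> `|h y - h x| < e.
Proof.
split=> [hx e e0|H].
  have /hx/nbhs_enorm[d d0 hd] : nbhs (h x) (ball (h x) e) by exact: nbhsx_ballx.
  by exists d => // y /hd; rewrite /ball /= distrC.
apply/(@cvgrPdist_lt _ _ _ (nbhs x)) => e e0; have [d d0 hd] := H e e0.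
by apply/nbhs_enorm; exists d => // y /hd; rewrite distrC.
Qed.

Lemma continuous_dotv v u : continuous (fun x => dotv v (x - u)).
Proof.
move=> x; apply/continuous_enorm_real => e e0.
have k0 : 0 < enorm v + 1 by rewrite ltr_wpDl.
exists (e / (enorm v + 1)) => [|y yx]; first by rewrite divr_gt0.
rewrite -dotvBr opprB addrA subrK.
apply: le_lt_trans (normr_dotv_le _ _) _.
rewrite ltr_pdivlMr // in yx; apply: le_lt_trans yx.
by rewrite mulrC ler_wpM2l // lerDl.
Qed.

Section Envelope.
Variables (f : 'rV[R]_n -> \bar R) (xb : 'rV[R]_n) (s rho : R).
Hypotheses (fN : forall z, (-oo < f z)%E) (flsc : lower_semicontinuous f)
  (sxb : subdiff f xb 0) (rho0 : 0 < rho) (s0 : 0 <= s) (g : growth f xb s rho).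

Let G (p : 'rV[R]_n * 'rV[R]_n) : Prop :=
  [/\ subdiff f p.1 p.2, enorm (p.1 - xb) <= rho, enorm p.2 <= rho
    & (f p.1 < f xb + rho%:E)%E].

Let k (p : 'rV[R]_n * 'rV[R]_n) x : R :=
  fine (f p.1) + (dotv p.2 (x - p.1) + s / 2 * dotv (x - p.1) (x - p.1)).

(** [fine] inside [k] loses nothing on [G]: a point carrying a subgradient has a finite value. *)
Definition support_envelope x : \bar R := ereal_sup [set (k p x)%:E | p in G].
Local Notation theta := support_envelope.

Let fxb : (f xb < +oo)%E := subdiff_fin _ _ _ sxb.

Let Gxb : G (xb, 0).
Proof.
split=> //=; rewrite ?subrr ?enorm0 ?ltW //.
by rewrite (efin_num _ _ fN fxb) -EFinD lte_fin ltrDl.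
Qed.

Let k_le p x : G p -> ((k p x)%:E <= theta x)%E.
Proof. by move=> Gp; apply: ereal_sup_ubound; exists p. Qed.

Let thetaN z : (-oo < theta z)%E.
Proof. by apply: lt_le_trans (k_le _ z Gxb); rewrite ltNyr. Qed.

Let theta_le x : enorm (x - xb) <= rho -> (theta x <= f x)%E.
Proof.
move=> xr; apply: ge_ereal_sup => _ [[u v] [uv ur vr fu] <-] /=.
have := g u v x uv ur vr fu xr.
by rewrite (efin_num _ _ fN (subdiff_fin _ _ _ uv)) -EFinD.
Qed.

Let theta_eq p : G p -> theta p.1 = f p.1.
Proof.
move=> Gp; have [uv ur vr fu] := Gp; apply/eqP; rewrite eq_le theta_le //=.
apply: le_trans (k_le _ _ Gp); rewrite /k subrr !dotv0 mulr0 !addr0.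
by rewrite -(efin_num _ _ fN (subdiff_fin _ _ _ uv)).
Qed.

Let theta_sub p x : G p -> (theta p.1 + (dotv p.2 (x - p.1))%:E <= theta x)%E.
Proof.
move=> Gp; have [uv ur vr fu] := Gp; rewrite theta_eq //.
apply: le_trans (k_le _ _ Gp).
rewrite (efin_num _ _ fN (subdiff_fin _ _ _ uv)) -EFinD lee_fin lerD2l lerDl.
by rewrite mulr_ge0 ?dotvv_ge0 // divr_ge0.
Qed.

Let theta_subdiff p : G p -> subdiff theta p.1 p.2.
Proof.
move=> Gp; apply: regular_subdiff_subdiff => //.
apply: (@regular_subdiff_quadratic _ _ _ _ _ 1 0) => //.
  by rewrite theta_eq //; case: Gp => /subdiff_fin.
by move=> y _; rewrite mul0r subr0; exact: theta_sub.
Qed.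

Let k_segment p x y (t : R) :
  k p (t *: x + (1 - t) *: y) =
  t * k p x + (1 - t) * k p y - s / 2 * (t * (1 - t) * dotv (x - y) (x - y)).
Proof.
have E : t *: x + (1 - t) *: y - p.1 = t *: (x - p.1) + (1 - t) *: (y - p.1).
  by row_ring.
have E' : x - y = (x - p.1) - (y - p.1) by rewrite opprB addrA subrK.
rewrite /k E E'; move: (x - p.1) (y - p.1) => A B.
rewrite segment_sq !dotvE (dotvC B A); ring.
Qed.

(** Each member of the family satisfies this with equality, by [k_segment]. The quadratic defect
    stands on the left so that no infinite value is subtracted. *)
Let theta_strongly_convex (x y : 'rV[R]_n) (t : R) : 0 < t < 1 ->
  (theta (t *: x + (1 - t) *: y)
     + (s / 2 * (t * (1 - t) * dotv (x - y) (x - y)))%:E <=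
   t%:E * theta x + (1 - t)%:E * theta y)%E.
Proof.
move=> /andP[t0 t1]; rewrite -leeBrDr //.
apply: ge_ereal_sup => _ [p Gp <-]; rewrite k_segment leeBrDr // -EFinD subrK.
rewrite EFinD !EFinM; apply: leeD; apply: lee_wpmul2l; rewrite ?lee_fin ?k_le //.
  exact: ltW.
by rewrite subr_ge0 ltW.
Qed.

Let theta_lsc : lower_semicontinuous theta.
Proof.
move=> x a /ereal_sup_gt[_ [p Gp <-]]; rewrite lte_fin => ak.
have kc : continuous (k p).
  have c1 : continuous (fun y => dotv p.2 (y - p.1)) := continuous_dotv _ _.
  have c2 : continuous (fun y => s / 2 * dotv (y - p.1) (y - p.1)).
    exact: continuous_sq_enorm (continuous_subl _).
  move=> y; apply: (@cvgD _ _ _ (nbhs y)); first exact: cvg_cst.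
  by apply: (@cvgD _ _ _ (nbhs y)); [exact: c1|exact: c2].
exists [set y | a < k p y]; first exact: (cvgr_gt (k p x) (kc x)).
by move=> y /= ay; apply: lt_le_trans (k_le _ _ Gp); rewrite lte_fin.
Qed.

Lemma witness_of_growth : attentive f xb ->
  exists U V eps, var_convex_witness f xb 0 U V theta eps /\
    convex_on U (fun x => theta x - (s / 2 * enorm x ^+ 2)%:E)%E.
Proof.
move=> fatt; have [d1 d10 hd1] := fatt rho rho0.
have g0 : growth f xb (- 0) rho by apply: growth_le g; rewrite ?oppr0.
have [||d2 [X [V [d20 hXV _ _]]]] :=
  proximal_map _ _ _ _ 1 fN flsc sxb rho0 g0 ltr01 _ rho.
- by rewrite mulr0 invr_ge0.
- by rewrite rho0 lexx.
(* [rho] keeps points where [theta <= f], [d1] supplies the value bound from attentiveness, and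
   [d2 / 2] puts [x + v] in the domain of the proximal map. *)
pose d := Num.min rho (Num.min d1 (d2 / 2)).
have d0 : 0 < d by rewrite !lt_min rho0 d10 divr_gt0.
have dr : d <= rho by rewrite ge_min lexx.
have dd1 : d <= d1 by below_min.
have dd2 : d <= d2 / 2 by below_min.
clearbody d.
have inG x v : subdiff f x v -> enorm (x - xb) <= d -> enorm (v - 0) <= d -> G (x, v).
  rewrite subr0 => xv xd vd; split=> //=; [exact: le_trans xd dr|exact: le_trans vd dr|].
  by apply: hd1 xv _ _; [exact: le_trans xd dd1|exact: le_trans vd dd1].
have tcvx : convex_on setT theta.
  move=> x y t _ _ t01; apply: le_trans (theta_strongly_convex x y t t01).
  have /andP[t0 t1] := t01; rewrite leeDl // lee_fin.
  by rewrite !mulr_ge0 ?dotvv_ge0 ?invr_ge0 ?subr_ge0 // ltW.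
(* Maximality: the proximal point of [x + v] lies on the graph of [subdiff f],
   and monotonicity of [subdiff theta] identifies it with [x]. *)
have back x v : subdiff theta x v -> enorm (x - xb) <= d -> enorm (v - 0) <= d ->
    G (x, v).
  rewrite subr0 => xv xd vd.
  have pd : enorm (x + 1 *: v - xb) <= d2.
    by rewrite scale1r addrAC; apply: le_trans (enormD _ _) _; lra.
  have [pE [h1 h2 h3] h4 _] := hXV _ pd.
  have [x' x'E] : exists x', x' = X (x + 1 *: v) by eexists.
  have [v' v'E] : exists v', v' = V (x + 1 *: v) by eexists.
  rewrite -x'E -?v'E in pE h1 h2 h3 h4.
  have Gx' : G (x', v') by [].
  have := convex_subdiff theta x v x' thetaN tcvx xv.
  have := theta_sub _ x Gx' => /=.
  have tx := subdiff_fin _ _ _ xv.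
  have tx' := subdiff_fin _ _ _ (theta_subdiff _ Gx').
  rewrite (efin_num _ _ thetaN tx) (efin_num _ _ thetaN tx') -!EFinD !lee_fin => m1 m2.
  have bE : v' - v = - (x' - x).
    have : (x' - x) + (v' - v) = 0.
      by rewrite addrACA -opprD; move: pE; rewrite !scale1r => ->; rewrite subrr.
    by move/eqP; rewrite addrC addr_eq0 => /eqP.
  have xx' : x' = x.
    apply/eqP; rewrite -subr_eq0 -dotvv_eq0 eq_le dotvv_ge0 andbT.
    have : dotv (x' - x) (v' - v) = - dotv (x' - x) (x' - x) by rewrite bE dotvNr.
    move: m1 m2; rewrite -(opprB x' x); move: (x' - x) => a.
    by rewrite !dotvE !(dotvC a); lra.
  have vv' : v' = v by apply/eqP; rewrite -subr_eq0 bE xx' subrr oppr0.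
  by rewrite -xx' -vv'.
exists (eball xb d), (eball 0 d), rho; split; last first.
  move=> x y t _ _ t01; cbv beta; have /andP[t0 t1] := t01.
  have t1' : 0 < 1 - t by rewrite subr_gt0.
  rewrite leeBlDr //; have := theta_strongly_convex x y t t01; rewrite -leeBrDr //.
  move=> /le_trans; apply.
  rewrite !enorm_sq segment_sq.
  case: (theta x) (thetaN x) => [a||] // _; case: (theta y) (thetaN y) => [b||] // _.
  - by rewrite -!EFinB -!EFinM -!EFinD -?EFinB lee_fin; lra.
  - by rewrite addye // gt0_muley ?lte_fin // -EFinB -!EFinM addey // addye // leey.
  - by rewrite addye // gt0_muley ?lte_fin // -EFinB -!EFinM addye // addye // leey.
  - by rewrite !addye // !gt0_muley ?lte_fin // addye // leey.
split=> //.
- split; [exact: nbhs_eball|exact: nbhs_eball|exact: convex_eball|exact: convex_eball].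
- split=> //.
  + by split=> //; exists xb; rewrite /edom /= (theta_eq _ Gxb).
  + by move=> x xd; apply: theta_le; exact: le_trans xd dr.
- apply/seteqP; split=> -[x v] [[/= xU vV] xv].
    have [xd _] := xU; split=> //.
    exact: (theta_subdiff _ (inG x v xv xd vV)).
  by have [] := back x v xv xU vV.
- by move=> x v /= [[xU vV] xv]; rewrite (theta_eq _ (back x v xv xU vV)).
Qed.

End Envelope.
End SupportEnvelope.

(** * Maps of class C2 and metric regularity *)

Section Calculus.
Context {R : realType}.

(** Duality: [|y B^T|^2 = <y, y B^T B> <= |y| k |y B^T|]. *)
Lemma enorm_trmx {n m} (B : 'M[R]_(n, m)) (k : R) : 0 <= k ->
  (forall w : 'rV[R]_n, enorm (w *m B) <= k * enorm w) ->
  forall y : 'rV[R]_m, enorm (y *m B^T) <= k * enorm y.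
Proof.
move=> k0 h y; have [y0|y0] := eqVneq (enorm (y *m B^T)) 0.
  by rewrite y0 mulr_ge0.
have {}y0 : 0 < enorm (y *m B^T) by rewrite lt_def y0 enorm_ge0.
rewrite -(ler_pM2r y0) -expr2 enorm_sq dotv_mulmxl trmxK.
apply: le_trans (dotv_le_enorm _ _) _.
by rewrite mulrC mulrAC; apply: ler_wpM2r => //; apply: h.
Qed.

Lemma diff_expansion {n m} (F : 'rV[R]_n -> 'rV[R]_m) x : differentiable F x ->
  forall e : R, 0 < e -> exists2 d : R, 0 < d & forall y, enorm (y - x) < d ->
    enorm (F y - F x - (y - x) *m 'J F x) <= e * enorm (y - x).
Proof.
move=> dF e e0.
have := diff_locally dF; set k := 'o _ => FE.
have n1 : 0 < n%:R + 1 :> R by rewrite ltr_wpDl.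
have m1 : 0 < m%:R + 1 :> R by rewrite ltr_wpDl.
have e'0 : 0 < e / (m%:R + 1) by rewrite divr_gt0.
have /nbhs_enorm[d d0 hd] := littleoP [littleo of k] e'0.
exists d => // y yx.
have -> : F y - F x - (y - x) *m 'J F x = k (y - x).
  have E : F y = F x + 'd F x (y - x) + k (y - x).
    by have := congr1 (fun h => h (y - x)) FE; rewrite /= subrK.
  by rewrite E mul_rV_lin1; row_ring.
apply: le_trans (enorm_le_mx_norm _) _.
have := hd (y - x); rewrite subr0 => /(_ yx) h.
apply: le_trans (_ : (m%:R + 1) * (e / (m%:R + 1) * `|y - x|) <= _).
  by apply: ler_pM => //; rewrite ?ler0n // lerDl.
rewrite mulrA mulrCA divff ?mulr1 ?gt_eqF //.
by rewrite ler_pM2l // mx_norm_le_enorm.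
Qed.

Lemma derive_gradient {n} (f : 'rV[R]_n -> R) x d : differentiable f x ->
  'D_d f x = dotv (gradient f x) d.
Proof.
move=> df; rewrite deriveE // {1}[d]row_sum_delta linear_sum /dotv.
apply: eq_bigr => i _; rewrite linearZ /= -deriveE // mxE.
by rewrite mulrC.
Qed.

Lemma derive_coord {n m} (F : 'rV[R]_n -> 'rV[R]_m) x d j : differentiable F x ->
  'D_d (fun z => F z 0 j) x = (d *m 'J F x) 0 j.
Proof.
move=> dF; rewrite -deriveEjacobian // derive_mx; last exact: diff_derivable.
by rewrite mxE.
Qed.

Lemma differentiable_coordinates {n m} (F : 'rV[R]_n -> 'rV[R]_m) x :
  (forall j, differentiable (fun z => F z 0 j) x) -> differentiable F x.
Proof.
move=> dF; have -> : F = \sum_(j < m) (fun z => F z 0 j *: delta_mx 0 j).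
  by apply/funext => z; rewrite fct_sumE [LHS]row_sum_delta.
apply: differentiable_sum => j; exact: differentiableZl.
Qed.

Lemma jacobian_gradient {n m} (F : 'rV[R]_n -> 'rV[R]_m) x d j :
  differentiable F x ->
  (d *m 'J F x) 0 j = dotv (gradient (fun z => F z 0 j) x) d.
Proof.
move=> dF; rewrite -derive_coord // derive_gradient //.
exact: (differentiable_comp dF (differentiable_coord _ _ _)).
Qed.

Lemma mean_value_line {n} (f : 'rV[R]_n -> R) u d :
  (forall x, differentiable f x) ->
  exists2 t : R, 0 <= t <= 1 & f (u + d) - f u = 'D_d f (u + t *: d).
Proof.
move=> df; pose h (t : R) := f (u + t *: d).
have dh (t : R) : is_derive t (1 : R) h ('D_d f (u + t *: d)).
  have E : (fun k : R => k^-1 *: ((h \o shift t) (k *: 1) - h t)) =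
      (fun k => k^-1 *: ((f \o shift (u + t *: d)) (k *: d) - f (u + t *: d))).
    apply/funext => k; rewrite /h /= [k *: 1]mulr1 scalerDl.
    by rewrite addrCA.
  split.
    by rewrite /derivable E; exact: (diff_derivable (df _)).
  by rewrite /derive E.
have [|t t01] := MVT_segment (f := h) (df := fun t => 'D_d f (u + t *: d)) (a := 0) (b := 1) ler01.
  by apply: derivable_within_continuous => t _; have [] := dh t.
rewrite subr0 mulr1 /h scale1r scale0r addr0 => E.
by exists t => //; move: t01; rewrite in_itv.
Qed.

(** The reciprocal of one plus the sum of the [1 / rho j] avoids choosing a minimum and covers
    [m = 0]. *)
Lemma positive_lower_bound {m} (rho : 'I_m -> R) : (forall j, 0 < rho j) ->
  exists2 r, 0 < r & forall j, r <= rho j.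
Proof.
move=> rho0; have S0 : 0 <= \sum_j (rho j)^-1.
  by apply: sumr_ge0 => j _; rewrite invr_ge0 ltW.
have S1 : 0 < 1 + \sum_j (rho j)^-1 by rewrite ltr_pwDl.
exists (1 + \sum_j (rho j)^-1)^-1 => [|j]; first by rewrite invr_gt0.
rewrite -[leRHS]invrK lef_pV2 ?posrE ?invr_gt0 //.
rewrite (bigD1 j) //= addrCA lerDl addr_ge0 // sumr_ge0 // => i _.
by rewrite invr_ge0 ltW.
Qed.

Lemma enorm_segment_lt {n} (p1 p2 xb : 'rV[R]_n) (t k : R) : 0 <= t <= 1 ->
  enorm (p1 - xb) < k -> enorm (p2 - xb) < k ->
  enorm (p1 + t *: (p2 - p1) - xb) < k.
Proof.
move=> t01 h1 h2.
apply: le_lt_trans (_ : Num.max (enorm (p1 - xb)) (enorm (p2 - xb)) < _).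
  by apply: enorm_segment => //; rewrite le_max lexx ?orbT.
by rewrite gt_max h1 h2.
Qed.

(** Continuity in the Euclidean operator norm, whereas the library norm of a matrix is its largest
    entry in absolute value. *)
Definition opcont {n p m} (F : 'rV[R]_n -> 'M[R]_(p, m)) x : Prop :=
  forall e : R, 0 < e -> exists2 d : R, 0 < d & forall y, enorm (y - x) < d ->
    forall w : 'rV[R]_p, enorm (w *m (F y - F x)) <= e * enorm w.

Lemma enorm_mulmx_norm {p m} (A : 'M[R]_(p, m)) w :
  enorm (w *m A) <= (m * p)%:R * `|A| * enorm w.
Proof.
apply: le_trans (enorm_le_sum _) _.
apply: le_trans (_ : \sum_(j < m) (p%:R * `|A| * enorm w) <= _); last first.
  by rewrite sumr_const card_ord -[leLHS]mulr_natl natrM !mulrA.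
apply: ler_sum => j _; rewrite mxE.
apply: le_trans (ler_norm_sum _ _ _) _.
apply: le_trans (_ : \sum_(i < p) (`|A| * enorm w) <= _); last first.
  by rewrite sumr_const card_ord -[leLHS]mulr_natl !mulrA.
apply: ler_sum => i _; rewrite normrM mulrC ler_pM // ?enorm_coord //.
rewrite [leRHS]/Num.norm /= mx_normrE.
by apply/bigmax_geP; right; exists (i, j).
Qed.

Lemma opcont_continuous {n p m} (F : 'rV[R]_n -> 'M[R]_(p, m)) x :
  {for x, continuous F} -> opcont F x.
Proof.
move=> Fx e e0; have k0 : 0 < (m * p)%:R + 1 :> R by rewrite ltr_wpDl.
have e'0 : 0 < e / ((m * p)%:R + 1) by rewrite divr_gt0.
have /Fx/nbhs_enorm[d d0 hd] := nbhsx_ballx (F x) _ e'0.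
exists d => // y /hd; rewrite /= -ball_normE /= distrC ltr_pdivlMr // => h w.
apply: le_trans (enorm_mulmx_norm _ _) _; rewrite ler_wpM2r //.
by apply: le_trans (ltW h); rewrite mulrC ler_wpM2l // lerDl.
Qed.

Lemma opcont_bound {n p m} (F : 'rV[R]_n -> 'M[R]_(p, m)) x : opcont F x ->
  exists K d : R, [/\ 0 <= K, 0 < d & forall y, enorm (y - x) < d ->
    forall w, enorm (w *m F y) <= K * enorm w].
Proof.
move=> Fx; have [K K0 hK] := enorm_mulmx (F x).
have [d d0 hd] := Fx 1 ltr01; exists (1 + K), d; split=> //.
  by rewrite addr_ge0.
move=> y /hd h w; rewrite -[F y](subrK (F x)) mulmxDr.
by apply: le_trans (enormD _ _) _; rewrite mulrDl lerD.
Qed.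

(** The mean value theorem is applied to each coordinate, with its own intermediate point; at all of
    them the Jacobian is within [e / (m + 1)] of that at [xb]. *)
Lemma strict_diff {n m} (F : 'rV[R]_n -> 'rV[R]_m) xb :
  (forall x, differentiable F x) -> opcont (fun x => 'J F x) xb ->
  forall e : R, 0 < e -> exists2 r : R, 0 < r & forall x u,
    enorm (x - xb) < r -> enorm (u - xb) < r ->
    enorm (F x - F u - (x - u) *m 'J F xb) <= e * enorm (x - u).
Proof.
move=> dF JF e e0; have m1 : 0 < m%:R + 1 :> R by rewrite ltr_wpDl.
have [r r0 hr] := JF (e / (m%:R + 1)) (divr_gt0 e0 m1).
exists r => // x u xr ur; apply: le_trans (enorm_le_sum _) _.
apply: le_trans (_ : \sum_(j < m) (e / (m%:R + 1) * enorm (x - u)) <= _).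
  apply: ler_sum => j _.
  have dFj z : differentiable (fun z => F z 0 j) z.
    exact: (differentiable_comp (dF z) (differentiable_coord _ _ _)).
  have [t /andP[t0 t1]] := mean_value_line _ u (x - u) dFj.
  rewrite [u + _]addrC subrK derive_coord // => E.
  have -> : (F x - F u - (x - u) *m 'J F xb) 0 j =
      ((x - u) *m ('J F (u + t *: (x - u)) - 'J F xb)) 0 j.
    by rewrite mulmxBr !mxE E !mxE.
  apply: le_trans (enorm_coord _ _) _; apply: hr.
  by apply: enorm_segment_lt => //; rewrite t0 t1.
rewrite sumr_const card_ord -[leLHS]mulr_natl.
rewrite mulrA ler_wpM2r // mulrCA ler_piMr ?(ltW e0) //.
by rewrite ler_pdivrMr // mul1r lerDl.
Qed.

Lemma gradient_lipschitz {n} (f : 'rV[R]_n -> R) xb : C2_scalar f ->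
  exists L r : R, [/\ 0 <= L, 0 < r,
    (forall x u, enorm (x - xb) < r -> enorm (u - xb) < r ->
      enorm (gradient f x - gradient f u) <= L * enorm (x - u))
    & forall x u, enorm (x - xb) < r -> enorm (u - xb) < r ->
      `|f x - f u - dotv (gradient f u) (x - u)| <= L * dotv (x - u) (x - u)].
Proof.
move=> [df dgf hc].
have [r r0 hr] := strict_diff (gradient f) xb dgf (opcont_continuous _ _ (hc xb)) 1 ltr01.
have [K K0 hK] := enorm_mulmx (hessian f xb).
have L0 : 0 <= 1 + K by rewrite addr_ge0.
have lip x u : enorm (x - xb) < r -> enorm (u - xb) < r ->
    enorm (gradient f x - gradient f u) <= (1 + K) * enorm (x - u).
  move=> xr ur; rewrite -[gradient f x - gradient f u](subrK ((x - u) *m hessian f xb)).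
  apply: le_trans (enormD _ _) _; rewrite mulrDl.
  by apply: lerD; [exact: hr|exact: hK].
exists (1 + K), r; split=> // x u xr ur.
have [t /andP[t0 t1]] := mean_value_line f u (x - u) df.
rewrite [u + (x - u)]addrC subrK derive_gradient // => ->; rewrite -dotvBl.
apply: le_trans (normr_dotv_le _ _) _; rewrite -enorm_sq expr2 mulrA ler_wpM2r //.
have zr : enorm (u + t *: (x - u) - xb) < r.
  by apply: enorm_segment_lt => //; rewrite t0 t1.
apply: le_trans (lip _ _ zr ur) _; rewrite ler_wpM2l //.
rewrite [u + _]addrC addrK enormZ ger0_norm //.
by rewrite ler_piMl.
Qed.

End Calculus.

Section C2Scalar.
Context {R : realType} {n : nat}.
Implicit Types (f h : 'rV[R]_n -> R).

Lemma coordB {p} (a b : 'rV[R]_p) j : (a - b) 0 j = a 0 j - b 0 j.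
Proof. by rewrite !mxE. Qed.

Lemma jacobian_ext {p q} (A B : 'M[R]_(p, q)) :
  (forall v : 'rV[R]_p, v *m A = v *m B) -> A = B.
Proof. by move=> h; apply/row_matrixP => i; rewrite !rowE h. Qed.

Lemma gradientD f h x : differentiable f x -> differentiable h x ->
  gradient (f \+ h) x = gradient f x + gradient h x.
Proof.
move=> df dh; apply/rowP => i; rewrite !mxE deriveD //; exact: diff_derivable.
Qed.

Lemma gradientZ k f x : differentiable f x ->
  gradient (k \*: f) x = k *: gradient f x.
Proof.
move=> df; apply/rowP => i; rewrite !mxE deriveZ //; exact: diff_derivable.
Qed.

Lemma C2_scalarD f h : C2_scalar f -> C2_scalar h ->
  C2_scalar (f \+ h) /\ forall x, hessian (f \+ h) x = hessian f x + hessian h x.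
Proof.
move=> [df dgf cf] [dh dgh ch].
have gE : gradient (f \+ h) = gradient f \+ gradient h.
  by apply/funext => x; exact: gradientD.
have hE x : hessian (f \+ h) x = hessian f x + hessian h x.
  rewrite /hessian gE; apply: jacobian_ext => v; rewrite mulmxDr.
  have E := deriveEjacobian v (differentiableD (dgf x) (dgh x)).
  apply: etrans (esym E) _.
  have E2 := deriveD (diff_derivable (v := v) (dgf x)) (diff_derivable (v := v) (dgh x)).
  apply: etrans E2 _.
  by congr (_ + _); exact: deriveEjacobian.
split; last exact: hE.
split.
- by move=> x; exact: differentiableD.
- by move=> x; rewrite gE; exact: differentiableD.
- have -> : hessian (f \+ h) = hessian f \+ hessian h by apply/funext => x; exact: hE.
  by move=> x; apply: continuousD; [exact: cf|exact: ch].
Qed.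

Lemma C2_scalarZ k f : C2_scalar f ->
  C2_scalar (k \*: f) /\ forall x, hessian (k \*: f) x = k *: hessian f x.
Proof.
move=> [df dgf cf].
have gE : gradient (k \*: f) = k \*: gradient f.
  by apply/funext => x; exact: gradientZ.
have hE x : hessian (k \*: f) x = k *: hessian f x.
  rewrite /hessian gE; apply: jacobian_ext => v; rewrite -scalemxAr.
  have E := deriveEjacobian v (differentiableZ k (dgf x)).
  apply: etrans (esym E) _.
  have E2 := deriveZ k (diff_derivable (v := v) (dgf x)).
  apply: etrans E2 _.
  by congr (_ *: _); exact: deriveEjacobian.
split; last exact: hE.
split.
- by move=> x; exact: differentiableZ.
- by move=> x; rewrite gE; exact: differentiableZ.
- have -> : hessian (k \*: f) = k \*: hessian f by apply/funext => x; exact: hE.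
  by move=> x; apply: continuousZl_tmp; exact: cf.
Qed.

Lemma C2_scalar0 : C2_scalar (fun _ : 'rV[R]_n => 0 : R) /\
  forall x, hessian (fun _ : 'rV[R]_n => 0 : R) x = 0.
Proof.
have gE : gradient (fun _ : 'rV[R]_n => 0 : R) = (fun=> 0).
  by apply/funext => x; apply/rowP => i; rewrite !mxE derive_cst.
have hE x : hessian (fun _ : 'rV[R]_n => 0 : R) x = 0.
  rewrite /hessian gE; apply/row_matrixP => i; rewrite !rowE mulmx0.
  by rewrite -deriveEjacobian ?derive_cst //; exact: differentiable_cst.
split; last exact: hE.
split.
- by move=> x; exact: differentiable_cst.
- by move=> x; rewrite gE; exact: differentiable_cst.
- have -> : hessian (fun _ : 'rV[R]_n => 0 : R) = (fun=> 0) by apply/funext => x; exact: hE.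
  by move=> x; exact: cst_continuous.
Qed.

End C2Scalar.

Section SmoothMap.
Context {R : realType} {n m : nat}.
Variables (g : 'rV[R]_n -> 'rV[R]_m).
Hypothesis C2g : C2 g.

Lemma C2_differentiable x : differentiable g x.
Proof. by apply: differentiable_coordinates => j; case: (C2g j). Qed.

Lemma dotv_map_sum y : (fun x => dotv y (g x)) =
  \sum_(j < m) (y 0 j \*: (fun x => g x 0 j)).
Proof. by apply/funext => x; rewrite fct_sumE. Qed.

Lemma C2_dotv y : C2_scalar (fun x => dotv y (g x)) /\
  forall x, hessian (fun x => dotv y (g x)) x =
    \sum_(j < m) y 0 j *: hessian (fun x => g x 0 j) x.
Proof.
rewrite dotv_map_sum.
have : C2_scalar (\sum_(j < m) (y 0 j \*: (fun x => g x 0 j))) /\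
    hessian (\sum_(j < m) (y 0 j \*: (fun x => g x 0 j))) =
    \sum_(j < m) (fun x => y 0 j *: hessian (fun x => g x 0 j) x).
  elim/big_rec2: _ => [|j H F _ [CF HE]].
    have [c0 h0] := @C2_scalar0 R n; split=> //.
    by apply/funext => x; rewrite h0.
  have [c1 h1] := C2_scalarZ (y 0 j) _ (C2g j).
  have [c2 h2] := C2_scalarD _ _ c1 CF; split=> //.
  by apply/funext => x; rewrite h2 h1 HE.
by move=> [c h]; split=> // x; rewrite h fct_sumE.
Qed.

Lemma gradient_dotv y x :
  gradient (fun x => dotv y (g x)) x = y *m ('J g x)^T.
Proof.
have dg := C2_differentiable x; have [[dy _ _] _] := C2_dotv y.
apply: dotv_ext => w; rewrite dotv_mulmxl trmxK -derive_gradient //.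
rewrite dotv_map_sum derive_sum => [|j]; last first.
  by apply: diff_derivable; apply: differentiableZ; case: (C2g j).
apply: eq_bigr => j _; rewrite deriveZ; last first.
  by apply: diff_derivable; case: (C2g j).
by rewrite derive_coord.
Qed.

Lemma opcont_jacobian x : opcont (fun x => 'J g x) x.
Proof.
move=> e e0; have m1 : 0 < m%:R + 1 :> R by rewrite ltr_wpDl.
have /choice[d hd] : forall j : 'I_m, exists d : R, 0 < d /\
    forall y, enorm (y - x) < d ->
      enorm (gradient (fun z => g z 0 j) y - gradient (fun z => g z 0 j) x) <=
        e / (m%:R + 1).
  move=> j; have [_ dgj _] := C2g j.
  have /continuous_enorm/(_ _ (divr_gt0 e0 m1))[d d0 hd] :=
    differentiable_continuous (dgj x).
  by exists d; split=> // y /hd/ltW.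
have [r r0 hr] := positive_lower_bound d (fun j => (hd j).1).
exists r => // y yr w; apply: le_trans (enorm_le_sum _) _.
apply: le_trans (_ : \sum_(j < m) (e / (m%:R + 1) * enorm w) <= _).
  apply: ler_sum => j _.
  have -> : (w *m ('J g y - 'J g x)) 0 j =
      dotv (gradient (fun z => g z 0 j) y - gradient (fun z => g z 0 j) x) w.
    have E1 := jacobian_gradient g y w j (C2_differentiable y).
    have E2 := jacobian_gradient g x w j (C2_differentiable x).
    by rewrite mulmxBr coordB dotvBl; congr (_ - _).
  apply: le_trans (normr_dotv_le _ _) _; rewrite ler_wpM2r //.
  by apply: (hd j).2; apply: lt_le_trans yr (hr j).
rewrite sumr_const card_ord -[leLHS]mulr_natl.
rewrite mulrA ler_wpM2r // mulrCA ler_piMr ?(ltW e0) //.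
by rewrite ler_pdivrMr // mul1r lerDl.
Qed.

Lemma map_taylor xb : exists L r : R, [/\ 0 <= L, 0 < r &
  forall x u, enorm (x - xb) < r -> enorm (u - xb) < r ->
    enorm (g x - g u - (x - u) *m 'J g u) <= L * dotv (x - u) (x - u)].
Proof.
have /choice[p hp] : forall j : 'I_m, exists p : R * R, [/\ 0 <= p.1, 0 < p.2 &
  forall x u, enorm (x - xb) < p.2 -> enorm (u - xb) < p.2 ->
    `|g x 0 j - g u 0 j - dotv (gradient (fun z => g z 0 j) u) (x - u)| <=
    p.1 * dotv (x - u) (x - u)].
  move=> j; have [L [r [L0 r0 _ h]]] := gradient_lipschitz _ xb (C2g j).
  by exists (L, r).
have p20 j : 0 < (p j).2 by case: (hp j).
have [r r0 hr] := positive_lower_bound (fun j => (p j).2) p20.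
exists (\sum_j (p j).1), r; split=> //.
  by apply: sumr_ge0 => j _; case: (hp j).
move=> x u xr ur; apply: le_trans (enorm_le_sum _) _.
rewrite mulr_suml ler_sum // => j _; have [_ _ h] := hp j.
have E := jacobian_gradient g u (x - u) j (C2_differentiable u).
have := h x u (lt_le_trans xr (hr j)) (lt_le_trans ur (hr j)).
by rewrite -E !coordB.
Qed.

Lemma continuous_map x : {for x, continuous g}.
Proof. exact/differentiable_continuous/C2_differentiable. Qed.

(** The Hessian is linear in the multiplier: splitting off [y' - y] leaves locally bounded
    coordinate Hessians, plus continuity at the fixed [y]. *)
Lemma hessian_dotv_continuous x y (e : R) : 0 < e -> exists2 d : R, 0 < d &
  forall x' y', enorm (x' - x) < d -> enorm (y' - y) < d -> forall w,
    enorm (w *m (hessian (fun z => dotv y' (g z)) x' -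
                 hessian (fun z => dotv y (g z)) x)) <= e * enorm w.
Proof.
move=> e0; have e20 : 0 < e / 2 by rewrite divr_gt0.
have [[_ _ hc] _] := C2_dotv y.
have [d1 d10 h1] := opcont_continuous _ _ (hc x) _ e20.
have /choice[p hp] : forall j : 'I_m, exists p : R * R, [/\ 0 <= p.1, 0 < p.2 &
    forall x', enorm (x' - x) < p.2 -> forall w,
      enorm (w *m hessian (fun z => g z 0 j) x') <= p.1 * enorm w].
  move=> j; have [_ _ cj] := C2g j.
  have [K [d [K0 d0 h]]] := opcont_bound _ _ (opcont_continuous _ _ (cj x)).
  by exists (K, d).
have p20 j : 0 < (p j).2 by case: (hp j).
have [r r0 hr] := positive_lower_bound (fun j => (p j).2) p20.
pose S := \sum_j (p j).1; have S0 : 0 <= S by apply: sumr_ge0 => j _; case: (hp j).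
have S1 : 0 < S + 1 by rewrite ltr_wpDl.
exists (Num.min (Num.min d1 r) (e / 2 / (S + 1))) => [|x' y'].
  by rewrite !lt_min d10 r0 divr_gt0.
rewrite !lt_min => /andP[/andP[xd1 xr] _] /andP[_ yd] w.
have E : hessian (fun z => dotv y' (g z)) x' - hessian (fun z => dotv y (g z)) x
  = \sum_j (y' - y) 0 j *: hessian (fun z => g z 0 j) x' +
    (hessian (fun z => dotv y (g z)) x' - hessian (fun z => dotv y (g z)) x).
  rewrite addrA; congr (_ - _).
  rewrite (C2_dotv y').2 (C2_dotv y).2 -big_split; apply: eq_bigr => j _ /=.
  by rewrite -scalerDl mxE mxE subrK.
rewrite E mulmxDr; apply: le_trans (enormD _ _) _.
rewrite [e in leRHS]splitr mulrDl lerD //; last exact: h1.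
have enorm_sum (F : 'I_m -> 'rV[R]_n) : enorm (\sum_j F j) <= \sum_j enorm (F j).
  elim/big_rec2: _ => [|j a b _ h]; first by rewrite enorm0.
  by apply: le_trans (enormD _ _) _; rewrite lerD2l.
rewrite mulmx_sumr; apply: le_trans (enorm_sum _) _.
apply: le_trans (_ : \sum_j (enorm (y' - y) * ((p j).1 * enorm w)) <= _).
  apply: ler_sum => j _; rewrite -scalemxAr enormZ ler_pM ?enorm_coord //.
  by have [_ _ ->//] := hp j; apply: lt_le_trans xr (hr j).
rewrite -mulr_sumr -mulr_suml -/S mulrA ler_wpM2r //.
rewrite ltr_pdivlMr // in yd; apply: le_trans (ltW yd).
by rewrite ler_wpM2l // lerDl.
Qed.

Section Submersion.
Variable xb : 'rV[R]_n.
Hypothesis rank_g : \rank ('J g xb) = m.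

(** If [L] inverts the Jacobian at [xb], then [L *m 'J g x] differs from the identity by at most
    [1/2] in operator norm, so its inverse has norm at most [2]; this gives one bound for all [x]
    near [xb]. *)
Lemma jacobian_right_inverse : exists K r : R, [/\ 0 < K, 0 < r &
  forall x, enorm (x - xb) < r -> exists B : 'M[R]_(m, n),
    B *m 'J g x = 1%:M /\ forall e, enorm (e *m B) <= K * enorm e].
Proof.
have [L LJ] : exists L, L *m 'J g xb = 1%:M.
  by exists (pinvmx ('J g xb)); apply: mulVpmx; rewrite /row_full rank_g.
have [K K0 hK] := enorm_mulmx L.
have K1 : 0 < K + 1 by rewrite ltr_wpDl.
have e0 : 0 < 2^-1 / (K + 1) by rewrite divr_gt0 // invr_gt0.
have [r r0 hr] := opcont_jacobian xb _ e0.
exists (2 * (K + 1)), r; split=> // [|x xr]; first by rewrite mulr_gt0.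
have half e : enorm e <= 2 * enorm (e *m (L *m 'J g x)).
  have E : e *m (L *m 'J g x) = e + e *m L *m ('J g x - 'J g xb).
    move: LJ; move: ('J g x) ('J g xb) => A B LB.
    by rewrite mulmxBr -!mulmxA LB mulmx1 addrC subrK.
  have h1 : enorm (e *m L *m ('J g x - 'J g xb)) <= enorm e / 2.
    apply: le_trans (hr x xr _) _.
    apply: le_trans (_ : 2^-1 / (K + 1) * ((K + 1) * enorm e) <= _).
      rewrite ler_wpM2l ?(ltW e0) //; apply: le_trans (hK e) _.
      by rewrite ler_wpM2r // lerDl.
    by rewrite mulrA divfK ?gt_eqF // mulrC.
  move: h1 E; move: (e *m L *m _) (e *m (L *m _)) => a b h1 E.
  by have := enormB b a; rewrite {1}E addrK; lra.
have Mu : L *m 'J g x \in unitmx.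
  rewrite -row_free_unit; apply/inj_row_free => v v0; apply/eqP.
  by rewrite -enorm_eq0 eq_le enorm_ge0 andbT (le_trans (half v)) // v0 enorm0 mulr0.
exists (invmx (L *m 'J g x) *m L); split; first by rewrite -mulmxA mulVmx.
move=> e; rewrite mulmxA; apply: le_trans (hK _) _.
have := half (e *m invmx (L *m 'J g x)); rewrite -mulmxA mulVmx // mulmx1 => h.
rewrite (mulrC 2) -mulrA; apply: ler_pM => //; rewrite lerDl //.
Qed.

(* Lyusternik-Graves: the solution is a minimiser of
   [|g x - z| + c |x - u|] over a small ball. *)
Lemma metric_regularity : exists k r : R, [/\ 0 < k, 0 < r &
  forall u z, enorm (u - xb) < r -> enorm (z - g u) < r ->
    exists2 x, g x = z & enorm (x - u) <= k * enorm (z - g u)].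
Proof.
have [L LJ] : exists L, L *m 'J g xb = 1%:M.
  by exists (pinvmx ('J g xb)); apply: mulVpmx; rewrite /row_full rank_g.
have [K1 K10 hK1] := enorm_mulmx L.
pose K := K1 + 1; have K0 : 0 < K by rewrite ltr_wpDl.
have hK e : enorm (e *m L) <= K * enorm e.
  by apply: le_trans (hK1 e) _; rewrite ler_wpM2r // lerDl.
clearbody K.
have e0 : 0 < 2^-1 / K by rewrite divr_gt0 // invr_gt0.
have [r r0 hr] := strict_diff g xb C2_differentiable (opcont_jacobian xb) _ e0.
pose c := (4 * K)^-1; have c0 : 0 < c by rewrite invr_gt0 mulr_gt0.
pose r1 := Num.min (r / 8) (c * (r / 8)).
have r10 : 0 < r1 by rewrite lt_min !mulr_gt0 // divr_gt0.
have r1a : r1 <= r / 8 by rewrite ge_min lexx.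
have r1b : r1 <= c * (r / 8) by rewrite ge_min lexx orbT.
clearbody r1.
exists (4 * K), r1; split=> // [|u z ur zr]; first by rewrite mulr_gt0.
pose h x := enorm (g x - z) + c * enorm (x - u).
have hc : continuous h.
  have c1 : continuous (fun x => g x - z).
    by move=> x; apply: (@continuous_comp _ _ _ g (fun y => y - z));
      [exact: continuous_map|exact: continuous_subl].
  have c2 : continuous (fun x => enorm (g x - z)).
    by move=> x; apply: (continuous_comp (c1 x)); exact: enorm_continuous.
  have c3 : continuous (fun x : 'rV[R]_n => enorm (x - u)).
    by move=> x; apply: (continuous_comp (continuous_subl u x)); exact: enorm_continuous.
  move=> x; apply: (@cvgD _ _ _ (nbhs x)); first exact: c2.
  by apply: (@cvgM _ _ (nbhs x)); [exact: cvg_cst|exact: c3].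
have uK : enorm (u - xb) <= r / 2 by lra.
have [||x xK xmin] := @EVT_min_rV _ _ h _ _ (compact_eball xb (r / 2)).
- by exists u.
- exact: continuous_subspaceT.
rewrite inE /eball /= in xK.
have {}xmin y : enorm (y - xb) <= r / 2 -> h x <= h y.
  by move=> yK; apply: xmin; rewrite inE.
have := xmin u uK; rewrite /h subrr enorm0 mulr0 addr0 => h0.
have cx : c * enorm (x - u) <= enorm (z - g u).
  by rewrite (enormBC z); apply: le_trans h0; rewrite lerDr.
have xu : enorm (x - u) <= 4 * K * enorm (z - g u).
  by rewrite -ler_pdivrMl ?mulr_gt0.
exists x => //; apply/eqP; rewrite -subr_eq0; apply: contraT => E0.
have [E EE] : exists E, E = g x - z by eexists.
rewrite -EE in E0; have {}E0 : 0 < enorm E by rewrite enorm_gt0.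
have xu8 : enorm (x - u) <= r / 8.
  by rewrite -(ler_pM2l c0); apply: le_trans cx _; apply: le_trans r1b; exact: ltW.
have xr4 : enorm (x - xb) <= r / 4.
  by apply: le_trans (enorm_triangle u _ _) _; lra.
(* With a nonzero residual [E], a step [t D] along this Newton direction lowers [|g x - z|] by at
   least [t |E| / 2] and raises [c |x - u|] by at most [c t K |E| = t |E| / 4], against
   minimality. *)
pose D := - (E *m L).
have DK : enorm D <= K * enorm E by rewrite enormN.
have KE0 : 0 < K * enorm E by rewrite mulr_gt0.
pose t := Num.min 1 (r / 8 / (K * enorm E)).
have t0 : 0 < t by rewrite lt_min ltr01 !divr_gt0.
have t1 : t <= 1 by rewrite ge_min lexx.
have tr : t * (K * enorm E) <= r / 8 by rewrite -ler_pdivlMr // ge_min lexx orbT.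
clearbody t.
have tD : enorm (t *: D) <= t * (K * enorm E).
  by rewrite enormZ gtr0_norm // ler_pM2l.
have yr : enorm (x + t *: D - xb) <= r / 2.
  by rewrite addrAC; apply: le_trans (enormD _ _) _; lra.
have xlt : enorm (x - xb) < r by lra.
have ylt : enorm (x + t *: D - xb) < r by lra.
have := hr _ _ ylt xlt; rewrite [x + _]addrC addrK => h1.
have h2 : 2^-1 / K * enorm (t *: D) <= t * enorm E / 2.
  apply: le_trans (_ : 2^-1 / K * (t * (K * enorm E)) <= _).
    by rewrite ler_wpM2l // ltW.
  by le_of_eq; field; rewrite gt_eqF.
have gE : g (t *: D + x) - z =
    (1 - t) *: E + (g (t *: D + x) - g x - (t *: D) *m 'J g xb).
  have -> : t *: D *m 'J g xb = - (t *: E).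
    by rewrite -scalemxAl mulNmx -mulmxA LJ mulmx1 scalerN.
  rewrite EE; move: (g _) (g x) => a b.
  by row_ring.
have h3 : enorm (g (t *: D + x) - z) <= (1 - t) * enorm E + t * enorm E / 2.
  rewrite gE; apply: le_trans (enormD _ _) _; rewrite enormZ ger0_norm ?subr_ge0 //.
  by rewrite lerD2l; apply: le_trans h1 h2.
have h4 : enorm (t *: D + x - u) <= enorm (x - u) + t * (K * enorm E).
  by rewrite -addrA addrC; apply: le_trans (enormD _ _) _; rewrite lerD2l.
have := xmin _ yr; rewrite /h -EE (addrC x (t *: D)) => h5.
have h6 : c * enorm (t *: D + x - u) <= c * enorm (x - u) + t * enorm E / 4.
  apply: le_trans (_ : c * (enorm (x - u) + t * (K * enorm E)) <= _).
    by rewrite ler_pM2l.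
  rewrite mulrDr lerD2l /c; le_of_eq; field.
  by rewrite gt_eqF.
have : 0 < t * enorm E by rewrite mulr_gt0.
by lra.
Qed.

End Submersion.
End SmoothMap.

Section Auxiliary.
Context {R : realType}.

Lemma trmx_sub {p q} (A B : 'M[R]_(p, q)) : (A - B)^T = A^T - B^T.
Proof. by apply/matrixP => i j; rewrite !mxE. Qed.

Lemma lt_half (a b d : R) : a <= b -> b <= d / 2 -> 0 < d -> a < d.
Proof. by lra. Qed.

Lemma half_lt (d : R) : 0 < d -> d / 2 < d.
Proof. by lra. Qed.

Lemma enorm_near {p} (y z : 'rV[R]_p) (k : R) : enorm (y - z) <= k ->
  enorm y <= enorm z + k.
Proof. by have := enormD (y - z) z; rewrite subrK; lra. Qed.

End Auxiliary.

(** * Subgradients and normals of the composite function *)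

Section Composite.
Context {R : realType} {n m : nat}.
Variables (phi0 : 'rV[R]_n -> R) (g : 'rV[R]_n -> 'rV[R]_m)
  (psi : 'rV[R]_m -> \bar R) (xb : 'rV[R]_n).
Hypotheses (C2phi0 : C2_scalar phi0) (C2g : C2 g)
  (psiN : forall z, (-oo < psi z)%E) (psi_lsc : lower_semicontinuous psi)
  (rank_g : \rank ('J g xb) = m).
Local Notation phi := (composite phi0 g psi).
Local Notation V x y := (gradient phi0 x + y *m ('J g x)^T).

Lemma composite_gtNy x : (-oo < phi x)%E.
Proof.
rewrite /composite; case: (psi (g x)) (psiN (g x)) => [a||] // _.
by rewrite -EFinD ltNyr.
Qed.

Lemma composite_lty x : (phi x < +oo)%E -> (psi (g x) < +oo)%E.
Proof.
by rewrite /composite; case: (psi (g x)) => [a||] //; rewrite ?ltry.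
Qed.

Lemma composite_fin x : (psi (g x) < +oo)%E ->
  phi x = (phi0 x + fine (psi (g x)))%:E.
Proof. by move=> h; rewrite /composite (efin_num _ _ psiN h). Qed.

Lemma lty_composite x : (psi (g x) < +oo)%E -> (phi x < +oo)%E.
Proof. by move=> /composite_fin->; rewrite ltry. Qed.

Lemma continuous_phi0 x : {for x, continuous phi0}.
Proof. by apply: differentiable_continuous; case: C2phi0. Qed.

Lemma composite_lsc : lower_semicontinuous phi.
Proof.
have -> : phi = (fun x => psi (g x) + (phi0 x)%:E)%E.
  by apply/funext => x; rewrite addeC.
apply: lscD; last exact: continuous_phi0.
by apply: lsc_comp => // x; exact: continuous_map.
Qed.

Lemma phi0_expansion x (e : R) : 0 < e -> exists2 d : R, 0 < d &
  forall x', enorm (x' - x) < d ->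
    `|phi0 x' - phi0 x - dotv (gradient phi0 x) (x' - x)| <= e * enorm (x' - x).
Proof.
move=> e0; have [L [r [L0 r0 _ h]]] := gradient_lipschitz _ x C2phi0.
have L1 : 0 < L + 1 by rewrite ltr_wpDl.
exists (Num.min r (e / (L + 1))) => [|x']; first by rewrite lt_min r0 divr_gt0.
rewrite lt_min => /andP[x'r x'e].
apply: le_trans (h x' x x'r _) _; first by rewrite subrr enorm0.
rewrite -enorm_sq expr2 mulrA ler_wpM2r //.
rewrite ltr_pdivlMr // in x'e; apply: le_trans (ltW x'e).
by rewrite mulrC ler_wpM2l // lerDl.
Qed.

Lemma g_expansion x (e : R) : 0 < e -> exists2 d : R, 0 < d &
  forall x', enorm (x' - x) < d ->
    enorm (g x' - g x - (x' - x) *m 'J g x) <= e * enorm (x' - x).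
Proof. by move=> e0; exact: (diff_expansion g x (C2_differentiable g C2g x)). Qed.

(** Bundles the two consequences of full rank, bounded one-sided inverses and lifting of nearby
    values, under one constant and one radius. *)
Definition submersive (K r : R) : Prop :=
  forall x, enorm (x - xb) < r ->
    (exists B : 'M[R]_(m, n), B *m 'J g x = 1%:M /\
       forall e, enorm (e *m B) <= K * enorm e) /\
    (forall z, enorm (z - g x) < r ->
       exists2 x', g x' = z & enorm (x' - x) <= K * enorm (z - g x)).

Lemma submersive_near : exists K r : R, [/\ 0 < K, 0 < r & submersive K r].
Proof.
have [K1 [r1 [K10 r10 h1]]] := jacobian_right_inverse g C2g xb rank_g.
have [K2 [r2 [K20 r20 h2]]] := metric_regularity g C2g xb rank_g.
exists (Num.max K1 K2), (Num.min r1 r2); split; rewrite ?lt_max ?K10 ?lt_min ?r10 //.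
move=> x; rewrite lt_min => /andP[xr1 xr2]; split.
  have [B [BJ hB]] := h1 x xr1; exists B; split=> // e.
  by apply: le_trans (hB e) _; rewrite ler_wpM2r // le_max lexx.
move=> z; rewrite lt_min => /andP[_ zr2]; have [x' gx' h] := h2 x z xr2 zr2.
by exists x' => //; apply: le_trans h _; rewrite ler_wpM2r // le_max lexx orbT.
Qed.

Section Submersive.
Variables (K r : R).
Hypotheses (K0 : 0 < K) (r0 : 0 < r) (sub : submersive K r).

Lemma mulmx_trK x (B : 'M[R]_(m, n)) (y : 'rV[R]_m) :
  B *m 'J g x = 1%:M -> y *m ('J g x)^T *m B^T = y.
Proof.
move: ('J g x) => J BJ; by rewrite -mulmxA -trmx_mul BJ trmx1 mulmx1.
Qed.

Lemma jacobianT_inj x (y y' : 'rV[R]_m) : enorm (x - xb) < r ->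
  y *m ('J g x)^T = y' *m ('J g x)^T -> y = y'.
Proof.
move=> /sub[[B [BJ _]] _] h.
by rewrite -(mulmx_trK x B y BJ) h (mulmx_trK x B y' BJ).
Qed.

(** For [d] in the kernel of the Jacobian, metric regularity corrects [x + t d] to a point of the
    fibre [g = g x] at distance [o(t)], so [<p, d> <= 0]; both signs give orthogonality to the
    kernel, hence membership in the range of the adjoint. *)
Lemma range_of_kernel x (p : 'rV[R]_n) : enorm (x - xb) < r ->
  (forall e : R, 0 < e -> exists2 d : R, 0 < d & forall x', g x' = g x ->
     enorm (x' - x) < d -> dotv p (x' - x) <= e * enorm (x' - x)) ->
  exists y : 'rV[R]_m, p = y *m ('J g x)^T.
Proof.
move=> xr hp; have [[B [BJ hB]] reg] := sub x xr.
have kerle (d : 'rV[R]_n) : d *m 'J g x = 0 -> dotv p d <= 0.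
  move=> dJ; have [->|d0] := eqVneq d 0; first by rewrite dotv0.
  have {}d0 : 0 < enorm d by rewrite enorm_gt0.
  apply/ler_addgt0Pr => e e0; rewrite add0r.
  pose C := enorm p + enorm d + 1.
  have C1 : 1 <= C by rewrite lerDr addr_ge0.
  have C0 : 0 < C by apply: lt_le_trans C1.
  have pC : enorm p <= C by rewrite /C -addrA lerDl addr_ge0.
  have dC : enorm d <= C by rewrite /C -addrA addrCA lerDl addr_ge0.
  clearbody C.
  pose e1 := Num.min 1 (e / 3 / C).
  have e10 : 0 < e1 by rewrite lt_min ltr01 !divr_gt0.
  have e11 : e1 <= 1 by rewrite ge_min lexx.
  have e1C : e1 * C <= e / 3 by rewrite -ler_pdivlMr // ge_min lexx orbT.
  clearbody e1.
  have [d1 d10 h1] := hp e1 e10.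
  (* Chosen with [K e2 |d| = e1], so that the correction from [x + t d] to the fibre has length at
     most [e1 t]. *)
  pose e2 := e1 / (K * enorm d); have e20 : 0 < e2 by rewrite divr_gt0 // mulr_gt0.
  have [d2 d20 h2] := g_expansion x e2 e20.
  pose t := Num.min (Num.min ((r - enorm (x - xb)) / 2 / enorm d) (r / 2 / e2 / enorm d))
    (Num.min (d2 / 2 / enorm d) (d1 / 2 / (enorm d + 1))).
  have d1' : 0 < enorm d + 1 by rewrite addr_gt0.
  have rx0 : 0 < r - enorm (x - xb) by rewrite subr_gt0.
  have t0 : 0 < t by rewrite !lt_min !divr_gt0 ?mulr_gt0.
  have ta : t * enorm d <= (r - enorm (x - xb)) / 2.
    by rewrite -ler_pdivlMr // !ge_min lexx.
  have te : t * enorm d * e2 <= r / 2.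
    by rewrite -ler_pdivlMr // -ler_pdivlMr // !ge_min lexx orbT.
  have tb : t * enorm d <= d2 / 2 by rewrite -ler_pdivlMr // !ge_min lexx ?orbT.
  have tc : t * (enorm d + 1) <= d1 / 2 by rewrite -ler_pdivlMr // !ge_min lexx ?orbT.
  clearbody t.
  have td : enorm (t *: d) = t * enorm d by rewrite enormZ gtr0_norm.
  have [u uE] : exists u, u = x + t *: d by eexists.
  have ux : u - x = t *: d by rewrite uE addrC addKr.
  have h3 : enorm (g u - g x) <= e2 * (t * enorm d).
    have := h2 u; rewrite ux td -scalemxAl dJ scaler0 subr0; apply; lra.
  have ur : enorm (u - xb) < r.
    by apply: le_lt_trans (enorm_triangle x _ _) _; rewrite ux td; lra.
  have [_ regu] := sub u ur.
  have [|x' gx' x'u] := regu (g x).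
    rewrite enormBC; apply: le_lt_trans h3 _; rewrite mulrC.
    by apply: le_lt_trans te _; exact: half_lt.
  have x'u1 : enorm (x' - u) <= e1 * t.
    apply: le_trans x'u _; rewrite enormBC.
    apply: le_trans (_ : K * (e2 * (t * enorm d)) <= _); first by rewrite ler_pM2l.
    by rewrite /e2; le_of_eq; field; rewrite !gt_eqF.
  have e1t : e1 * t <= t by rewrite ler_piMl // ltW.
  have x'x : enorm (x' - x) <= t * enorm d + e1 * t.
    by apply: le_trans (enorm_triangle u _ _) _; rewrite ux td; lra.
  have := h1 x' gx'; have x'd1 : enorm (x' - x) < d1 by lra.
  move=> /(_ x'd1) h4.
  have h5 : dotv p (x' - x) = dotv p (x' - u) + t * dotv p d.
    by rewrite -dotvZr -ux -dotvDr subrKA.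
  have h6 := dotv_geN_enorm p (x' - u).
  have h7 : enorm p * enorm (x' - u) <= enorm p * (e1 * t) by rewrite ler_wpM2l.
  have h8 : e1 * enorm (x' - x) <= e1 * (t * enorm d + e1 * t).
    by rewrite ler_pM2l.
  have h9 : t * dotv p d <= t * (e1 * (enorm p + enorm d + e1)) by lra.
  rewrite ler_pM2l // in h9; apply: le_trans h9 _.
  have : e1 * (enorm p + enorm d + e1) <= e1 * (C + C + C).
    by rewrite ler_pM2l // !lerD //; apply: le_trans e11 C1.
  by lra.
have ker0 (d : 'rV[R]_n) : d *m 'J g x = 0 -> dotv p d = 0.
  move=> dJ; apply/eqP; rewrite eq_le kerle //=.
  by rewrite -oppr_le0 -dotvNr kerle // mulNmx dJ oppr0.
exists (p *m B^T); apply: dotv_ext => a.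
rewrite !dotv_mulmxl !trmxK -[a in LHS](subrK (a *m 'J g x *m B)) dotvDr ker0 ?add0r //.
by rewrite mulmxBl; move: BJ; move: ('J g x) => J BJ; rewrite -!mulmxA BJ mulmx1 subrr.
Qed.

(** The inverse at [x'], bounded by [K], recovers [y' - y] from its image under the adjoint at [x'];
    exchanging the Jacobians at [x'] and [x] costs little because it is applied to the fixed [y]. *)
Lemma multiplier_stable x (y : 'rV[R]_m) : enorm (x - xb) < r ->
  forall e : R, 0 < e -> exists2 d : R, 0 < d & forall x' y',
    enorm (x' - x) < d -> enorm (y' *m ('J g x')^T - y *m ('J g x)^T) < d ->
    enorm (y' - y) < e.
Proof.
move=> xr e e0.
pose C := K * (1 + enorm y); have C0 : 0 < C by rewrite mulr_gt0 // ltr_pwDl.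
pose e1 := Num.min (e / 2 / C) 1.
have e10 : 0 < e1 by rewrite lt_min ltr01 !divr_gt0.
have e1C : e1 * C <= e / 2 by rewrite -ler_pdivlMr // ge_min lexx.
clearbody e1.
have [d1 d10 h1] := opcont_jacobian g C2g x e1 e10.
exists (Num.min (Num.min d1 (r - enorm (x - xb))) e1) => [|x' y'].
  by rewrite !lt_min d10 subr_gt0 xr e10.
rewrite !lt_min => /andP[/andP[x'd1 x'r] _] /andP[_ pd].
have x'r' : enorm (x' - xb) < r.
  by apply: le_lt_trans (enorm_triangle x _ _) _; lra.
have [[B [BJ hB]] _] := sub x' x'r'.
have h2 : enorm ((y' - y) *m ('J g x')^T) <= e1 * (1 + enorm y).
  have h3 := enorm_trmx _ _ (ltW e10) (h1 x' x'd1) y.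
  move: h3 pd; move: ('J g x') ('J g x) => J' J h3 pd.
  have -> : (y' - y) *m J'^T = (y' *m J'^T - y *m J^T) - y *m (J' - J)^T.
    rewrite mulmxBl trmx_sub mulmxBr opprB addrA; congr (_ - _).
    by rewrite subrK.
  by apply: le_trans (enormB _ _) _; lra.
have := enorm_trmx B K (ltW K0) hB ((y' - y) *m ('J g x')^T).
rewrite mulmx_trK // => h4.
have : K * enorm ((y' - y) *m ('J g x')^T) <= K * (e1 * (1 + enorm y)).
  by rewrite ler_pM2l.
by move: e1C; rewrite /C; lra.
Qed.

Lemma multiplier_stable_sum x (y : 'rV[R]_m) : enorm (x - xb) < r ->
  forall e : R, 0 < e -> exists2 d : R, 0 < d & forall x' y',
    enorm (x' - x) < d -> enorm (V x' y' - V x y) < d -> enorm (y' - y) < e.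
Proof.
move=> xr e e0; have [d1 d10 h1] := multiplier_stable x y xr e e0.
have [_ dgp _] := C2phi0; have d1' : 0 < d1 / 2 by rewrite divr_gt0.
have /continuous_enorm/(_ _ d1')[d3 d30 h3] := differentiable_continuous (dgp x).
exists (Num.min (d1 / 2) d3) => [|x' y']; first by rewrite lt_min d1' d30.
rewrite !lt_min => /andP[xd1 xd3] /andP[vd _]; have {}h3 := h3 x' xd3.
apply: (h1 x'); first by apply: lt_trans xd1 _; exact: half_lt.
have -> : y' *m ('J g x')^T - y *m ('J g x)^T =
    (V x' y' - V x y) - (gradient phi0 x' - gradient phi0 x).
  by move: (y' *m _) (y *m _) => p q; row_ring.
apply: le_lt_trans (enormB _ _) _; move: vd; move: (enorm (V x' y' - _)) => c vd; lra.
Qed.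

(** The approximating multipliers are bounded by [K (|p| + 1)], so the Jacobian at [x'] may be
    replaced by that at [x]; there [p *m B^T *m ('J g x)^T] fixes the range, and hence its limit
    [p]. *)
Lemma adjoint_range_closed x (p : 'rV[R]_n) : enorm (x - xb) < r ->
  (forall e : R, 0 < e -> exists x' (y' : 'rV[R]_m),
     enorm (x' - x) < e /\ enorm (y' *m ('J g x')^T - p) < e) ->
  exists y : 'rV[R]_m, p = y *m ('J g x)^T.
Proof.
move=> xr h; have [[B [BJ hB]] _] := sub x xr.
have [C C0 hC] := enorm_mulmx ('J g x)^T.
exists (p *m B^T); apply/eqP; rewrite -subr_eq0 -enorm_eq0 eq_le enorm_ge0 andbT.
apply/ler_addgt0Pr => e e0; rewrite add0r.
pose N := K * (enorm p + 1); have N0 : 0 < N by rewrite mulr_gt0 // ltr_wpDl.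
have CK0 : 0 < 1 + C * K by rewrite ltr_pwDl // mulr_ge0 // ltW.
pose e1 := e / 2 / (1 + C * K); have e10 : 0 < e1 by rewrite !divr_gt0.
have e1E : (1 + C * K) * (e1 + e1) = e by rewrite /e1; field; rewrite gt_eqF.
clearbody e1.
have [d d0 hd] := opcont_jacobian g C2g x _ (divr_gt0 e10 N0).
have [|x' [y' []]] := h (Num.min (Num.min d 1) (Num.min e1 (r - enorm (x - xb)))).
  by rewrite !lt_min d0 ltr01 e10 subr_gt0.
rewrite !lt_min => /andP[/andP[xd _] /andP[_ xdr]] /andP[/andP[_ p1] /andP[pe _]].
have x'r : enorm (x' - xb) < r.
  by apply: le_lt_trans (enorm_triangle x _ _) _; rewrite addrC -ltrBrDl.
have [[B' [BJ' hB']] _] := sub x' x'r.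
have y'N : enorm y' <= N.
  have := enorm_trmx B' K (ltW K0) hB' (y' *m ('J g x')^T); rewrite mulmx_trK //.
  move=> /le_trans; apply; rewrite (ler_pM2l K0).
  exact/enorm_near/ltW.
have h3 : enorm (y' *m ('J g x' - 'J g x)^T) <= e1.
  apply: le_trans (enorm_trmx _ _ (ltW (divr_gt0 e10 N0)) (hd x' xd) y') _.
  by rewrite mulrAC ler_pdivrMr // ler_wpM2l // ltW.
have h4 : enorm (y' *m ('J g x)^T - p) <= e1 + e1.
  have -> : y' *m ('J g x)^T - p =
      (y' *m ('J g x')^T - p) - y' *m ('J g x' - 'J g x)^T.
    move: ('J g x') ('J g x) => J' J; rewrite trmx_sub mulmxBr.
    move: (y' *m J'^T) (y' *m J^T) => a b.
    by row_ring.
  by apply: le_trans (enormB _ _) _; apply: lerD => //; exact: ltW.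
have E : p - p *m B^T *m ('J g x)^T =
    (y' *m ('J g x)^T - p) *m B^T *m ('J g x)^T - (y' *m ('J g x)^T - p).
  rewrite mulmxBl (mulmx_trK x B y' BJ) mulmxBl.
  move: ('J g x) => J; move: (y' *m J^T) (p *m B^T *m J^T) => a b.
  by row_ring.
rewrite E; move: (y' *m ('J g x)^T - p) h4 => q h4.
apply: le_trans (enormB _ _) _; rewrite -e1E mulrDl mul1r addrC.
apply: lerD => //; apply: le_trans (hC _) _.
rewrite -mulrA; apply: ler_wpM2l => //.
apply: le_trans (enorm_trmx B K (ltW K0) hB q) _.
by rewrite (ler_pM2l K0).
Qed.

Lemma adjoint_continuous x (y : 'rV[R]_m) (e : R) : 0 < e -> exists2 d : R, 0 < d &
  forall x' y', enorm (x' - x) < d -> enorm (y' - y) < d ->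
    enorm (V x' y' - V x y) < e.
Proof.
move=> e0; have e30 : 0 < e / 4 by rewrite divr_gt0.
have [_ dgp _] := C2phi0.
have /continuous_enorm/(_ _ e30)[d1 d10 h1] := differentiable_continuous (dgp x).
have [C [d2 [C0 d20 h2]]] := opcont_bound _ _ (opcont_jacobian g C2g x).
have y1 : 0 < enorm y + 1 by rewrite ltr_wpDl.
have C1 : 0 < C + 1 by rewrite ltr_wpDl.
have [d3 d30 h3] := opcont_jacobian g C2g x _ (divr_gt0 e30 y1).
exists (Num.min (Num.min d1 d2) (Num.min d3 (e / 4 / (C + 1)))) => [|x' y'].
  by rewrite !lt_min d10 d20 d30 divr_gt0.
rewrite !lt_min => /andP[/andP[xd1 xd2] /andP[xd3 _]] /andP[_ /andP[_ yd]].
have {}h1 := h1 x' xd1.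
have {}h2 := enorm_trmx _ _ C0 (h2 x' xd2) (y' - y).
have {}h3 := enorm_trmx _ _ (ltW (divr_gt0 e30 y1)) (h3 x' xd3) y.
rewrite ltr_pdivlMr // in yd.
have h4 : e / 4 / (enorm y + 1) * enorm y <= e / 4.
  by rewrite -mulrA ler_piMr ?(ltW e30) // mulrC ler_pdivrMr // mul1r lerDl.
move: h2 h3; move: ('J g x') ('J g x) => J' J h2 h3.
have -> : gradient phi0 x' + y' *m J'^T - (gradient phi0 x + y *m J^T) =
    (gradient phi0 x' - gradient phi0 x) + ((y' - y) *m J'^T + y *m (J' - J)^T).
  rewrite opprD addrACA; congr (_ + _).
  by rewrite trmx_sub mulmxBl mulmxBr addrA subrK.
apply: le_lt_trans (enormD _ _) _.
have := enormD ((y' - y) *m J'^T) (y *m (J' - J)^T).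
have : C * enorm (y' - y) <= e / 4.
  by apply: le_trans (ltW yd); rewrite mulrC ler_wpM2l // lerDl.
by lra.
Qed.

Lemma map_lipschitz x : exists C d : R, [/\ 0 < C, 0 < d &
  forall x', enorm (x' - x) < d -> enorm (g x' - g x) <= C * enorm (x' - x)].
Proof.
have [d d0 hd] := g_expansion x 1 ltr01.
have [C C0 hC] := enorm_mulmx ('J g x).
exists (1 + C), d; split=> //; first by rewrite ltr_pwDl.
move=> x' /hd h; rewrite -[g x' - g x](subrK ((x' - x) *m 'J g x)).
by apply: le_trans (enormD _ _) _; rewrite mulrDl; apply: lerD.
Qed.

Lemma dotv_g_expansion x (y : 'rV[R]_m) (e : R) : 0 < e -> exists2 d : R, 0 < d &
  forall x', enorm (x' - x) < d ->
    `|dotv y (g x' - g x) - dotv (y *m ('J g x)^T) (x' - x)| <= e * enorm (x' - x).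
Proof.
move=> e0; have y1 : 0 < enorm y + 1 by rewrite ltr_wpDl.
have [d d0 hd] := g_expansion x _ (divr_gt0 e0 y1).
exists d => // x' /hd h.
rewrite dotv_mulmxl trmxK -dotvBr; apply: le_trans (normr_dotv_le _ _) _.
apply: le_trans (_ : enorm y * (e / (enorm y + 1) * enorm (x' - x)) <= _).
  by rewrite ler_wpM2l.
rewrite mulrA ler_wpM2r // mulrCA ler_piMr ?(ltW e0) //.
by rewrite ler_pdivrMr // mul1r lerDl.
Qed.

Lemma regular_subdiff_composite x y :
  regular_subdiff psi (g x) y -> regular_subdiff phi x (V x y).
Proof.
move=> /(regular_subdiffP _ _ _ psiN)[gxy h].
apply/(regular_subdiffP _ _ _ composite_gtNy); split; first exact: lty_composite.
move=> e e0; have e30 : 0 < e / 3 by rewrite divr_gt0.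
have [C [d1 [C0 d10 h1]]] := map_lipschitz x.
have [d2 d20 h2] := h _ (divr_gt0 e30 C0).
have [d3 d30 h3] := phi0_expansion x _ e30.
have [d4 d40 h4] := dotv_g_expansion x y _ e30.
exists (Num.min (Num.min d1 (d2 / C)) (Num.min d3 d4)) => [|x'].
  by rewrite !lt_min d10 d30 d40 divr_gt0.
rewrite !lt_min => /andP[/andP[xd1 xd2] /andP[xd3 xd4]].
have {}h1 := h1 x' xd1; have {}h3 := h3 x' xd3; have {}h4 := h4 x' xd4.
have gd2 : enorm (g x' - g x) < d2.
  by apply: le_lt_trans h1 _; rewrite mulrC -ltr_pdivlMr.
have {}h2 := h2 _ gd2.
have [gx'y|] := ltP (psi (g x')) +oo%E; last first.
  by rewrite /composite leye_eq => /eqP->; rewrite addey // leey.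
rewrite !composite_fin // -EFinD lee_fin.
move: h2; rewrite (efin_num _ _ psiN gxy) (efin_num _ _ psiN gx'y) -EFinD lee_fin.
have h5 : e / 3 / C * enorm (g x' - g x) <= e / 3 * enorm (x' - x).
  by rewrite -mulrA ler_pM2l // mulrC ler_pdivrMr // mulrC.
move: h3 h4; rewrite !ler_norml => /andP[h3 _] /andP[h4 _] h2.
by rewrite dotvDl; lra.
Qed.

(** On the fibre [g = g x] the term with [psi] is constant, so [range_of_kernel] applies to
    [v - gradient phi0 x] and yields [y]. The inequality for [psi] at [z] is then read off at a
    preimage of [z] supplied by metric regularity. *)
Lemma regular_subdiff_composite_inv x v : enorm (x - xb) < r ->
  regular_subdiff phi x v -> exists2 y, v = V x y & regular_subdiff psi (g x) y.
Proof.
move=> xr /(regular_subdiffP _ _ _ composite_gtNy)[phixy h].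
have gxy := composite_lty _ phixy.
have [|y yE] := range_of_kernel x (v - gradient phi0 x) xr.
  move=> e e0; have e20 : 0 < e / 2 by rewrite divr_gt0.
  have [d1 d10 h1] := h _ e20; have [d2 d20 h2] := phi0_expansion x _ e20.
  exists (Num.min d1 d2) => [|x' gx']; first by rewrite lt_min d10.
  rewrite lt_min => /andP[xd1 xd2]; have := h1 x' xd1; have := h2 x' xd2.
  have gx'y : (psi (g x') < +oo)%E by rewrite gx'.
  rewrite !composite_fin // gx' -EFinD lee_fin ler_norml => /andP[_ ].
  by rewrite dotvBl; lra.
have vE : v = V x y by rewrite -yE addrC subrK.
exists y => //; apply/(regular_subdiffP _ _ _ psiN); split=> // e e0.
have e30 : 0 < e / 3 / K by rewrite !divr_gt0.
have [d1 d10 h1] := h _ e30.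
have [d3 d30 h3] := phi0_expansion x _ e30.
have [d4 d40 h4] := dotv_g_expansion x y _ e30.
have [_ reg] := sub x xr.
exists (Num.min r (Num.min d1 (Num.min d3 d4) / K)) => [|z].
  by rewrite lt_min r0 divr_gt0 // !lt_min d10 d30.
rewrite lt_min => /andP[zr zd]; have [x' gx' x'x] := reg z zr.
have : enorm (x' - x) < Num.min d1 (Num.min d3 d4).
  by apply: le_lt_trans x'x _; rewrite mulrC -ltr_pdivlMr.
rewrite !lt_min => /and3P[xd1 xd3 xd4].
have {}h3 := h3 x' xd3; have {}h4 := h4 x' xd4; have {}h1 := h1 x' xd1.
rewrite gx' in h4.
have [zy|] := ltP (psi z) +oo%E; last by rewrite leye_eq => /eqP->; rewrite leey.
have gx'y : (psi (g x') < +oo)%E by rewrite gx'.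
move: h1; rewrite !composite_fin // gx' -EFinD lee_fin vE.
rewrite (efin_num _ _ psiN gxy) (efin_num _ _ psiN zy) -EFinD lee_fin.
have h5 : e / 3 / K * enorm (x' - x) <= e / 3 * enorm (z - g x).
  by rewrite -mulrA ler_pM2l ?divr_gt0 // mulrC ler_pdivrMr // mulrC.
move: h3 h4; rewrite !ler_norml => /andP[_ h3] /andP[_ h4].
by rewrite dotvDl; lra.
Qed.

Lemma subdiff_composite x y : enorm (x - xb) < r ->
  subdiff psi (g x) y -> subdiff phi x (V x y).
Proof.
move=> xr /(subdiffP _ _ _ psiN)[gxy h].
apply/(subdiffP _ _ _ composite_gtNy); split; first exact: lty_composite.
move=> d d0; have [_ reg] := sub x xr.
have /continuous_enorm_real/(_ (d / 2))[|d1 d10 h1] := continuous_phi0 x.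
  by rewrite divr_gt0.
have [d2 d20 h2] := adjoint_continuous x y d d0.
have m0 : 0 < Num.min d (Num.min d1 d2) by rewrite !lt_min d0 d10.
have [|z' [y' [z'z y'y lt1 lt2 rs]]] :=
    h (Num.min (Num.min r (d / 2)) (Num.min (Num.min d (Num.min d1 d2) / K) d2)).
  by rewrite !lt_min r0 d20 !divr_gt0.
move: z'z y'y; rewrite !lt_min => /andP[/andP[zr _] /andP[zd _]] /andP[_ /andP[_ yd2]].
have [x' gx' x'x] := reg z' zr.
have : enorm (x' - x) < Num.min d (Num.min d1 d2).
  by apply: le_lt_trans x'x _; rewrite mulrC -ltr_pdivlMr.
rewrite !lt_min => /and3P[xd xd1 xd2].
exists x', (V x' y'); split=> //; last 1 first.
- by apply: regular_subdiff_composite; rewrite gx'.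
- exact: h2.
- have gx'y : (psi (g x') < +oo)%E by rewrite gx'; case: rs.
  rewrite !composite_fin // gx' -EFinD lte_fin.
  rewrite gx' in gx'y; move: lt1.
  rewrite (efin_num _ _ psiN gxy) (efin_num _ _ psiN gx'y) -EFinD lte_fin.
  have : Num.min (Num.min r (d / 2)) (Num.min (Num.min d (Num.min d1 d2) / K) d2) <= d / 2.
    by below_min.
  by have := h1 x' xd1; rewrite ltr_norml => /andP[]; lra.
- have gx'y : (psi (g x') < +oo)%E by rewrite gx'; case: rs.
  rewrite !composite_fin // gx' -EFinD lte_fin.
  rewrite gx' in gx'y; move: lt2.
  rewrite (efin_num _ _ psiN gxy) (efin_num _ _ psiN gx'y) -EFinD lte_fin.
  have : Num.min (Num.min r (d / 2)) (Num.min (Num.min d (Num.min d1 d2) / K) d2) <= d / 2.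
    by below_min.
  by have := h1 x' xd1; rewrite ltr_norml => /andP[]; lra.
Qed.

(** A limit multiplier exists by [adjoint_range_closed], and [multiplier_stable_sum] shows that the
    multipliers of the approximating regular subgradients tend to it. *)
Lemma subdiff_composite_inv x v : enorm (x - xb) < r ->
  subdiff phi x v -> exists2 y, v = V x y & subdiff psi (g x) y.
Proof.
move=> xr /(subdiffP _ _ _ composite_gtNy)[phixy h].
have gxy := composite_lty _ phixy; have [_ dgp _] := C2phi0.
have near_r x' : enorm (x' - x) < r - enorm (x - xb) -> enorm (x' - xb) < r.
  move=> xdr; apply: le_lt_trans (enorm_triangle x _ _) _.
  by rewrite addrC -ltrBrDl.
have [|y yE] := adjoint_range_closed x (v - gradient phi0 x) xr.
  move=> e e0; have e20 : 0 < e / 2 by rewrite divr_gt0.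
  have /continuous_enorm/(_ _ e20)[d1 d10 h1] := differentiable_continuous (dgp x).
  have [|x' [v' [x'x v'v _ _ rs]]] :=
      h (Num.min (Num.min d1 (r - enorm (x - xb))) (Num.min e (e / 2))).
    by rewrite !lt_min d10 subr_gt0 xr e0 e20.
  move: x'x v'v; rewrite !lt_min.
  move=> /andP[/andP[xd1 xr'] /andP[xe _]] /andP[_ /andP[_ ve]].
  have [y' v'E _] := regular_subdiff_composite_inv x' v' (near_r x' xr') rs.
  exists x', y'; split=> //.
  have -> : y' *m ('J g x')^T - (v - gradient phi0 x) =
      (v' - v) - (gradient phi0 x' - gradient phi0 x).
    by rewrite v'E; move: (y' *m _) => q; row_ring.
  apply: le_lt_trans (enormB _ _) _; rewrite [ltRHS]splitr; apply: ltrD => //.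
  exact: h1.
have vE : v = V x y by rewrite -yE addrC subrK.
exists y => //; apply/(subdiffP _ _ _ psiN); split=> // d d0.
have [d0' d0'0 h0] := multiplier_stable_sum x y xr d d0.
have /continuous_enorm/(_ d d0)[d1 d10 h1] := continuous_map g C2g x.
have /continuous_enorm_real/(_ (d / 2))[|d2 d20 h2] := continuous_phi0 x.
  by rewrite divr_gt0.
have [|x' [v' [x'x v'v lt1 lt2 rs]]] :=
    h (Num.min (Num.min d1 d2) (Num.min (Num.min d0' (r - enorm (x - xb))) (d / 2))).
  by rewrite !lt_min d10 d20 d0'0 subr_gt0 xr divr_gt0.
have le2 : Num.min (Num.min d1 d2) (Num.min (Num.min d0' (r - enorm (x - xb))) (d / 2)) <= d / 2.
  by below_min.
move: x'x v'v; rewrite !lt_min.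
move=> /andP[/andP[xd1 xd2] /andP[/andP[xd0 xr'] _]] /andP[_ /andP[/andP[vd0 _] _]].
have [y' v'E rs'] := regular_subdiff_composite_inv x' v' (near_r x' xr') rs.
have gx'y : (psi (g x') < +oo)%E by case: rs'.
have := h2 x' xd2; rewrite ltr_norml => /andP[l1 l2].
move: lt1 lt2; rewrite !composite_fin // -!EFinD !lte_fin => lt1 lt2.
exists (g x'), y'; split=> //.
- exact: h1.
- by apply: (h0 x') => //; rewrite -v'E -vE.
- by rewrite (efin_num _ _ psiN gxy) (efin_num _ _ psiN gx'y) -EFinD lte_fin; lra.
- by rewrite (efin_num _ _ psiN gxy) (efin_num _ _ psiN gx'y) -EFinD lte_fin; lra.
Qed.

(** * Growth of the composite function and prox-regularity of [psi] *)

Section Multiplier.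
Variable yb : 'rV[R]_m.
Hypotheses (Vyb : V xb yb = 0) (syb : subdiff psi (g xb) yb).

Lemma multiplier_near (e : R) : 0 < e -> exists2 d : R, 0 < d &
  forall x y, enorm (x - xb) <= d -> enorm (V x y) <= d ->
    enorm (y - yb) < e /\ enorm (g x - g xb) < e.
Proof.
move=> e0; have xbr : enorm (xb - xb) < r by rewrite subrr enorm0.
have [d1 d10 h1] := multiplier_stable_sum xb yb xbr e e0.
have /continuous_enorm/(_ e e0)[d2 d20 h2] := continuous_map g C2g xb.
exists (Num.min (d1 / 2) (d2 / 2)); first by rewrite lt_min !divr_gt0.
move=> x y; rewrite !le_min => /andP[xd1 xd2] /andP[vd1 _]; split.
  apply: (h1 x); first exact: le_lt_trans xd1 (half_lt _ d10).
  by rewrite Vyb subr0; exact: le_lt_trans vd1 (half_lt _ d10).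
by apply: h2; exact: le_lt_trans xd2 (half_lt _ d20).
Qed.

(** Graph points of the composite function near [(xb, 0)] have multipliers near [yb], where
    subdifferential continuity controls the values of [psi]. *)
Lemma composite_attentive : subdiff_continuous psi (g xb) yb -> attentive phi xb.
Proof.
move=> sc rho rho0; have rho2 : 0 < rho / 2 by rewrite divr_gt0.
have [d1 d10 h1] := sc _ rho2.
have [d2 d20 h2] := multiplier_near d1 d10.
have /continuous_enorm_real/(_ _ rho2)[d3 d30 h3] := continuous_phi0 xb.
exists (Num.min (Num.min d2 (d3 / 2)) (r / 2)) => [|x v xv].
  by rewrite !lt_min d20 !divr_gt0.
rewrite !le_min => /andP[/andP[xd2 xd3] xr] /andP[/andP[vd2 _] _].
have xd3' : enorm (x - xb) < d3.
  by apply: le_lt_trans xd3 _; exact: half_lt.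
have xr' : enorm (x - xb) < r.
  by apply: le_lt_trans xr _; exact: half_lt.
have [y vE sy] := subdiff_composite_inv x v xr' xv; rewrite vE in vd2.
have [yd gd] := h2 x y xd2 vd2.
have := h1 (g x) y sy (ltW gd) (ltW yd).
have gx := subdiff_fin _ _ _ sy; have gxb := subdiff_fin _ _ _ syb.
rewrite !composite_fin // (efin_num _ _ psiN gx) (efin_num _ _ psiN gxb).
rewrite -EFinB -EFinD abse_EFin !lte_fin => h4.
have := h3 x xd3'; move: h4; rewrite !ltr_norml => /andP[_ h4] /andP[_ h5].
by rewrite /=; lra.
Qed.

Lemma local_constants : exists C d : R, [/\ 0 < C, 0 < d &
  forall x u, enorm (x - xb) < d -> enorm (u - xb) < d ->
  [/\ `|phi0 x - phi0 u - dotv (gradient phi0 u) (x - u)| <= C * dotv (x - u) (x - u),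
      enorm (g x - g u - (x - u) *m 'J g u) <= C * dotv (x - u) (x - u)
    & enorm (g x - g u) <= C * enorm (x - u)]].
Proof.
have [C1 [d1 [C10 d10 _ h1]]] := gradient_lipschitz _ xb C2phi0.
have [C2 [d2 [C20 d20 h2]]] := map_taylor g C2g xb.
have [d3 d30 h3] := strict_diff g xb (C2_differentiable g C2g) (opcont_jacobian g C2g xb) 1 ltr01.
have [C3 C30 hC3] := enorm_mulmx ('J g xb).
pose C := C1 + C2 + C3 + 1; have C0 : 0 < C by rewrite ltr_wpDl // !addr_ge0.
exists C, (Num.min (Num.min d1 d2) d3); split=> //; first by rewrite !lt_min d10 d20.
move=> x u; rewrite !lt_min => /andP[/andP[xd1 xd2] xd3] /andP[/andP[ud1 ud2] ud3].
have a0 := dotvv_ge0 (x - u); split.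
- by apply: le_trans (h1 x u xd1 ud1) _; rewrite ler_wpM2r // /C; lra.
- by apply: le_trans (h2 x u xd2 ud2) _; rewrite ler_wpM2r // /C; lra.
rewrite -[g x - g u](subrK ((x - u) *m 'J g xb)).
apply: le_trans (enormD _ _) _; apply: le_trans (lerD (h3 x u xd3 ud3) (hC3 _)) _.
by rewrite -mulrDl ler_wpM2r // /C; lra.
Qed.

Ltac bare_lra :=
  clear -C2phi0 C2g psiN psi_lsc rank_g K0 r0 sub Vyb syb; lra.

Lemma growth_of_prox : prox_regular psi (g xb) yb ->
  exists s rho : R, [/\ 0 <= s, 0 < rho & growth phi xb (- s) rho].
Proof.
move=> [_ _ [eps [rp [eps0 rp0 hp]]]]; have eps2 : 0 < eps / 2 by rewrite divr_gt0.
have [C [d1 [C0 d10 h1]]] := local_constants.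
have [d2 d20 h2] := multiplier_near _ eps2.
have m1 : 0 < Num.min eps 1 by rewrite lt_min eps0 ltr01.
have [d3 d30 h3] := multiplier_near _ m1.
have /continuous_enorm_real/(_ _ eps2)[d4 d40 h4] := continuous_phi0 xb.
have /continuous_enorm/(_ _ eps0)[d5 d50 h5] := continuous_map g C2g xb.
pose rho := Num.min (Num.min (Num.min (d1 / 2) (d3 / 2)) (Num.min (d4 / 2) (d5 / 2))) (Num.min (eps / 2) (r / 2)).
have rho0 : 0 < rho by rewrite !lt_min !divr_gt0.
have rd1 : rho <= d1 / 2 by below_min.
have rd3 : rho <= d3 / 2 by below_min.
have rd4 : rho <= d4 / 2 by below_min.
have rd5 : rho <= d5 / 2 by below_min.
have re : rho <= eps / 2 by below_min.
have rr : rho < r.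
  apply: (@le_lt_trans _ _ (r / 2)); first by below_min.
  exact: half_lt.
clearbody rho.
(* The curvature of [phi0], that of [<y, g>] for multipliers within [1] of [yb], and the
   prox-regularity constant seen through the [C]-Lipschitz [g]; the factor [2] offsets the [s / 2]
   in [growth]. *)
pose s := 2 * (C + (enorm yb + 1) * C) + rp * C ^+ 2.
have s0 : 0 <= s.
  by rewrite addr_ge0 ?mulr_ge0 ?addr_ge0 ?mulr_ge0 ?addr_ge0 ?sqr_ge0 // ltW.
exists s, rho; split=> // u v x uv ur vr fu xr.
have ur' : enorm (u - xb) < r by apply: le_lt_trans rr.
have [y vE sy] := subdiff_composite_inv u v ur' uv.
have vd3 : enorm (V u y) <= d3 by rewrite -vE; exact: ltW (lt_half _ _ _ vr rd3 d30).
have ud3 := ltW (lt_half _ _ _ ur rd3 d30).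
have [] := h3 u y ud3 vd3; rewrite !lt_min => /andP[ye y1] /andP[ge _].
have xd1 := lt_half _ _ _ xr rd1 d10.
have ud1 := lt_half _ _ _ ur rd1 d10.
have [t1 t2 t3] := h1 x u xd1 ud1.
have guy := subdiff_fin _ _ _ sy; have gxby := subdiff_fin _ _ _ syb.
have ud4 := lt_half _ _ _ ur rd4 d40.
have := h4 u ud4; rewrite ltr_norml => /andP[p1 p2].
have pu : (psi (g u) < psi (g xb) + eps%:E)%E.
  move: fu; rewrite !composite_fin //.
  rewrite (efin_num _ _ psiN guy) (efin_num _ _ psiN gxby) -!EFinD !lte_fin /=.
  by move: p1 re; bare_lra.
have xd5 := lt_half _ _ _ xr rd5 d50.
have := hp (g x) (g u) y (ltW (h5 x xd5)) sy (ltW ge) (ltW ye) pu.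
have [gxy|] := ltP (psi (g x)) +oo%E; last first.
  by rewrite /composite leye_eq => /eqP-> _; rewrite addey // leey.
rewrite !composite_fin //.
rewrite (efin_num _ _ psiN guy) (efin_num _ _ psiN gxy) -EFinB -!EFinD !lee_fin /=.
rewrite vE dotvDl.
move: t1; rewrite ler_norml => /andP[t1 _].
have yN : enorm y <= enorm yb + 1.
  exact/enorm_near/ltW.
have q1 : dotv (y *m ('J g u)^T) (x - u) - (enorm yb + 1) * C * dotv (x - u) (x - u)
    <= dotv y (g x - g u).
  have E : dotv y (g x - g u) = dotv (y *m ('J g u)^T) (x - u)
      + dotv y (g x - g u - (x - u) *m 'J g u).
    by rewrite dotv_mulmxl trmxK -dotvDr (addrC (_ *m _)) subrK.
  rewrite E lerD2l; apply: le_trans (dotv_geN_enorm _ _); rewrite lerN2 -mulrA.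
  by apply: ler_pM.
have q2 : enorm (g x - g u) ^+ 2 <= C ^+ 2 * dotv (x - u) (x - u).
  rewrite -(enorm_sq (x - u)) -exprMn ler_pXn2r ?nnegrE ?mulr_ge0 //; exact: ltW.
have q3 : rp / 2 * enorm (g x - g u) ^+ 2 <= rp / 2 * (C ^+ 2 * dotv (x - u) (x - u)).
  by rewrite ler_wpM2l // divr_ge0.
move: q1 q3; rewrite /s; move: (dotv (y *m _) _) => k q1 q3.
by move: t1 q1 q3; bare_lra.
Qed.

Lemma prox_of_growth rho : 0 < rho -> growth phi xb 0 rho ->
  prox_regular psi (g xb) yb.
Proof.
move=> rho0 gr; split=> //.
have [C [d1 [C0 d10 h1]]] := local_constants.
have /continuous_enorm_real/(_ (rho / 2))[|d2 d20 h2] := continuous_phi0 xb.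
  by rewrite divr_gt0.
have [d3 d30 h3] := adjoint_continuous xb yb rho rho0.
pose M := Num.min (Num.min (d1 / 2) (d2 / 2)) (Num.min (Num.min (d3 / 2) rho) (r / 2)).
have M0 : 0 < M by rewrite !lt_min rho0 !divr_gt0.
have Md1 : M <= d1 / 2 by below_min.
have Md2 : M <= d2 / 2 by below_min.
have Md3 : M <= d3 / 2 by below_min.
have Mrho : M <= rho by below_min.
have Mr : M < r.
  apply: (@le_lt_trans _ _ (r / 2)); first by below_min.
  exact: half_lt.
clearbody M.
pose eps := Num.min (Num.min (M / 4 / K) (r / 3)) (Num.min (Num.min (rho / 2) 1) (d3 / 2)).
have eps0 : 0 < eps by rewrite !lt_min ltr01 !divr_gt0.
have eM : eps * K <= M / 4 by rewrite -ler_pdivlMr // !ge_min lexx.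
have er : eps <= r / 3 by below_min.
have erho : eps <= rho / 2 by below_min.
have e1 : eps <= 1 by below_min.
have ed3 : eps <= d3 / 2 by below_min.
have er1 : eps < r by lra.
have er2 : eps + eps < r by lra.
clearbody eps.
(* The same two curvature terms; [K ^+ 2] converts the distance of the lifted points into that of
   their images. *)
pose rp := 2 * (C + (enorm yb + 1) * C) * K ^+ 2.
have rp0 : 0 <= rp.
  by rewrite !mulr_ge0 ?addr_ge0 ?mulr_ge0 ?addr_ge0 ?sqr_ge0 // ltW.
exists eps, rp; split=> // z u' y zr sy u'r yr pu; rewrite /eball /= in zr u'r yr sy.
have xbr : enorm (xb - xb) < r by rewrite subrr enorm0.
have [_ regb] := sub xb xbr.
(* Both arguments of [psi] are lifted: [u'] starting from [xb], and [z] starting from the lift [u],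
   which ensures [|x - u| <= K |z - u'|]. *)
have [u gu uxb] := regb u' (le_lt_trans u'r er1).
have uM : enorm (u - xb) <= M / 4.
  by apply: le_trans uxb _; rewrite mulrC; apply: le_trans eM; rewrite ler_wpM2r // ltW.
have uM' : enorm (u - xb) <= M by move: uM M0; bare_lra.
have ur : enorm (u - xb) < r := le_lt_trans uM' Mr.
have [_ regu] := sub u ur.
have zu' : enorm (z - u') <= eps + eps.
  by apply: le_trans (enorm_triangle (g xb) _ _) _; rewrite (enormBC _ u') lerD.
have [|x gx xu] := regu z; first by rewrite gu; exact: le_lt_trans zu' er2.
rewrite gu in xu.
have xuM : enorm (x - u) <= M / 2.
  apply: le_trans xu _; apply: le_trans (_ : K * (eps + eps) <= _).
    by rewrite ler_pM2l.
  by rewrite mulrDr (mulrC K); move: eM; bare_lra.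
have xM : enorm (x - xb) <= M.
  by apply: le_trans (enorm_triangle u _ _) _; move: uM xuM M0; bare_lra.
have u'y : (psi u' < +oo)%E := subdiff_fin _ _ _ sy.
have gxby := subdiff_fin _ _ _ syb.
have [zy|] := ltP (psi z) +oo%E; last by rewrite leye_eq => /eqP->; rewrite leey.
rewrite -gu in sy u'y pu *; rewrite -gx in zy *.
have sv := subdiff_composite u y ur sy.
have ud3 := lt_half _ _ _ uM' Md3 d30.
have yd3 := lt_half _ _ _ yr ed3 d30.
have := h3 u y ud3 yd3; rewrite Vyb subr0 => vrho.
have ud2 := lt_half _ _ _ uM' Md2 d20.
have := h2 u ud2; rewrite ltr_norml => /andP[p1 p2].
have fu : (phi u < phi xb + rho%:E)%E.
  rewrite !composite_fin // -EFinD lte_fin.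
  move: pu; rewrite (efin_num _ _ psiN u'y) (efin_num _ _ psiN gxby) -EFinD lte_fin /=.
  by move: p2 erho; bare_lra.
have urho := le_trans uM' Mrho.
have xrho := le_trans xM Mrho.
have := gr u (V u y) x sv urho (ltW vrho) fu xrho.
rewrite !composite_fin // -EFinD lee_fin mul0r mul0r addr0 dotvDl.
rewrite (efin_num _ _ psiN u'y) (efin_num _ _ psiN zy) -?EFinD -?EFinB -?EFinD lee_fin /=.
have xd1 := lt_half _ _ _ xM Md1 d10.
have ud1 := lt_half _ _ _ uM' Md1 d10.
have [t1 t2 t3] := h1 x u xd1 ud1.
move: t1; rewrite ler_norml => /andP[_ t1].
have yN : enorm y <= enorm yb + 1.
  exact/enorm_near/(le_trans yr).
have q1 : dotv y (g x - g u) <= dotv (y *m ('J g u)^T) (x - u)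
    + (enorm yb + 1) * C * dotv (x - u) (x - u).
  have E : dotv y (g x - g u) = dotv (y *m ('J g u)^T) (x - u)
      + dotv y (g x - g u - (x - u) *m 'J g u).
    by rewrite dotv_mulmxl trmxK -dotvDr (addrC (_ *m _)) subrK.
  rewrite E lerD2l; apply: le_trans (dotv_le_enorm _ _) _; rewrite -mulrA.
  by apply: ler_pM.
have q2 : dotv (x - u) (x - u) <= K ^+ 2 * enorm (g x - g u) ^+ 2.
  rewrite -enorm_sq -exprMn ler_pXn2r ?nnegrE ?mulr_ge0 ?(ltW K0) //.
  by rewrite gx gu.
have q3 : (C + (enorm yb + 1) * C) * dotv (x - u) (x - u) <=
    (C + (enorm yb + 1) * C) * (K ^+ 2 * enorm (g x - g u) ^+ 2).
  by rewrite ler_wpM2l // addr_ge0 ?mulr_ge0 ?addr_ge0 // ltW.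
move: q1 q3; rewrite /rp; move: (dotv (y *m _) _) => k q1 q3.
by move: t1 q1 q3; bare_lra.
Qed.

End Multiplier.

(** The derivative in [x] of [V x y], the gradient of the Lagrangian: it is the extra displacement
    of the subgradient when the composite graph is followed instead of that of [psi]. *)
Definition lagrangian_hessian (x : 'rV[R]_n) (y : 'rV[R]_m) : 'M[R]_n :=
  hessian phi0 x + hessian (fun z => dotv y (g z)) x.
Local Notation A := lagrangian_hessian.

Lemma second_order_formE x y u w : second_order_form phi0 g x y u w =
  dotv (w *m A x y) w + dotv u (w *m 'J g x).
Proof. by rewrite /second_order_form /A mulmxDr dotvDl. Qed.

(** Differentiability of the gradients of [phi0] and of [<y, g>], together with the product of
    [y' - y] and the increment of the Jacobian, which is of second order. *)
Lemma adjoint_expansion x (y : 'rV[R]_m) (e : R) : 0 < e -> exists2 d : R, 0 < d &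
  forall x' y', enorm (x' - x) < d -> enorm (y' - y) < d ->
    enorm (V x' y' - V x y - ((x' - x) *m A x y + (y' - y) *m ('J g x)^T)) <=
      e * (enorm (x' - x) + enorm (y' - y)).
Proof.
move=> e0; have e20 : 0 < e / 2 by rewrite divr_gt0.
have [_ dgp _] := C2phi0.
have [[_ dgy _] _] := C2_dotv g C2g y.
have [d1 d10 h1] := diff_expansion _ _ (dgp x) _ e20.
have [d2 d20 h2] := diff_expansion _ _ (dgy x) _ e20.
have [d3 d30 h3] := opcont_jacobian g C2g x e e0.
exists (Num.min d1 (Num.min d2 d3)) => [|x' y']; first by rewrite !lt_min d10 d20.
rewrite !lt_min => /and3P[xd1 xd2 xd3] _.
have {}h1 := h1 x' xd1; have {}h2 := h2 x' xd2.
have {}h3 := enorm_trmx _ _ (ltW e0) (h3 x' xd3) (y' - y).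
rewrite !gradient_dotv // -/(hessian _ _) in h2; rewrite -/(hessian _ _) in h1.
have alg (G' G p q : 'rV[R]_n) (J' J : 'M[R]_(n, m)) :
    enorm (G' - G - p) <= e / 2 * enorm (x' - x) ->
    enorm (y *m J'^T - y *m J^T - q) <= e / 2 * enorm (x' - x) ->
    enorm ((y' - y) *m (J' - J)^T) <= e * enorm (y' - y) ->
    enorm (G' + y' *m J'^T - (G + y *m J^T) - (p + q + (y' - y) *m J^T)) <=
      e * (enorm (x' - x) + enorm (y' - y)).
  have -> : G' + y' *m J'^T - (G + y *m J^T) - (p + q + (y' - y) *m J^T) =
      (G' - G - p) + (y *m J'^T - y *m J^T - q) + (y' - y) *m (J' - J)^T.
    rewrite trmx_sub mulmxBr !mulmxBl.
    by move: (y' *m J'^T) (y *m J'^T) (y' *m J^T) (y *m J^T) => a b c d;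
      row_ring.
  move=> k1 k2 k3; apply: le_trans (enormD _ _) _.
  apply: le_trans (lerD (enormD _ _) (lexx _)) _.
  by apply: le_trans (lerD (lerD k1 k2) k3) _; rewrite -mulrDl -splitr mulrDr.
by rewrite /A mulmxDr; exact: (alg _ _ _ _ _ _ h1 h2 h3).
Qed.

Lemma adjoint_lipschitz x (y : 'rV[R]_m) : exists C d : R, [/\ 0 < C, 0 < d &
  forall x' y', enorm (x' - x) < d -> enorm (y' - y) < d ->
    enorm (V x' y' - V x y) <= C * (enorm (x' - x) + enorm (y' - y))].
Proof.
have [d d0 h] := adjoint_expansion x y 1 ltr01.
have [C1 C10 h1] := enorm_mulmx (A x y).
have [C2 C20 h2] := enorm_mulmx ('J g x)^T.
exists (1 + C1 + C2), d; split=> //; first by rewrite !ltr_pwDl // addr_ge0.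
move=> x' y' xd yd; have {h} := h x' y' xd yd; have {h1} := h1 (x' - x); have {h2} := h2 (y' - y).
move: (_ *m A x y) (_ *m ('J g x)^T) (V x' y' - V x y) => p q b h2 h1 h.
have := enormD (b - (p + q)) (p + q); rewrite subrK => h3.
have := enormD p q; have a0 := enorm_ge0 (x' - x); have b0 := enorm_ge0 (y' - y).
have : 0 <= C1 * enorm (y' - y) by rewrite mulr_ge0.
have : 0 <= C2 * enorm (x' - x) by rewrite mulr_ge0.
by lra.
Qed.

(** Solves the expansion of [V] for [y' - y]; the accuracy [1 / (2 K)] leaves half of [|y' - y|] to
    be absorbed on the left. *)
Lemma multiplier_lipschitz x (y : 'rV[R]_m) : enorm (x - xb) < r ->
  exists C d : R, [/\ 0 < C, 0 < d &
  forall x' y', enorm (x' - x) < d -> enorm (y' - y) < d ->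
    enorm (y' - y) <= C * (enorm (x' - x) + enorm (V x' y' - V x y))].
Proof.
move=> xr; have [[B [BJ hB]] _] := sub x xr.
have e0 : 0 < (2 * K)^-1 by rewrite invr_gt0 mulr_gt0.
have [d d0 h] := adjoint_expansion x y _ e0.
have [C1 C10 h1] := enorm_mulmx (A x y).
exists (2 * K * (1 + C1) + 1), d; split=> //.
  by rewrite addr_gt0 // !mulr_gt0 // ltr_pwDl.
move=> x' y' xd yd; have {h} := h x' y' xd yd; have {h1} := h1 (x' - x).
have := enorm_trmx B K (ltW K0) hB ((y' - y) *m ('J g x)^T); rewrite mulmx_trK //.
move: (_ *m A x y) (_ *m ('J g x)^T) (V x' y' - V x y) => p q b h2 h1 h.
have := enormB (b - p) (b - (p + q)).
have -> : b - p - (b - (p + q)) = q by row_ring.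
have := enormB b p => h4 h5.
have h6 : K * enorm q <= K * (enorm b + C1 * enorm (x' - x) + (2 * K)^-1 * (enorm (x' - x) + enorm (y' - y))).
  by rewrite ler_pM2l //; lra.
have h7 : K * ((2 * K)^-1 * (enorm (x' - x) + enorm (y' - y))) = (enorm (x' - x) + enorm (y' - y)) / 2.
  by field; rewrite gt_eqF.
have : 0 <= K * (C1 * enorm b) by rewrite !mulr_ge0 // ltW.
have : 0 <= K * enorm (x' - x) by rewrite mulr_ge0 // ltW.
have b0 := enorm_ge0 b.
by lra.
Qed.

(** In the pairing with a displacement of [(x, V x y)], the expansion of [V] moves [A] and the
    Jacobian onto [w]; up to small remainders, the test of the normal of [psi] is left. The
    transpose of [A] disappears once the result is paired with [w]. *)
Lemma regular_normal_composite x y u w : enorm (x - xb) < r ->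
  regular_normal (subdiff psi) (g x) y u (w *m 'J g x) ->
  regular_normal (subdiff phi) x (V x y)
    (w *m (A x y)^T + u *m ('J g x)^T) w.
Proof.
move=> xr [sy hn]; split; first exact: subdiff_composite.
move=> e e0; have e30 : 0 < e / 3 by rewrite divr_gt0.
have [Cy [d1 [Cy0 d10 h1]]] := multiplier_lipschitz x y xr.
have [Cg [d2 [Cg0 d20 h2]]] := map_lipschitz x.
have Cgy0 : 0 < Cg + Cy by rewrite addr_gt0.
have [d3 d30 h3] := hn _ (divr_gt0 e30 Cgy0).
have w10 : 0 < enorm w + 1 by rewrite ltr_wpDl.
have Cy10 : 0 < 1 + Cy by rewrite addr_gt0.
have Cw0 : 0 < (enorm w + 1) * (1 + Cy) by rewrite mulr_gt0.
have [d4 d40 h4] := adjoint_expansion x y _ (divr_gt0 e30 Cw0).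
have [d5 d50 h5] := dotv_g_expansion x u _ e30.
pose dy := Num.min d1 (Num.min d3 d4).
have dy0 : 0 < dy by rewrite !lt_min d10 d30.
have [d6 d60 h6] := multiplier_stable_sum x y xr dy dy0.
have /continuous_enorm/(_ _ d30)[d7 d70 h7] := continuous_map g C2g x.
exists (Num.min (Num.min (Num.min d1 d2) (Num.min d4 d5)) (Num.min (Num.min d6 d7) (r - enorm (x - xb)))).
  by rewrite !lt_min d10 d20 d40 d50 d60 d70 subr_gt0.
move=> x' v' xv'; rewrite !lt_min.
move=> /andP[/andP[/andP[xd1 xd2] /andP[xd4 xd5]] /andP[/andP[xd6 xd7] xr']].
move=> /andP[_ /andP[/andP[vd6 _] _]].
have x'r : enorm (x' - xb) < r.
  apply: le_lt_trans (enorm_triangle x _ _) _.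
  by rewrite addrC -ltrBrDl.
have [y' v'E sy'] := subdiff_composite_inv x' v' x'r xv'.
rewrite v'E in vd6 *.
have := h6 x' y' xd6 vd6; rewrite !lt_min => /and3P[yd1 yd3 yd4].
have {h1} := h1 x' y' xd1 yd1; have {h2} := h2 x' xd2.
have {h3} := h3 (g x') y' sy' (h7 x' xd7) yd3.
have {h4} := h4 x' y' xd4 yd4; have {h5} := h5 x' xd5.
rewrite ler_norml => /andP[+ _].
have E : dotv (w *m (A x y)^T + u *m ('J g x)^T) (x' - x) - dotv w (V x' y' - V x y) =
  (dotv u (g x' - g x) - dotv (w *m 'J g x) (y' - y))
  - (dotv u (g x' - g x) - dotv (u *m ('J g x)^T) (x' - x))
  - dotv w (V x' y' - V x y - ((x' - x) *m A x y + (y' - y) *m ('J g x)^T)).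
  rewrite dotvDl (dotv_mulmxl w (A x y)^T) trmxK (dotv_mulmxl w ('J g x)).
  move: ((x' - x) *m A x y) ((y' - y) *m ('J g x)^T) (V x' y' - V x y) => p q b.
  by rewrite (dotvBr b) (dotvDr p q); ring.
rewrite E; move: (dotv u (g x' - g x) - _) (dotv u (g x' - g x) - _) (V x' y' - V x y).
move=> q1 q2 b; move: (b - _) => e1.
have := dotv_geN_enorm w e1.
have b0 := enorm_ge0 b; have a0 := enorm_ge0 (x' - x).
move: (enorm (x' - x)) (enorm b) (enorm (y' - y)) (enorm (g x' - g x)) a0 b0 => a bb dy' dg a0 b0.
move=> k1 k2 k3 k4 k5 k6.
have l1 : enorm w * enorm e1 <= e / 3 * (a + bb).
  apply: le_trans (_ : (enorm w + 1) * (e / 3 / ((enorm w + 1) * (1 + Cy)) * (a + dy')) <= _).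
    by apply: ler_pM => //; rewrite lerDl.
  have w1 : enorm w + 1 != 0 by rewrite gt_eqF // ltr_wpDl.
  have c1 : 1 + Cy != 0 by rewrite gt_eqF // addr_gt0.
  have -> : (enorm w + 1) * (e / 3 / ((enorm w + 1) * (1 + Cy)) * (a + dy')) =
      e / 3 * ((a + dy') / (1 + Cy)) by field; rewrite w1 c1.
  rewrite ler_pM2l // ler_pdivrMr ?addr_gt0 //; lra.
have l2 : e / 3 / (Cg + Cy) * (dg + dy') <= e / 3 * (a + bb).
  rewrite -mulrA ler_pM2l // mulrC ler_pdivrMr //.
  have : 0 <= Cg * bb by rewrite mulr_ge0 // ltW.
  by lra.
have l3 : 0 <= e / 3 * bb by rewrite mulr_ge0 // ltW.
by lra.
Qed.

(** Holding [y' = y] and moving along the fibre [g = g x] brings [p - w *m (A x y)^T] under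
    [range_of_kernel], which supplies [u]; displacements on the graph of [subdiff psi] are then
    lifted to the composite graph. *)
Lemma regular_normal_composite_inv x v p w : enorm (x - xb) < r ->
  regular_normal (subdiff phi) x v p w -> exists y u,
    [/\ v = V x y, subdiff psi (g x) y,
        p = w *m (A x y)^T + u *m ('J g x)^T
      & regular_normal (subdiff psi) (g x) y u (w *m 'J g x)].
Proof.
move=> xr [xv hn]; have [y vE sy] := subdiff_composite_inv x v xr xv.
rewrite vE in xv hn *; clear v vE.
have w10 : 0 < enorm w + 1 by rewrite ltr_wpDl.
have [Cb [d1 [Cb0 d10 h1]]] := adjoint_lipschitz x y.
have Cb10 : 0 < 1 + Cb by rewrite addr_gt0.
have pairing x' y' : dotv p (x' - x) - dotv w (V x' y' - V x y) =
    dotv (p - w *m (A x y)^T) (x' - x) - dotv (w *m 'J g x) (y' - y)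
    - dotv w (V x' y' - V x y - ((x' - x) *m A x y + (y' - y) *m ('J g x)^T)).
  rewrite dotvBl (dotv_mulmxl w (A x y)^T) trmxK (dotv_mulmxl w ('J g x)).
  move: ((x' - x) *m A x y) ((y' - y) *m ('J g x)^T) (V x' y' - V x y) => a q b.
  by rewrite (dotvBr b) (dotvDr a q); ring.
have remainder (e : R) : 0 < e -> exists2 d : R, 0 < d & forall x' y',
    enorm (x' - x) < d -> enorm (y' - y) < d ->
    `|dotv w (V x' y' - V x y - ((x' - x) *m A x y + (y' - y) *m ('J g x)^T))|
    <= e * (enorm (x' - x) + enorm (y' - y)).
  move=> e0; have [d d0 h] := adjoint_expansion x y _ (divr_gt0 e0 w10).
  exists d => // x' y' xd yd; have {h} := h x' y' xd yd.
  move: (V x' y' - V x y - _) => e1 h.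
  have ab0 : 0 <= enorm (x' - x) + enorm (y' - y) by rewrite addr_ge0.
  apply: le_trans (normr_dotv_le _ _) _.
  apply: le_trans (_ : (enorm w + 1) * (e / (enorm w + 1) * (enorm (x' - x) + enorm (y' - y))) <= _).
    by apply: ler_pM => //; rewrite lerDl.
  by rewrite mulrA (mulrC (enorm w + 1)) divfK // gt_eqF.
have [|u uE] := range_of_kernel x (p - w *m (A x y)^T) xr.
  move=> e e0; have e20 : 0 < e / 2 by rewrite divr_gt0.
  have [d2 d20 h2] := hn _ (divr_gt0 e20 Cb10).
  have [d3 d30 h3] := remainder _ e20.
  exists (Num.min (Num.min (Num.min d1 d2) (d2 / Cb)) (Num.min d3 (r - enorm (x - xb)))).
    by rewrite !lt_min d10 d20 d30 divr_gt0 // subr_gt0.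
  move=> x' gx'; rewrite !lt_min => /andP[/andP[/andP[xd1 xd2] xdb] /andP[xd3 xdr]].
  have x'r : enorm (x' - xb) < r.
    by apply: le_lt_trans (enorm_triangle x _ _) _; rewrite addrC -ltrBrDl.
  have sv : subdiff phi x' (V x' y) by apply: subdiff_composite => //; rewrite gx'.
  have yy : enorm (y - y) < d1 by rewrite subrr enorm0.
  have yy3 : enorm (y - y) < d3 by rewrite subrr enorm0.
  have {}h1 := h1 x' y xd1 yy; have {}h3 := h3 x' y xd3 yy3.
  have bd2 : enorm (V x' y - V x y) < d2.
    apply: le_lt_trans h1 _; rewrite [y - y]subrr enorm0 addr0.
    by rewrite mulrC -ltr_pdivlMr.
  have {}h2 := h2 x' _ sv xd2 bd2.
  move: h2; rewrite pairing; move: h1 h3; rewrite [y - y]subrr enorm0 addr0 dotv0 subr0.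
  move: (dotv w _) => k h1; rewrite ler_norml => /andP[_ h3] h2.
  have l1 : e / 2 / (1 + Cb) * (enorm (x' - x) + enorm (V x' y - V x y)) <= e / 2 * enorm (x' - x).
    by rewrite -mulrA ler_pM2l // mulrC ler_pdivrMr // mulrDr mulr1 lerD2l mulrC.
  by move: (dotv (p - _) _) h2 l1 => c h2 l1; lra.
exists y, u; split=> //; first by rewrite -uE addrC subrK.
split=> // e e0; have e30 : 0 < e / 3 by rewrite divr_gt0.
have K10 : 0 < K + 1 by rewrite addr_gt0.
have [_ reg] := sub x xr.
have [d2 d20 h2] := hn _ (divr_gt0 e30 (mulr_gt0 Cb10 K10)).
have [d3 d30 h3] := remainder _ (divr_gt0 e30 K10).
have [d4 d40 h4] := dotv_g_expansion x u _ (divr_gt0 e30 K0).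
have [d dE] : exists d, d = Num.min (Num.min (Num.min d1 d2) (d2 / Cb / 2))
    (Num.min (Num.min d3 d4) (r - enorm (x - xb))) by eexists.
have d0 : 0 < d by rewrite dE !lt_min d10 d20 d30 d40 subr_gt0 xr !divr_gt0.
exists (Num.min (Num.min r (d / K)) d) => [|z' y' zy' ]; first by rewrite !lt_min r0 d0 divr_gt0.
rewrite !lt_min => /andP[/andP[zr zd] _] /andP[_ yd].
have [x' gx' x'z] := reg z' zr.
have xd : enorm (x' - x) < d.
  by apply: le_lt_trans x'z _; rewrite mulrC -ltr_pdivlMr.
move: xd yd; rewrite dE !lt_min.
move=> /andP[/andP[/andP[xd1 xd2] xdb] /andP[/andP[xd3 xd4] xdr]].
move=> /andP[/andP[/andP[yd1 yd2] ydb] /andP[/andP[yd3 yd4] ydr]].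
have x'r : enorm (x' - xb) < r.
  by apply: le_lt_trans (enorm_triangle x _ _) _; rewrite addrC -ltrBrDl.
have sv : subdiff phi x' (V x' y') by apply: subdiff_composite => //; rewrite gx'.
have {}h1 := h1 x' y' xd1 yd1; have {}h3 := h3 x' y' xd3 yd3.
have {}h4 := h4 x' xd4; rewrite gx' in h4.
have bd2 : enorm (V x' y' - V x y) < d2.
  apply: le_lt_trans h1 _; rewrite mulrC -ltr_pdivlMr //.
  by rewrite [ltRHS]splitr ltrD.
have {}h2 := h2 x' _ sv xd2 bd2.
move: h2; rewrite pairing uE; move: h1 h3 h4.
rewrite !ler_norml => h1 /andP[_ h3] /andP[_ h4] h2.
move: h1 h2 h3 h4.
move: (dotv w (_ - _)) (dotv (u *m _) _) (dotv (w *m _) _) (dotv u _) => k1 k2 k3 k4.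
have a0 := enorm_ge0 (x' - x); have c0 := enorm_ge0 (y' - y); have dz0 := enorm_ge0 (z' - g x).
move: (enorm (V x' y' - V x y)) (enorm (x' - x)) (enorm (y' - y)) (enorm (z' - g x)) x'z a0 c0 dz0.
move=> b a c dz x'z a0 c0 dz0 h1 h2 h3 h4.
have Kc0 : 0 <= K * c by rewrite mulr_ge0 // ltW.
have S : a + c <= (K + 1) * (dz + c) by lra.
have l1 : e / 3 / ((1 + Cb) * (K + 1)) * (a + b) <= e / 3 * (dz + c).
  rewrite -mulrA ler_pM2l // mulrC ler_pdivrMr ?mulr_gt0 //.
  have : (1 + Cb) * (a + c) <= (1 + Cb) * ((K + 1) * (dz + c)) by rewrite ler_pM2l.
  by lra.
have l2 : e / 3 / (K + 1) * (a + c) <= e / 3 * (dz + c).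
  by rewrite -mulrA ler_pM2l // mulrC ler_pdivrMr // mulrC.
have l3 : e / 3 / K * a <= e / 3 * dz.
  by rewrite -mulrA ler_pM2l // mulrC ler_pdivrMr // mulrC.
have l4 : 0 <= e / 3 * c by rewrite mulr_ge0 // ltW.
by lra.
Qed.

End Submersive.
End Composite.

Lemma regular_normalZ {R : realType} {n : nat} (G : 'rV[R]_n -> set 'rV[R]_n)
    z y u w (k : R) : 0 < k ->
  regular_normal G z y u w -> regular_normal G z y (k *: u) (k *: w).
Proof.
move=> k0 [Gzy h]; split=> // e e0; have [d d0 hd] := h _ (divr_gt0 e0 k0).
exists d => // z' y' Gzy' zd yd.
rewrite !dotvZl -mulrBr mulrC -ler_pdivlMr // mulrAC; exact: hd.
Qed.

(** * Second-order conditions *)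

Section SecondOrder.
Context {R : realType} {n m : nat}.

Lemma quadratic_form_perturbation (A0 : 'M[R]_n) (u q : 'rV[R]_m) (w : 'rV[R]_n)
    (s e : R) : 0 <= s -> 0 < e ->
  exists2 d : R, 0 < d & forall (A1 : 'M[R]_n) u' q' w',
    enorm (u' - u) < d -> enorm (q' - q) < d -> enorm (w' - w) < d ->
    (forall a, enorm (a *m (A1 - A0)) <= d * enorm a) ->
    dotv (w' *m A1) w' + dotv u' q' - s * dotv w' w' <=
    dotv (w *m A0) w + dotv u q - s * dotv w w + e.
Proof.
move=> s0 e0; have [C C0 hC] := enorm_mulmx A0.
pose W := enorm w + 1; have W1 : 1 <= W by rewrite lerDr.
have W0 : 0 <= W by apply: le_trans W1.
pose Q := enorm q + 1; have Q0 : 0 <= Q by rewrite addr_ge0.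
(* [M] sums the coefficients of [d] in [t1] to [t6]; the final [1] makes it positive. *)
pose M := W * W + 2 * (C * W) + (Q + enorm u) + 2 * (s * W) + 1.
have M0 : 0 < M by rewrite ltr_wpDl // !addr_ge0 ?mulr_ge0.
pose d := Num.min 1 (e / M).
have d0 : 0 < d by rewrite lt_min ltr01 divr_gt0.
have d1 : d <= 1 by rewrite ge_min lexx.
have dM : d * M <= e by rewrite -ler_pdivlMr // ge_min lexx orbT.
clearbody d; exists d => // A1 u' q' w' ud qd wd hA.
have w'W : enorm w' <= W by apply: enorm_near; lra.
have q'Q : enorm q' <= Q by apply: enorm_near; lra.
have wW : enorm w <= W by rewrite lerDl.
have t1 : dotv (w' *m (A1 - A0)) w' <= d * (W * W).
  apply: le_trans (dotv_le_enorm _ _) _; rewrite mulrA; apply: ler_pM => //.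
  by apply: le_trans (hA w') _; rewrite ler_pM2l.
have t2 : dotv ((w' - w) *m A0) w' <= d * (C * W).
  apply: le_trans (dotv_le_enorm _ _) _; rewrite mulrA; apply: ler_pM => //.
  by apply: le_trans (hC _) _; rewrite mulrC ler_wpM2r // ltW.
have t3 : dotv (w *m A0) (w' - w) <= d * (C * W).
  apply: le_trans (dotv_le_enorm _ _) _; rewrite mulrC; apply: ler_pM => //.
    exact: ltW.
  by apply: le_trans (hC _) _; rewrite ler_wpM2l.
have t4 : dotv (u' - u) q' <= d * Q.
  by apply: le_trans (dotv_le_enorm _ _) _; apply: ler_pM => //; exact: ltW.
have t5 : dotv u (q' - q) <= d * enorm u.
  apply: le_trans (dotv_le_enorm _ _) _; rewrite mulrC.
  by apply: ler_wpM2r => //; exact: ltW.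
have t6 : s * dotv (w - w') (w + w') <= s * (d * (W + W)).
  rewrite ler_wpM2l //; apply: le_trans (dotv_le_enorm _ _) _.
  apply: ler_pM => //; first by rewrite enormBC ltW.
  by apply: le_trans (enormD _ _) _; rewrite lerD.
have E : dotv (w' *m A1) w' + dotv u' q' - s * dotv w' w' =
  dotv (w *m A0) w + dotv u q - s * dotv w w +
  (dotv (w' *m (A1 - A0)) w' + dotv ((w' - w) *m A0) w' + dotv (w *m A0) (w' - w)
   + dotv (u' - u) q' + dotv u (q' - q) + s * dotv (w - w') (w + w')).
  rewrite mulmxBr mulmxBl; move: (w' *m A1) (w' *m A0) (w *m A0) => a b c.
  by rewrite !dotvE (dotvC w' w); ring.
by rewrite E lerD2l; move: dM; rewrite /M; lra.
Qed.

Variables (phi0 : 'rV[R]_n -> R) (g : 'rV[R]_n -> 'rV[R]_m)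
  (psi : 'rV[R]_m -> \bar R) (xb : 'rV[R]_n).
Hypotheses (C2phi0 : C2_scalar phi0) (C2g : C2 g)
  (psiN : forall z, (-oo < psi z)%E) (psi_lsc : lower_semicontinuous psi).
Local Notation phi := (composite phi0 g psi).
Local Notation V x y := (gradient phi0 x + y *m ('J g x)^T).
Local Notation A := (lagrangian_hessian phi0 g).
Definition second_order_bound (s : R) : Prop :=
  exists U V : set 'rV[R]_n, [/\ nbhs xb U, nbhs (0 : 'rV[R]_n) V &
    forall (x v : 'rV[R]_n) (y u : 'rV[R]_m) (w : 'rV[R]_n),
      U x -> V v -> Lambda phi0 g psi x v y ->
      second_subdiff psi (g x) y (w *m 'J g x) u ->
      s * enorm w ^+ 2 <= second_order_form phi0 g x y u w].

Variables (K r : R).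
Hypotheses (K0 : 0 < K) (r0 : 0 < r) (sub : submersive g xb K r).

Lemma lagrangian_hessian_continuous x y (e : R) : 0 < e -> exists2 d : R, 0 < d &
  forall x' y', enorm (x' - x) < d -> enorm (y' - y) < d -> forall w,
    enorm (w *m (A x' y' - A x y)) <= e * enorm w.
Proof.
move=> e0; have e20 : 0 < e / 2 by rewrite divr_gt0.
have [_ _ hc] := C2phi0.
have [d1 d10 h1] := opcont_continuous _ _ (hc x) _ e20.
have [d2 d20 h2] := hessian_dotv_continuous g C2g x y _ e20.
exists (Num.min d1 d2) => [|x' y']; first by rewrite lt_min d10.
rewrite !lt_min => /andP[xd1 xd2] /andP[_ yd2] w.
rewrite /lagrangian_hessian opprD addrACA mulmxDr; apply: le_trans (enormD _ _) _.
rewrite [e in leRHS]splitr mulrDl; apply: lerD.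
  exact: h1 x' xd1 w.
exact: h2 x' y' xd2 yd2 w.
Qed.

Lemma second_order_approx x y u w : enorm (x - xb) < r ->
  second_subdiff psi (g x) y (w *m 'J g x) u ->
  forall e : R, 0 < e -> exists x' y' u' w',
    [/\ enorm (x' - x) < e, enorm (V x' y' - V x y) < e,
        enorm (u' - u) < e /\ enorm (w' - w) < e,
        enorm (w' *m 'J g x' - w *m 'J g x) < e /\
        (forall a, enorm (a *m (A x' y' - A x y)) <= e * enorm a)
      & regular_normal (subdiff psi) (g x') y' u' (w' *m 'J g x')].
Proof.
move=> xr /second_subdiffP[sy h] e e0; have [_ reg] := sub x xr.
have [d1 d10 h1] := lagrangian_hessian_continuous x y e e0.
have [d2 d20 h2] := adjoint_continuous phi0 g C2phi0 C2g x y e e0.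
have w10 : 0 < enorm w + 1 by rewrite ltr_wpDl.
have eK0 : 0 < e / 2 / K by rewrite !divr_gt0.
have [d3 d30 h3] := opcont_jacobian g C2g x _ (divr_gt0 eK0 w10).
have [d dE] : exists d, d = Num.min (Num.min d1 d2) (Num.min (Num.min d3 e) (r - enorm (x - xb))) by eexists.
have d0 : 0 < d by rewrite dE !lt_min d10 d20 d30 e0 subr_gt0.
have [|z' [y' [u' [q' [zz yy uu qq rn]]]]] :=
    h (Num.min (Num.min (d / K) r) (Num.min d (e / 2 / K))).
  by rewrite !lt_min d0 r0 eK0 divr_gt0.
move: zz yy uu qq; rewrite !lt_min.
move=> /andP[/andP[zd zr] _] /andP[_ /andP[yd _]] /andP[_ /andP[ud _]] /andP[_ /andP[qd qe]].
have [x' gx' x'z] := reg z' zr.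
have xd : enorm (x' - x) < d.
  by apply: le_lt_trans x'z _; rewrite mulrC -ltr_pdivlMr.
move: xd yd ud qd; rewrite dE !lt_min.
move=> /andP[/andP[xd1 xd2] /andP[/andP[xd3 xde] xdr]] /andP[/andP[yd1 yd2] _].
move=> /andP[_ /andP[/andP[_ ude] _]] /andP[_ /andP[/andP[_ qde] _]].
have x'r : enorm (x' - xb) < r.
  by apply: le_lt_trans (enorm_triangle x _ _) _; rewrite addrC -ltrBrDl.
have [[B [BJ hB]] _] := sub x' x'r.
(* The approximating normal of [psi] has an arbitrary second component [q']; correcting [w] with the
   inverse [B] at [x'] writes it as the image of a vector near [w]. *)
exists x', y', u', (w + (q' - w *m 'J g x') *m B).
have w'J : (w + (q' - w *m 'J g x') *m B) *m 'J g x' = q'.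
  move: BJ; move: ('J g x') => J' BJ.
  by rewrite mulmxDl -mulmxA BJ mulmx1 addrC subrK.
rewrite w'J gx'; split=> //; first exact: h2.
- split=> //; rewrite addrAC subrr add0r; apply: le_lt_trans (hB _) _.
  have -> : q' - w *m 'J g x' = (q' - w *m 'J g x) - w *m ('J g x' - 'J g x).
    by move: ('J g x') ('J g x) => J' J; rewrite mulmxBr opprB addrA subrK.
  have h4 := h3 x' xd3 w.
  have h5 : e / 2 / K / (enorm w + 1) * enorm w <= e / 2 / K.
    by rewrite mulrAC ler_pdivrMr // ler_wpM2l ?(ltW eK0) // lerDl.
  have h6 := enormB (q' - w *m 'J g x) (w *m ('J g x' - 'J g x)).
  apply: le_lt_trans (_ : K * (enorm (q' - w *m 'J g x) + e / 2 / K) < _).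
    rewrite (ler_pM2l K0); apply: le_trans h6 _; rewrite lerD2l.
    exact: le_trans h4 h5.
  have eE : e = K * (e / 2 / K + e / 2 / K) by field; rewrite gt_eqF.
  by rewrite [ltRHS]eE (ltr_pM2l K0) ltrD2r.
- by split=> //; exact: h1.
Qed.

(** Growth speaks of regular normals, the second-order condition of limiting ones; continuity of the
    quadratic form bridges the two. *)
Lemma second_order_limit x y u w (s : R) : enorm (x - xb) < r -> 0 <= s ->
  second_subdiff psi (g x) y (w *m 'J g x) u ->
  (exists2 d : R, 0 < d & forall x' y' u' w', enorm (x' - x) < d ->
     enorm (V x' y' - V x y) < d ->
     regular_normal (subdiff psi) (g x') y' u' (w' *m 'J g x') ->
     s * dotv w' w' <= dotv (w' *m A x' y') w' + dotv u' (w' *m 'J g x')) ->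
  s * dotv w w <= dotv (w *m A x y) w + dotv u (w *m 'J g x).
Proof.
move=> xr s0 hs [d d0 hd]; rewrite -subr_ge0; apply/ler_addgt0Pr => e e0.
have [d1 d10 h1] := quadratic_form_perturbation (A x y) u (w *m 'J g x) w s e s0 e0.
have m0 : 0 < Num.min d d1 by rewrite lt_min d0.
have [x' [y' [u' [w' [xx vv [uu ww] [qq aa] rn]]]]] := second_order_approx x y u w xr hs _ m0.
move: xx vv uu ww qq; rewrite !lt_min.
move=> /andP[xx _] /andP[vv _] /andP[_ uu] /andP[_ ww] /andP[_ qq].
have aa1 a : enorm (a *m (A x' y' - A x y)) <= d1 * enorm a.
  by apply: le_trans (aa a) _; rewrite ler_wpM2r // ge_min lexx orbT.
apply: le_trans (h1 _ _ _ _ uu qq ww aa1).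
by rewrite subr_ge0; exact: hd xx vv rn.
Qed.

Section Multiplier.
Variable yb : 'rV[R]_m.
Hypotheses (Vyb : V xb yb = 0) (syb : subdiff psi (g xb) yb)
  (phi_att : attentive phi xb).

Let xbr : enorm (xb - xb) < r.
Proof. by rewrite subrr enorm0. Qed.

Lemma stationary_composite : subdiff phi xb 0.
Proof.
by rewrite -Vyb; exact: (subdiff_composite _ _ _ _ C2phi0 C2g psiN _ _ K0 r0 sub _ _ xbr syb).
Qed.

Let phiN := composite_gtNy phi0 g psi psiN.
Let phi_lsc : lower_semicontinuous phi := composite_lsc phi0 g psi C2phi0 C2g psi_lsc.

Lemma second_order_of_growth (s rho : R) : 0 <= s -> 0 < rho ->
  growth phi xb s rho ->
  second_order_bound s.
Proof.
move=> s0 rho0 gr.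
have [d1 d10 h1] := growth_normal _ _ _ _ phiN phi_lsc stationary_composite rho0 s0 gr.
have [d2 d20 h2] := phi_att _ d10.
pose D := Num.min (Num.min (d1 / 2) (d2 / 2)) (r / 2).
have D0 : 0 < D by rewrite !lt_min !divr_gt0.
have D1 : D <= d1 / 2 by rewrite !ge_min lexx.
have D2 : D <= d2 / 2 by below_min.
have Dr : D <= r / 2 by below_min.
clearbody D.
exists (eball xb D), (eball 0 D); split; try exact: nbhs_eball.
move=> x v y u w; rewrite /eball /= subr0 => xD vD [vE sy] hs; subst v.
rewrite enorm_sq second_order_formE.
have xr : enorm (x - xb) < r := lt_half _ _ _ xD Dr r0.
apply: second_order_limit => //.
exists (Num.min D (r / 2)); first by rewrite lt_min D0 divr_gt0.
move=> x' y' u' w'; rewrite !lt_min => /andP[xx xxr] /andP[vv _] rn.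
have x'D : enorm (x' - xb) <= D + D.
  by apply: le_trans (enorm_triangle x _ _) _; rewrite lerD // ltW.
have v'D : enorm (V x' y') <= D + D.
  apply: le_trans (enorm_near _ _ _ (ltW vv)) _; by rewrite lerD2r.
have le2 d : D <= d / 2 -> D + D <= d.
  by move=> h; apply: le_trans (lerD h h) _; rewrite -splitr.
have x'r : enorm (x' - xb) < r.
  apply: le_lt_trans (enorm_triangle x _ _) _; rewrite [r]splitr.
  by apply: ltr_leD => //; exact: le_trans xD Dr.
have sv := regular_normal_composite _ _ _ _ C2phi0 C2g psiN _ _ K0 r0 sub _ _ _ _ x'r rn.
have [sv' _] := sv.
have x'1 := le_trans x'D (le2 _ D1); have v'1 := le_trans v'D (le2 _ D1).
have fx' := h2 _ _ sv' (le_trans x'D (le2 _ D2)) (le_trans v'D (le2 _ D2)).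
have := h1 _ _ _ _ x'1 v'1 fx' sv.
rewrite dotvDl (dotv_mulmxl w' (A x' y')^T) trmxK (dotvC w').
by rewrite (dotv_mulmxl u' ('J g x')^T) trmxK.
Qed.

Lemma growth_of_second_order (s : R) : 0 <= s -> prox_regular psi (g xb) yb ->
  second_order_bound s ->
  exists2 rho : R, 0 < rho & growth phi xb s rho.
Proof.
move=> s0 pr [U [W [/nbhs_enorm[dU dU0 hU] /nbhs_enorm[dW dW0 hW] h]]].
have [rr [rho [rr0 rho0 gr]]] :=
  growth_of_prox _ _ _ _ C2phi0 C2g psiN _ _ K0 r0 sub _ Vyb syb pr.
pose mu := (2 * (rr + 1))^-1.
have rr1 : 0 < rr + 1 by rewrite ltr_wpDl.
have mu0 : 0 < mu by rewrite invr_gt0 mulr_gt0.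
have mur : mu * rr <= 2^-1.
  rewrite /mu invfM -mulrA -[leRHS]mulr1 ler_pM2l ?invr_gt0 //.
  by rewrite mulrC ler_pdivrMr // mul1r lerDl.
have k0 : 0 < 1 + mu * s by rewrite ltr_pwDl // mulr_ge0 // ltW.
pose c := s / (1 + mu * s).
have c0 : 0 <= c by rewrite divr_ge0 // ltW.
have cmu : 1 - c * mu = (1 + mu * s)^-1 by rewrite /c; field; rewrite gt_eqF.
have cmu1 : c * mu < 1 by rewrite -subr_gt0 cmu invr_gt0.
have -> : s = c / (1 - c * mu) by rewrite cmu invrK /c divfK // gt_eqF.
apply: (growth_of_normals _ _ _ _ _ _ phiN phi_lsc stationary_composite rho0 gr mu0 mur c0 cmu1 phi_att).
exists (Num.min (Num.min (dU / 2) (dW / 2)) (r / 2)); first by rewrite !lt_min !divr_gt0.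
move=> x v p w; rewrite !le_min => /andP[/andP[xU _] xr] /andP[/andP[_ vW] _] rn.
have xr' : enorm (x - xb) < r := le_lt_trans xr (half_lt _ r0).
have [y [u [vE sy pE rn']]] :=
  regular_normal_composite_inv _ _ _ _ C2phi0 C2g psiN _ _ K0 r0 sub _ _ _ _ xr' rn.
have Ux : U x by apply: hU; exact: le_lt_trans xU (half_lt _ dU0).
have Wv : W v by apply: hW; rewrite subr0; exact: le_lt_trans vW (half_lt _ dW0).
have hs : second_subdiff psi (g x) y (w *m 'J g x) u.
  apply/second_subdiffP; split=> // d d0; exists (g x), y, u, (w *m 'J g x).
  by rewrite !subrr !enorm0.
have := h x v y u w Ux Wv (conj vE sy) hs; rewrite enorm_sq second_order_formE.
have -> : dotv (w *m A x y) w + dotv u (w *m 'J g x) = dotv p w.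
  rewrite pE dotvDl (dotv_mulmxl w (A x y)^T) trmxK (dotvC w).
  by rewrite (dotv_mulmxl u ('J g x)^T) trmxK.
(* With [q = w + mu p], [(1 + mu s) <p, q> - s |q|^2] equals [mu |p - s w|^2 + (1 + mu s) (<p, w> -
   s |w|^2)]. *)
move=> pw; rewrite /c mulrAC ler_pdivrMr //.
have CS : 0 <= dotv (p - s *: w) (p - s *: w) := dotvv_ge0 _.
have pp := dotvv_ge0 p; have ww := dotvv_ge0 w.
have h3 : 0 <= mu * s * (dotv p w - s * dotv w w).
  by rewrite mulr_ge0 ?subr_ge0 // mulr_ge0 // ltW.
have h4 : 0 <= mu * dotv (p - s *: w) (p - s *: w) by rewrite mulr_ge0 // ltW.
move: h4; rewrite !dotvE (dotvC w p) => h4.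
lra.
Qed.

Lemma positive_of_pointwise (mu L d0 : R) : 0 < mu -> 0 <= L -> 0 < d0 ->
  (forall x v p w, enorm (x - xb) <= d0 -> enorm v <= d0 ->
     regular_normal (subdiff phi) x v p w -> enorm p <= L * enorm (w + mu *: p)) ->
  (forall (u : 'rV[R]_m) (w : 'rV[R]_n), w != 0 ->
     second_subdiff psi (g xb) yb (w *m 'J g xb) u ->
     0 < second_order_form phi0 g xb yb u w) ->
  exists c d : R, [/\ 0 < c, 0 < d & forall x v p w,
    enorm (x - xb) <= d -> enorm v <= d -> regular_normal (subdiff phi) x v p w ->
    c * dotv (w + mu *: p) (w + mu *: p) <= dotv p (w + mu *: p)].
Proof.
move=> mu0 L0 d00 hL hpos; apply: contrapT => hno.
have bad (d : R) : 0 < d -> exists x v p w, [/\ enorm (x - xb) <= d, enorm v <= d,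
    regular_normal (subdiff phi) x v p w
    & dotv p (w + mu *: p) < d * dotv (w + mu *: p) (w + mu *: p)].
  move=> dpos; apply: contrapT => hn; apply: hno; exists d, d; split=> //.
  move=> x v p w xd vd rn; rewrite leNgt; apply/negP => lt.
  by apply: hn; exists x, v, p, w.
(* A violation is recorded as the pair of [p] and [w + mu p], the latter of norm one: regular
   normals form a cone, and [hL] keeps [p] in a fixed ball. *)
pose P (d : R) (z : 'rV[R]_(n + n)) := exists x v p w,
  [/\ z = row_mx p (w + mu *: p), enorm (x - xb) <= d /\ enorm v <= d,
      regular_normal (subdiff phi) x v p w,
      enorm (w + mu *: p) = 1 & dotv p (w + mu *: p) <= d].
have [d d' z dd' [x [v [p [w [zE [xd vd] rn q1 pq]]]]]||z zL zP] :=
    compact_cluster_point P (L + 1).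
- exists x, v, p, w; split=> //; last exact: le_trans pq dd'.
  by split; [exact: le_trans xd dd'|exact: le_trans vd dd'].
- move=> d dpos; have m0 : 0 < Num.min d d0 by rewrite lt_min dpos.
  have [x [v [p [w []]]]] := bad _ m0.
  rewrite !le_min => /andP[xd xd0] /andP[vd vd0] rn lt.
  have q0 : 0 < enorm (w + mu *: p).
    rewrite enorm_gt0; apply/negP => /eqP q0.
    by move: lt; rewrite q0 !dotv0 mulr0 ltxx.
  have k0 : 0 < (enorm (w + mu *: p))^-1 by rewrite invr_gt0.
  have pL := hL x v p w xd0 vd0 rn.
  move: lt; have rn' := regular_normalZ _ _ _ _ _ _ k0 rn.
  have qE : (enorm (w + mu *: p))^-1 *: w + mu *: ((enorm (w + mu *: p))^-1 *: p) =
      (enorm (w + mu *: p))^-1 *: (w + mu *: p).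
    by rewrite scalerDr !scalerA (mulrC mu).
  have q1 : enorm ((enorm (w + mu *: p))^-1 *: (w + mu *: p)) = 1.
    by rewrite enormZ gtr0_norm // mulVf // gt_eqF.
  rewrite -enorm_sq => lt.
  exists (row_mx ((enorm (w + mu *: p))^-1 *: p)
    ((enorm (w + mu *: p))^-1 *: (w + mu *: p))).
    apply: le_trans (enorm_row_mx _ _) _; rewrite q1 lerD2r enormZ gtr0_norm //.
    by rewrite mulrC ler_pdivrMr.
  exists x, v, ((enorm (w + mu *: p))^-1 *: p), ((enorm (w + mu *: p))^-1 *: w).
  rewrite qE; split=> //; rewrite dotvZl dotvZr mulrA -invfM -expr2 mulrC.
  rewrite ler_pdivrMr ?exprn_gt0 //; apply: le_trans (ltW lt) _.
  by rewrite ler_wpM2r ?sqr_ge0 // ge_min lexx.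
have [p0 [q0 zE]] : exists p0 q0, z = row_mx p0 q0.
  by exists (lsubmx z), (rsubmx z); rewrite hsubmxK.
have cl (d : R) : 0 < d -> exists x v p w,
    [/\ enorm (p - p0) < d, enorm (w + mu *: p - q0) < d,
        enorm (x - xb) <= d /\ enorm v <= d, regular_normal (subdiff phi) x v p w
      & enorm (w + mu *: p) = 1 /\ dotv p (w + mu *: p) <= d].
  move=> dpos; have [z' z'z [x [v [p [w [z'E xv rn q1 pq]]]]]] := zP d dpos.
  exists x, v, p, w; move: z'z; rewrite zE z'E opp_row_mx add_row_mx => lt.
  by split=> //; apply: le_lt_trans lt; [exact: enorm_row_mxl|exact: enorm_row_mxr].
have q0N : q0 != 0.
  apply/eqP => q00; have [|x [v [p [w [_ + _ _ [q1 _]]]]]] := cl 2^-1.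
    by rewrite invr_gt0.
  by rewrite q00 subr0 q1; lra.
have pq0 : dotv p0 q0 <= 0.
  apply/ler_addgt0Pr => e e0; rewrite add0r.
  have C0 : 0 < 2 + enorm p0 by rewrite ltr_pwDl.
  have [x [v [p [w [pp qq _ _ [q1 pq]]]]]] := cl _ (divr_gt0 e0 C0).
  move: pp qq pq; set d := e / _; have dE : d * (2 + enorm p0) = e by rewrite /d divfK ?gt_eqF.
  clearbody d; move: (w + mu *: p) q1 => q q1 pp qq pq.
  have -> : dotv p0 q0 = dotv p q + dotv (p0 - p) q + dotv p0 (q0 - q) by rewrite !dotvE; ring.
  have t1 : dotv (p0 - p) q <= d.
    by apply: le_trans (dotv_le_enorm _ _) _; rewrite q1 mulr1 enormBC ltW.
  have t2 : dotv p0 (q0 - q) <= enorm p0 * d.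
    by apply: le_trans (dotv_le_enorm _ _) _; rewrite ler_wpM2l // enormBC ltW.
  by rewrite -dE; lra.
have [w0 w0E] : exists w0, w0 = q0 - mu *: p0 by eexists.
have q0E : q0 = w0 + mu *: p0 by rewrite w0E subrK.
(* What is left of [p0] without the curvature of the Lagrangian: the candidate for the image, under
   the adjoint at [xb], of a limiting normal component [u0] of [psi]. *)
pose n0 := p0 - w0 *m (A xb yb)^T.
have data (e : R) : 0 < e -> exists x y u w,
    [/\ enorm (x - xb) < e /\ enorm (y - yb) < e, enorm (g x - g xb) < e,
        enorm (w - w0) < e, enorm (u *m ('J g x)^T - n0) < e
      & regular_normal (subdiff psi) (g x) y u (w *m 'J g x)].
  move=> e0; have [C C0 hC] := enorm_mulmx (A xb yb)^T.
  have W0 : 0 < enorm w0 + 1 by rewrite ltr_wpDl.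
  have e30 : 0 < e / 3 by rewrite divr_gt0.
  have eW0 : 0 < e / 3 / (enorm w0 + 1) by rewrite divr_gt0.
  have [d1 d10 h1] := lagrangian_hessian_continuous xb yb _ eW0.
  have m10 : 0 < Num.min e d1 by rewrite lt_min e0.
  have [d2 d20 h2] := multiplier_near phi0 g xb C2phi0 C2g K r K0 r0 sub yb Vyb _ m10.
  have C10 : 0 < C + 1 by rewrite ltr_wpDl.
  have Cm0 : 0 < (C + 1) * (1 + mu) by rewrite mulr_gt0 // addr_gt0.
  pose d := Num.min (Num.min (Num.min 1 (e / 2)) (Num.min (d1 / 2) d2))
    (Num.min (r / 2) (Num.min (e / 3) 1 / ((C + 1) * (1 + mu)))).
  have dpos : 0 < d.
    by rewrite !lt_min ltr01 d20 !divr_gt0 // lt_min e30 ltr01.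
  have de : d <= e / 2 by below_min.
  have dd1 : d <= d1 / 2 by below_min.
  have dd2 : d <= d2 by below_min.
  have dr : d <= r / 2 by below_min.
  have dC : d * ((C + 1) * (1 + mu)) <= Num.min (e / 3) 1.
    by rewrite -ler_pdivlMr // !ge_min lexx ?orbT.
  clearbody d; move: dC; rewrite le_min => /andP[dC1 dC2].
  have [x [v [p [w [pp qq [xd vd] rn _]]]]] := cl d dpos.
  have xr : enorm (x - xb) < r := lt_half _ _ _ xd dr r0.
  have [y [u [vE sy pE rn']]] :=
    regular_normal_composite_inv _ _ _ _ C2phi0 C2g psiN _ _ K0 r0 sub _ _ _ _ xr rn.
  rewrite vE in vd.
  have [] := h2 x y (le_trans xd dd2) (le_trans vd dd2).
  rewrite !lt_min => /andP[ye y1] /andP[ge _].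
  have ww : enorm (w - w0) <= d * (1 + mu).
    have -> : w - w0 = (w + mu *: p - q0) - mu *: (p - p0).
      by rewrite w0E; row_ring.
    apply: le_trans (enormB _ _) _; rewrite mulrDr mulr1 enormZ gtr0_norm // (mulrC d).
    by apply: lerD; [exact: ltW|rewrite (ler_pM2l mu0) ltW].
  have dmu0 : 0 <= d * (1 + mu) by rewrite mulr_ge0 ?addr_ge0 // ltW.
  have dmuC : d * (1 + mu) <= d * ((C + 1) * (1 + mu)).
    by rewrite mulrCA ler_peMl // lerDr.
  have w1 : enorm w <= enorm w0 + 1.
    by apply: enorm_near; apply: le_trans ww (le_trans dmuC dC2).
  exists x, y, u, w; split=> //.
  - by split=> //; exact: lt_half xd de e0.
  - apply: le_lt_trans (le_trans ww (le_trans dmuC dC1)) _.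
    by rewrite ltr_pdivrMr // ltr_pMr // ltr1n.
  - have -> : u *m ('J g x)^T - n0 = (p - p0)
        - (w *m (A x y - A xb yb)^T + (w - w0) *m (A xb yb)^T).
      rewrite pE /n0 trmx_sub mulmxBr mulmxBl.
      have alg (a b c f : 'rV[R]_n) : a - (p0 - f) = (b + a - p0) - (b - c + (c - f)).
        by row_ring.
      exact: alg.
    have t1 : enorm (w *m (A x y - A xb yb)^T) <= e / 3.
      have xd1 := lt_half _ _ _ xd dd1 d10.
      apply: le_trans (enorm_trmx _ _ (ltW eW0) (h1 x y xd1 y1) w) _.
      by rewrite mulrAC ler_pdivrMr // ler_wpM2l // ltW.
    have t2 : enorm ((w - w0) *m (A xb yb)^T) <= C * (d * (1 + mu)).
      by apply: le_trans (hC _) _; rewrite ler_wpM2l.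
    have t3 : C * (d * (1 + mu)) + d * (1 + mu) <= e / 3.
      by apply: le_trans dC1; le_of_eq; ring.
    have t4 : d <= d * (1 + mu) by rewrite ler_peMr ?(ltW dpos) // lerDl ltW.
    apply: le_lt_trans (enormB _ _) _.
    apply: le_lt_trans (lerD (ltW pp) (enormD _ _)) _.
    apply: le_lt_trans (_ : d + (e / 3 + C * (d * (1 + mu))) < _).
      by rewrite lerD2l; exact: lerD t1 t2.
    move: t3 t4; move: (d * (1 + mu)) => b t3 t4.
    apply: (@le_lt_trans _ _ (e / 3 + e / 3)); last first.
      by rewrite [ltRHS](_ : e = e / 3 + e / 3 + e / 3) ?ltrDl //; field.
    by rewrite addrCA lerD2l; apply: le_trans t3; rewrite addrC lerD2l.
have [|u0 u0E] := adjoint_range_closed g xb C2g K r K0 sub xb n0 xbr.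
  move=> e e0; have [x [y [u [w [[xe _] _ _ ue _]]]]] := data e e0.
  by exists x, u.
(* The cluster point controls only the images of the vectors [u] under the adjoints;
   [multiplier_stable] turns this into convergence of [u] to [u0]. *)
have hs : second_subdiff psi (g xb) yb (w0 *m 'J g xb) u0.
  apply/second_subdiffP; split=> // d dpos.
  have d20 : 0 < d / 2 by rewrite divr_gt0.
  have [d1 d10 h1] := multiplier_stable g xb C2g K r K0 sub xb u0 xbr d dpos.
  have [C [d2 [C0 d2pos h2]]] := opcont_bound _ _ (opcont_jacobian g C2g xb).
  have W0 : 0 < enorm w0 + 1 by rewrite ltr_wpDl.
  have [d3 d30 h3] := opcont_jacobian g C2g xb _ (divr_gt0 d20 W0).
  have C1 : 0 < C + 1 by rewrite ltr_wpDl.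
  have [|x [y [u [w [[xe ye] ge we ue rn]]]]] :=
      data (Num.min (Num.min d d1) (Num.min (Num.min d2 d3) (d / 2 / (C + 1)))).
    by rewrite !lt_min dpos d10 d2pos d30 divr_gt0.
  move: xe ye ge we ue; rewrite !lt_min.
  move=> /andP[/andP[_ x1] /andP[/andP[x2 x3] _]] /andP[/andP[yd _] _].
  move=> /andP[/andP[gd _] _] /andP[_ /andP[_ wd]] /andP[/andP[_ u1] _].
  exists (g x), y, u, (w *m 'J g x); split=> //.
    by apply: (h1 x) => //; rewrite -u0E.
  have {}h2 := h2 x x2 (w - w0); have {}h3 := h3 x x3 w0.
  move: h2 h3; move: ('J g x) ('J g xb) => J' J h2 h3.
  have -> : w *m J' - w0 *m J = (w - w0) *m J' + w0 *m (J' - J).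
    by rewrite mulmxBl mulmxBr addrA subrK.
  apply: le_lt_trans (enormD _ _) _; rewrite [ltRHS]splitr; apply: ltr_leD.
    apply: le_lt_trans h2 _; rewrite ltr_pdivlMr // mulrC in wd.
    by apply: le_lt_trans wd; rewrite ler_wpM2r // lerDl.
  apply: le_trans h3 _; rewrite mulrAC ler_pdivrMr // ler_wpM2l ?(ltW d20) // lerDl //.
have formE : second_order_form phi0 g xb yb u0 w0 = dotv p0 w0.
  have -> : p0 = w0 *m (A xb yb)^T + u0 *m ('J g xb)^T.
    by rewrite -u0E /n0 addrC subrK.
  rewrite second_order_formE dotvDl (dotv_mulmxl w0 (A xb yb)^T) trmxK (dotvC w0).
  by rewrite (dotv_mulmxl u0 ('J g xb)^T) trmxK.
have pp := dotvv_ge0 p0.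
have mupp : 0 <= mu * dotv p0 p0 by rewrite mulr_ge0 // ltW.
(* If [w0 = 0], then [<p0, q0> = mu |p0|^2 <= 0] forces [p0 = 0], hence [q0 = 0]; otherwise
   pointwise positivity gives [<p0, q0> = <p0, w0> + mu |p0|^2 > 0]. *)
have [w00|w0N] := eqVneq w0 0.
  move: pq0 q0N; rewrite q0E w00 add0r dotvZr => le0.
  have : dotv p0 p0 == 0.
    by rewrite eq_le pp andbT -(pmulr_rle0 _ mu0).
  by rewrite dotvv_eq0 => /eqP->; rewrite scaler0 eqxx.
have := hpos u0 w0 w0N hs; rewrite formE => pw.
by move: pq0; rewrite q0E dotvDr dotvZr leNgt ltr_wpDr.
Qed.

Lemma growth_of_pointwise : prox_regular psi (g xb) yb ->
  (forall (u : 'rV[R]_m) (w : 'rV[R]_n), w != 0 ->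
     second_subdiff psi (g xb) yb (w *m 'J g xb) u ->
     0 < second_order_form phi0 g xb yb u w) ->
  exists s rho : R, [/\ 0 < s, 0 < rho & growth phi xb s rho].
Proof.
move=> pr hpos.
have [rr [rho [rr0 rho0 gr]]] :=
  growth_of_prox _ _ _ _ C2phi0 C2g psiN _ _ K0 r0 sub _ Vyb syb pr.
pose mu := (2 * (rr + 1))^-1.
have rr1 : 0 < rr + 1 by rewrite ltr_wpDl.
have mu0 : 0 < mu by rewrite invr_gt0 mulr_gt0.
have mur : mu * rr <= 2^-1.
  rewrite /mu invfM -mulrA -[leRHS]mulr1 ler_pM2l ?invr_gt0 //.
  by rewrite mulrC ler_pdivrMr // mul1r lerDl.
have [d0 d00 hL] :=
  normal_bound _ _ _ _ _ phiN phi_lsc stationary_composite rho0 gr mu0 mur phi_att.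
have L0 : 0 <= 3 / mu by rewrite divr_ge0 // ltW.
have [c [d [c0 dpos hc]]] := positive_of_pointwise _ _ _ mu0 L0 d00 hL hpos.
(* The cap [1 / (2 mu)] secures [c' mu < 1], without which the return from the envelope to the
   function has no finite modulus. *)
pose c' := Num.min c (2^-1 / mu).
have c'0 : 0 < c' by rewrite lt_min c0 !divr_gt0 // invr_gt0.
have c'c : c' <= c by rewrite ge_min lexx.
have c'mu : c' * mu <= 2^-1 by rewrite -ler_pdivlMr // ge_min lexx orbT.
have c'mu1 : c' * mu < 1 by apply: le_lt_trans c'mu _; rewrite invf_lt1 // ltr1n.
have [|rho' rho'0 gr'] := growth_of_normals _ _ _ _ _ _ phiN phi_lsc
    stationary_composite rho0 gr mu0 mur (ltW c'0) c'mu1 phi_att.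
  exists d => // x v p w xd vd rn; apply: le_trans (hc x v p w xd vd rn).
  by rewrite ler_wpM2r ?dotvv_ge0.
exists (c' / (1 - c' * mu)), rho'; split=> //.
by rewrite divr_gt0 // subr_gt0.
Qed.

End Multiplier.
End SecondOrder.

Theorem theorem6p2 (R : realType) (n m : nat)
  (phi0 : 'rV[R]_n -> R) (g : 'rV[R]_n -> 'rV[R]_m) (psi : 'rV[R]_m -> \bar R)
  (xbar : 'rV[R]_n)
  (C2phi0 : C2_scalar phi0) (C2g : C2 g)
  (psi_proper : proper_efun psi) (psi_lsc : lower_semicontinuous psi)
  (stationary : subdiff (composite phi0 g psi) xbar 0)
  (rank_g : \rank ('J g xbar) = m) :
  (exists! ybar : 'rV[R]_m,
     gradient phi0 xbar + ybar *m ('J g xbar)^T = 0 /\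
     subdiff psi (g xbar) ybar) /\
  forall ybar : 'rV[R]_m,
    gradient phi0 xbar + ybar *m ('J g xbar)^T = 0 ->
    subdiff psi (g xbar) ybar ->
    subdiff_continuous psi (g xbar) ybar ->
    [/\ variational_sufficiency (composite phi0 g psi) xbar <->
          prox_regular psi (g xbar) ybar /\
          (exists U V : set 'rV[R]_n, [/\ nbhs xbar U, nbhs (0 : 'rV[R]_n) V &
             forall (x v : 'rV[R]_n) (y u : 'rV[R]_m) (w : 'rV[R]_n),
               U x -> V v -> Lambda phi0 g psi x v y ->
               second_subdiff psi (g x) y (w *m 'J g x) u ->
               0 <= second_order_form phi0 g x y u w]),
        forall sigma : R, 0 < sigma ->
          (strong_variational_sufficiency sigma (composite phi0 g psi) xbar <->
           prox_regular psi (g xbar) ybar /\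
           (exists U V : set 'rV[R]_n, [/\ nbhs xbar U, nbhs (0 : 'rV[R]_n) V &
              forall (x v : 'rV[R]_n) (y u : 'rV[R]_m) (w : 'rV[R]_n),
               U x -> V v -> Lambda phi0 g psi x v y ->
                second_subdiff psi (g x) y (w *m 'J g x) u ->
                sigma * enorm w ^+ 2 <= second_order_form phi0 g x y u w])),
        exists U V : set 'rV[R]_n, [/\ nbhs xbar U, nbhs (0 : 'rV[R]_n) V &
          forall x v, U x -> V v -> subdiff (composite phi0 g psi) x v ->
            exists! y, Lambda phi0 g psi x v y]
      & (exists2 sigma : R, 0 < sigma &
           strong_variational_sufficiency sigma (composite phi0 g psi) xbar) <->
        prox_regular psi (g xbar) ybar /\
        (forall (u : 'rV[R]_m) (w : 'rV[R]_n), w != 0 ->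
           second_subdiff psi (g xbar) ybar (w *m 'J g xbar) u ->
           0 < second_order_form phi0 g xbar ybar u w)].
Proof.
have [psiN _] := psi_proper.
have [K [r [K0 r0 sub]]] := submersive_near g xbar C2g rank_g.
have xbr : enorm (xbar - xbar) < r by rewrite subrr enorm0.
(* Used twice: at [xbar] it produces the multiplier, and on the ball of radius [r] it gives the
   singleton claim for every [v]. *)
have multiplier_unique x v : enorm (x - xbar) < r ->
    subdiff (composite phi0 g psi) x v -> exists! y, Lambda phi0 g psi x v y.
  move=> xr xv.
  have [y vE sy] := subdiff_composite_inv phi0 g psi xbar C2phi0 C2g psiN K r K0 r0 sub x v xr xv.
  exists y; split=> // y' [vE' _].
  apply: (jacobianT_inj g xbar K r sub x y y' xr).
  by apply: (@addrI _ (gradient phi0 x)); rewrite -vE -vE'.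
split.
  have [y [[Vy sy] uniq]] := multiplier_unique xbar 0 xbr stationary.
  by exists y; split=> // y' [Vy' sy']; apply: uniq.
move=> yb Vyb syb sc.
have phi_att := composite_attentive phi0 g psi xbar C2phi0 C2g psiN K r K0 r0 sub yb Vyb syb sc.
have phiN := composite_gtNy phi0 g psi psiN.
have phi_lsc := composite_lsc phi0 g psi C2phi0 C2g psi_lsc.
have phixb := subdiff_fin _ _ _ stationary.
have growth_prox (s rho : R) : 0 <= s -> 0 < rho ->
    growth (composite phi0 g psi) xbar s rho -> prox_regular psi (g xbar) yb.
  move=> s0 rho0 gr.
  apply: (prox_of_growth phi0 g psi xbar C2phi0 C2g psiN psi_lsc K r K0 r0 sub yb Vyb syb rho rho0).
  exact: growth_le gr.
have strong_growth (s : R) :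
    strong_variational_sufficiency s (composite phi0 g psi) xbar ->
    exists2 rho : R, 0 < rho & growth (composite phi0 g psi) xbar s rho.
  move=> [_ _ [U [V [theta [eps [wit conv]]]]]].
  exact: growth_of_witness phiN phixb wit conv.
have growth_strong (s rho : R) : 0 <= s -> 0 < rho ->
    growth (composite phi0 g psi) xbar s rho ->
    strong_variational_sufficiency s (composite phi0 g psi) xbar.
  move=> s0 rho0 gr; split=> //.
  have [U [V [eps [wit conv]]]] :=
    witness_of_growth _ _ _ _ phiN phi_lsc stationary rho0 s0 gr phi_att.
  by exists U, V, (support_envelope (composite phi0 g psi) xbar s rho), eps.
(* At modulus [0] the extra requirement is convexity of [theta] on [U], contained in its global
   convexity; (i) and (ii) thus become one statement in [s >= 0]. *)
have weak_strong : variational_sufficiency (composite phi0 g psi) xbar <->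
    strong_variational_sufficiency 0 (composite phi0 g psi) xbar.
  have shift0 (theta : 'rV[R]_n -> \bar R) :
      (fun x => theta x - (0 / 2 * enorm x ^+ 2)%:E)%E = theta.
    by apply/funext => x; rewrite mul0r mul0r sube0.
  split=> -[_ _ [U [V [theta [eps wit]]]]]; split=> //; exists U, V, theta, eps.
    split=> //; rewrite shift0; have [_ [_ _ conv _] _ _ _] := wit.
    by move=> x y t _ _; exact: conv.
  by case: wit.
have sufficiency (s : R) : 0 <= s ->
    strong_variational_sufficiency s (composite phi0 g psi) xbar <->
    prox_regular psi (g xbar) yb /\ second_order_bound phi0 g psi xbar s.
  move=> s0; split.
    move=> /strong_growth[rho rho0 gr]; split; first exact: growth_prox s0 rho0 gr.
    exact: (second_order_of_growth phi0 g psi xbar C2phi0 C2g psiN psi_lsc K r K0 r0 sub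
      yb Vyb syb phi_att s rho s0 rho0 gr).
  move=> [pr so].
  have [rho rho0 gr] := growth_of_second_order phi0 g psi xbar C2phi0 C2g psiN psi_lsc
    K r K0 r0 sub yb Vyb syb phi_att s s0 pr so.
  exact: growth_strong s0 rho0 gr.
split.
- rewrite weak_strong (sufficiency 0 (lexx 0)).
  split=> -[pr [U [V [nU nV h]]]]; split=> //; exists U, V; split=> // x v y u w Ux Vv Ly hs.
    by have := h x v y u w Ux Vv Ly hs; rewrite mul0r.
  by rewrite mul0r; exact: h Ux Vv Ly hs.
- by move=> s s0; exact: sufficiency (ltW s0).
- exists [set x | enorm (x - xbar) < r], setT; split.
  + exact: near_enorm.
  + exact: filterT.
  + by move=> x v xr _; exact: multiplier_unique.
- split=> [[s s0 /(sufficiency s (ltW s0))[pr [U [V [nU nV h]]]]]|[pr hpos]].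
    split=> // u w w0 hs.
    have := h xbar 0 yb u w (nbhs_singleton nU) (nbhs_singleton nV) (conj (esym Vyb) syb) hs.
    by apply: lt_le_trans; rewrite mulr_gt0 // exprn_gt0 // enorm_gt0.
  have [s [rho [s0 rho0 gr]]] := growth_of_pointwise phi0 g psi xbar C2phi0 C2g psiN psi_lsc
    K r K0 r0 sub yb Vyb syb phi_att pr hpos.
  by exists s => //; exact: growth_strong (ltW s0) rho0 gr.
Qed.
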